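(* Use the fixed-design multi-resolution notation of the context. Suppose $y-f^*$ has i.i.d. $N(0,\sigma^2)$ entries with $f^*=\sum_{j=1}^p\sum_{k:(j,k)\in\mathscr K}f^*_{j,k}\in\mathbb R^n$, where $f^*_{j,k}=U_{j,k}\beta^*_{j,k}$. Let $0<\epsilon\le1\le2\log(p/\epsilon)$, and let $k^*\ge k_*$ be integers with $2^{k_*-1}<2\log(p/\epsilon)\le2^{k_*}$ and $2^{k^*}\ge n^{1/(2\alpha_*+1)}$ for some $\alpha_*>0$. Let $\hat f$ be the MR-GL estimator with a constant $A_0>1$ and penalty levels $\lambda_{j,k}=\sigma_n(2^{k/2}+\sqrt{2\log(p/\epsilon)})$, where $\sigma_n=\sigma/n^{1/2}$. Let $\lambda_0=\sigma_n\sqrt{2\log(p/\epsilon)}$, $\bar f_{j,k}=f^*_{j,k}$ for $(j,k)\in\mathscr K^*$, $\bar f=\sum_{(j,k)\in\mathscr K^*}\bar f_{j,k}$, $\xi=(A_0+1)/(A_0-1)$ and $S=\{(j,k)\in\mathscr K^*:\|\bar f_{j,k}\|_{2,n}\ge A_0\lambda_{j,k}\}$. Let $q,q_0\in[0,1]$, $0\le\alpha_0\le\alpha$ with $\alpha>1/2$, $$\gamma=\frac{(2-q)(\alpha-\frac12)+(1-\frac q2-q\alpha_0)_+}{\alpha-\frac12+(1-\frac q2-q\alpha_0)_+},\qquad \rho=\frac{(1-\frac q2-q\alpha_0)_+}{\alpha-\frac12+(1-\frac q2-q\alpha_0)_+},$$ and let $q_1,q_2$ satisfy $q(1-\rho)/q_2+\rho/q_1=1$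 with $q_1\ge\rho$. Then with probability at least $1-\epsilon/\sqrt{2\log(p/\epsilon)}$, $$\|\hat f-\bar f\|_{2,n}^2+\|\hat f-f^*\|_{2,n}^2\le\frac{2\,n^{-2\alpha/(2\alpha_*+1)}M_{\alpha,1,n}^2}{4^\alpha-1}+C^*_{\rm pred}(\xi,S)\Big[4\sigma_n^{\gamma}J_{q,\alpha,\alpha_0}(k_*,k^* )M_{\alpha_0,q_2,n}^{q(1-\rho)}M_{\alpha,q_1,n}^{\rho}+\lambda_0^{2-q_0}M_{q_0,n}^{q_0,\mathrm{BR}}\Big],\quad(\ast)$$ with the option of replacing $M_{\alpha,1,n}^2$ by $O(M_{\alpha,2,n}^2)$ in the first term when condition (A) of the context holds. In particular, the following hold (on the same event) when $C^*_{\rm pred}(\xi,S)=O(1)$, condition (A) holds and $\alpha_0\ne1/q-1/2$. (i) With $q=0$, $\gamma=4\alpha/(2\alpha+1)=2-\rho$, $q_1=\rho$, $q_0=0$ and $\#\{j:f_j^*\ne0\}\le s_0$ in $(\ast)$, $$\|\hat f-f^*\|_{2,n}^2\lesssim s_0n^{-2\alpha/(2\alpha_*+1)}M_{\alpha,\infty,n}^2+s_0\sigma_n^{4\alpha/(2\alpha+1)}M_{\alpha,\infty,n}^{2/(2\alpha+1)}+s_0\lambda_0^2.$$ (ii) With $\alpha_0=\alpha$, $\gamma=\min\{4\alpha/(2\alpha+1),2-q\}$, $q_1=1$ and $q_2=q$ in $(\ast)$, $$\|\hat f-f^*\|_{2,n}^2\lesssim n^{-2\alpha/(2\alpha_*+1)}M_{\alpha,2,n}^2+\sigma_n^{\gamma}M_{\alpha,q,n}^{2-\gamma}+\lambda_0^{2-q_0}M_{q_0,n}^{q_0,\mathrm{BR}}.$$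 (iii) With $\alpha_0=0$, $\gamma=(2-q)2\alpha/(2\alpha+1-q)$, $\rho=\gamma/(2\alpha)$, $q_1=1$ and $q_2=q$ in $(\ast)$, $$\|\hat f-f^*\|_{2,n}^2\lesssim n^{-2\alpha/(2\alpha_*+1)}M_{\alpha,2,n}^2+\sigma_n^{\gamma}M_{0,q,n}^{q(1-\rho)}M_{\alpha,1,n}^{\rho}+\lambda_0^{2-q_0}M_{q_0,n}^{q_0,\mathrm{BR}}.$$
   Context: $\|u\|_{2,n}=\|u\|_2/\sqrt n$ for $u\in\mathbb R^n$; $\lesssim$ denotes inequality up to a constant factor. $\{1,\dots,p\}$ is the disjoint union of $J_0$ (parametric components) and $J_1$ (nonparametric components). With integers $0\le k_*\le k^*$, $\mathscr K=\{(j,k_* ):j\in J_0\}\cup\{(j,k):j\in J_1,k\ge k_*\}$ and $\mathscr K^*=\{(j,k_* ):j\in J_0\}\cup\{(j,k):j\in J_1,k_*\le k\le k^*\}$. Group sizes: $d_{j,k_*}=d_j^*$ for $j\in J_0$ (given positive integers), $d_{j,k}=2^{\max(k-1,k_* )}$ for $j\in J_1$. $U_{j,k}\in\mathbb R^{n\times d_{j,k}}$, $(j,k)\in\mathscr K$, are deterministic matrices and $\beta^*_{j,k}\in\mathbb R^{d_{j,k}}$; $f_j^*=\sum_{k:(j,k)\in\mathscr K}f^*_{j,k}$ (convergent series in $\mathbb R^n$). MR-GL (multi-resolution group Lasso): $\hat f=\sum_{(j,k)\in\mathscr K^*}U_{j,k}\hat\beta_{j,k}$ with $\hat\beta$ any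 minimizer over $b=(b_{j,k})$ of $\frac12\|y-\sum_{(j,k)\in\mathscr K^*}U_{j,k}b_{j,k}\|_{2,n}^2+A_0\sum_{(j,k)\in\mathscr K^*}\lambda_{j,k}\|U_{j,k}b_{j,k}\|_{2,n}$. Prediction factor: with $\mathrm{pen}_T(b)=\sum_{(j,k)\in T}\lambda_{j,k}\|U_{j,k}b_{j,k}\|_{2,n}$ and $S^c=\mathscr K^*\setminus S$, $$C_{\rm pred}(\xi,S)=\sup_b\frac{\{\mathrm{pen}_S(b)-\xi^{-1}\mathrm{pen}_{S^c}(b)\}_+^2}{(\sum_{(j,k)\in S}\lambda_{j,k}^2)\|\sum_{(j,k)\in\mathscr K^*}U_{j,k}b_{j,k}\|_{2,n}^2}\quad(0/0=0),$$ and $C^*_{\rm pred}(\xi,S)=\max\{8A_0^2,4(A_0+1)^2C_{\rm pred}(\xi,S)\}$. Sobolev-type norms: for $j\in J_1$, $\alpha\ge0$, $\|f_j^*\|_{\alpha,2,n}^2=\sum_{k=k_*+1}^\infty2^{2\alpha k}\|f^*_{j,k}\|_{2,n}^2$. Complexity measures: $M_{\alpha,q,n}^q=\sum_{j\in J_1}\|f_j^*\|_{\alpha,2,n}^q$ (so $M_{\alpha,q,n}$ is its $1/q$ power), $M_{\alpha,\infty,n}=\max_{j\in J_1}\|f^*_j\|_{\alpha,2,n}$, and $M_{q,n}^{q,\mathrm{BR}}=\sum_{j=1}^p(\lambda_{j,k_*}/\lambda_0)^{2-q}\|\bar f_{j,k_*}\|_{2,n}^q$. Values at $q=0$ are limits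 as $q\to0+$ (so $0$-th powers count nonzero terms); accordingly, when $q=0$ the factor $M_{\alpha_0,q_2,n}^{q(1-\rho)}$ is read as $\#\{j\in J_1:\|f_j^*\|_{\alpha_0,2,n}\ne0\}^{1-\rho/q_1}$ (so $q_1=1$, $q_2=q=0$ gives exponent $1-\rho$, and $q_1=\rho$ gives factor 1). For real $c$, $0\le q\le1$ and integers $0\le k_1\le k_2$: $J_c^{(q)}(k_1,k_2)=\big(\sum_{k=k_1+1}^{k_2}2^{ck/(1-q/2)}\big)^{1-q/2}$ if $c\le0$, and $J_c^{(q)}(k_1,k_2)=\big(\sum_{k=0}^{k_2-k_1-1}2^{-ck/(1-q/2)}\big)^{1-q/2}$ if $c>0$ (zero when $k_1=k_2$). With $\rho$ as in the claim, $$J_{q,\alpha,\alpha_0}(k_*,k^* )=\{(1/\rho-1)^\rho+(1/\rho-1)^{\rho-1}\}\{J^{(q)}_{1-q/2-\alpha_0q}(k_*,k^* )\}^{1-\rho}\{J^{(1)}_{\alpha-1/2}(k_*,k^* )\}^{\rho},$$ the curly prefactor being read as its limit $1$ when $\rho=0$. Condition (A): $\|f^*-\bar f\|_{2,n}^2\lesssim\sum_{j\in J_1}\big\|\sum_{k=k^*+1}^\infty f^*_{j,k}\big\|_{2,n}^2$ (the right-hand side is always at most $\frac{2^{-2\alpha k^*}}{4^\alpha-1}\sum_{j\in J_1}\|f_j^*\|_{\alpha,2,n}^2$).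
   Formalization: The formal theorem assumes d_j^* ≤ 2^{k_*} for j in J_0 (without this the bound (∗) fails), and in (i) the count of j with f_j^* ≠ 0 counts those j for which some f_{j,k}^* is nonzero, even if these sum to zero. *)

(* Defs.v *)
From HB Require Import structures.
From mathcomp Require Import all_boot all_order all_algebra.
From mathcomp Require Import all_classical all_reals all_analysis.

Set Implicit Arguments.
Unset Strict Implicit.
Unset Printing Implicit Defensive.

Import Order.TTheory GRing.Theory Num.Theory.
Import numFieldNormedType.Exports.
Local Open Scope classical_set_scope.
Local Open Scope ring_scope.

(* The components {1, ..., p} are 'I_p, and J_0 is the complement of J1.
   kl and ku stand for k_* and k^*. *)

Section Index.
Variables (p : nat) (J1 : {set 'I_p}).

(* d_{j,k}.  For j in J_0 only the value at k = kl is ever used. *)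
Definition gdim (dpar : 'I_p -> nat) (kl : nat) (j : 'I_p) (k : nat) : nat :=
  if j \in J1 then (2 ^ maxn k.-1 kl)%N else dpar j.

Definition inK (kl : nat) (j : 'I_p) (k : nat) : bool :=
  (kl <= k)%N && ((j \in J1) || (k == kl)).

Definition Kstar (kl ku : nat) : {set 'I_p * 'I_ku.+1} :=
  [set jk : 'I_p * 'I_ku.+1 | inK kl jk.1 jk.2].

End Index.

Definition norm2n (R : realType) (n : nat) (u : 'cV[R]_n) : R :=
  Num.sqrt (\sum_(i < n) u i 0 ^+ 2) / Num.sqrt n%:R.

Section Design.
Variables (R : realType) (n p : nat) (J1 : {set 'I_p}) (dpar : 'I_p -> nat).
Variables (kl ku : nat).

(* Coefficient families are indexed by all pairs (j, k); the entries outside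
   the relevant index set (K for beta^*, K^* for b) are not used. *)
Definition design := forall (j : 'I_p) (k : nat), 'M[R]_(n, gdim J1 dpar kl j k).
Definition coefs := forall (j : 'I_p) (k : nat), 'cV[R]_(gdim J1 dpar kl j k).

Variables (U : design) (lam : nat -> R).

Definition block (b : coefs) (j : 'I_p) (k : nat) : 'cV[R]_n :=
  U j k *m b j k.

Definition fit (b : coefs) : 'cV[R]_n :=
  \sum_(jk in Kstar J1 kl ku) block b jk.1 jk.2.

Definition fcomp_cvg (b : coefs) : Prop :=
  forall j, j \in J1 ->
    cvg ((fun N : nat => \sum_(kl <= k < N) block b j k) @ \oo).

Definition fcomp (b : coefs) (j : 'I_p) : 'cV[R]_n :=
  if j \in J1 then lim ((fun N : nat => \sum_(kl <= k < N) block b j k) @ \oo)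
  else block b j kl.

Definition fcomp_tail (b : coefs) (j : 'I_p) : 'cV[R]_n :=
  lim ((fun N : nat => \sum_(ku.+1 <= k < N) block b j k) @ \oo).

Definition ftrue (b : coefs) : 'cV[R]_n := \sum_(j < p) fcomp b j.

(* f_j^* as an element of the multi-resolution expansion, i.e. the family
   f_{j,k}^* , k >= k_* , is not identically zero. *)
Definition active (b : coefs) (j : 'I_p) : bool :=
  `[< exists k, inK J1 kl j k /\ block b j k <> 0 >].

Definition num_active (b : coefs) : nat := #|[pred j | active b j]|.

Definition pen (A : {set 'I_p * 'I_ku.+1}) (b : coefs) : R :=
  \sum_(jk in A) lam jk.2 * norm2n (block b jk.1 jk.2).

Definition mrgl_loss (A0 : R) (y : 'cV[R]_n) (b : coefs) : R :=
  2^-1 * norm2n (y - fit b) ^+ 2 + A0 * pen (Kstar J1 kl ku) b.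

Definition is_mrgl (A0 : R) (y : 'cV[R]_n) (bhat : coefs) : Prop :=
  forall b, mrgl_loss A0 y bhat <= mrgl_loss A0 y b.

(* Division in \bar R satisfies 0 / 0 = 0 and x / 0 = +oo for x > 0, so the
   value is +oo when the ratio is unbounded or has a null denominator only. *)
Definition Cpred (xi : R) (S : {set 'I_p * 'I_ku.+1}) : \bar R :=
  ereal_sup (range (fun b : coefs =>
    ((Num.max 0 (pen S b - xi^-1 * pen (Kstar J1 kl ku :\: S) b) ^+ 2)%:E /
     ((\sum_(jk in S) lam jk.2 ^+ 2) * norm2n (fit b) ^+ 2)%:E)%E)).

Definition Cpred_star (A0 xi : R) (S : {set 'I_p * 'I_ku.+1}) : \bar R :=
  maxe (8 * A0 ^+ 2)%:E ((4 * (A0 + 1) ^+ 2)%:E * Cpred xi S)%E.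

Definition strong_set (A0 : R) (b : coefs) : {set 'I_p * 'I_ku.+1} :=
  [set jk in Kstar J1 kl ku |
    A0 * lam jk.2 <= norm2n (block b jk.1 jk.2)].

Definition condA (cA : R) (b : coefs) : Prop :=
  norm2n (ftrue b - fit b) ^+ 2 <=
    cA * \sum_(j in J1) norm2n (fcomp_tail b j) ^+ 2.

(* ||f_j^*||_{a,2,n}, possibly +oo *)
Definition sobolev (b : coefs) (a : R) (j : 'I_p) : \bar R :=
  ((\sum_(kl.+1 <= k <oo)
     (2 `^ (2 * a * k%:R) * norm2n (block b j k) ^+ 2)%:E) `^ 2^-1)%E.

(* M_{a,r,n} for 0 < r < +oo *)
Definition Mpos (b : coefs) (a r : R) : \bar R :=
  ((\sum_(j in J1) (sobolev b a j `^ r)) `^ r^-1)%E.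

Definition M (b : coefs) (a : R) (q : \bar R) : \bar R :=
  match q with
  | +oo%E => \big[maxe/0%E]_(j in J1) sobolev b a j
  | r%:E%E => if r == 0 then lim (Mpos b a r' @[r' --> 0^'+]) else Mpos b a r
  | -oo%E => 0%E
  end.

(* the factor M_{a,q2,n}^{q (1 - rho)} *)
Definition Mfactor (b : coefs) (a q rho : R) (q1 q2 : \bar R) : \bar R :=
  if q == 0 then
    ((#|[pred j in J1 | sobolev b a j != 0%E]|%:R) `^
       (1 - fine (rho%:E / q1)%E))%:E
  else (M b a q2 `^ (q * (1 - rho)))%E.

(* M_{q,n}^{q,BR}; at q = 0 the 0-th powers count the nonzero terms, whereas
   0 `^ 0 = 1 in the library. *)
Definition MBR (lam0 : R) (b : coefs) (q : R) : R :=
  \sum_(j < p) (lam kl / lam0) `^ (2 - q) *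
    (if block b j kl == 0 then 0 else norm2n (block b j kl) `^ q).

End Design.

Section Rates.
Variable R : realType.

Definition Lpe (p : nat) (eps : R) : R := 2 * ln (p%:R / eps).

(* lambda_{j,k}, which does not depend on j *)
Definition lambda (sigman : R) (p : nat) (eps : R) (k : nat) : R :=
  sigman * (2 `^ (k%:R / 2) + Num.sqrt (Lpe p eps)).

Definition lambda0 (sigman : R) (p : nat) (eps : R) : R :=
  sigman * Num.sqrt (Lpe p eps).

Definition gap (q alpha0 : R) : R := Num.max 0 (1 - q / 2 - q * alpha0).

Definition gamma (q alpha alpha0 : R) : R :=
  ((2 - q) * (alpha - 2^-1) + gap q alpha0) / (alpha - 2^-1 + gap q alpha0).

Definition rho (q alpha alpha0 : R) : R :=
  gap q alpha0 / (alpha - 2^-1 + gap q alpha0).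

(* J_c^{(q)}(k1, k2) *)
Definition Jc (c q : R) (k1 k2 : nat) : R :=
  (if c <= 0 then \sum_(k1.+1 <= k < k2.+1) 2 `^ (c * k%:R / (1 - q / 2))
   else \sum_(0 <= k < k2 - k1) 2 `^ (- c * k%:R / (1 - q / 2)))
  `^ (1 - q / 2).

Definition Jprefactor (r : R) : R :=
  if r == 0 then 1 else (r^-1 - 1) `^ r + (r^-1 - 1) `^ (r - 1).

(* J_{q,alpha,alpha0}(kl, ku) *)
Definition Jrate (q alpha alpha0 : R) (kl ku : nat) : R :=
  let r := rho q alpha alpha0 in
  Jprefactor r * Jc (1 - q / 2 - alpha0 * q) q kl ku `^ (1 - r)
               * Jc (alpha - 2^-1) 1 kl ku `^ r.

(* q (1 - rho) / q2 + rho / q1 = 1 with q1, q2 in [0, +oo], where 1 / +oo = 0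
   and 1 / 0 = +oo.  The first disjunct is the limiting case q = q2 = 0, in
   which q / q2 stands for an arbitrary limit and q1 is left free. *)
Definition conjugate (q r : R) (q1 q2 : \bar R) : Prop :=
  (q = 0 /\ q2 = 0%E) \/
  ((q * (1 - r))%:E / q2 + r%:E / q1 = 1)%E.

End Rates.

(* Taking some of the A i equal to setT gives the product rule for every
   subfamily. *)
Definition mutually_independent (R : realType) (disp : measure_display)
    (T : measurableType disp) (P : probability T R) (n : nat)
    (X : 'I_n -> {RV P >-> R}) : Prop :=
  forall A : 'I_n -> set R, (forall i, measurable (A i)) ->
    P (\bigcap_i (X i @^-1` A i)) = (\prod_(i < n) P (X i @^-1` A i))%E.

(* normal_prob takes the standard deviation as its second parameter *)
Definition iid_normal (R : realType) (disp : measure_display)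
    (T : measurableType disp) (P : probability T R) (n : nat) (sigma : R)
    (X : 'I_n -> {RV P >-> R}) : Prop :=
  mutually_independent X /\
  (forall i (A : set R), measurable A ->
    distribution P (X i) A = normal_prob 0 sigma A).

(* Main.v *)
Require Import Defs.
From HB Require Import structures.
From mathcomp Require Import all_boot all_order all_algebra.
From mathcomp Require Import all_classical all_reals all_analysis.
From mathcomp Require Import measurable_realfun.
From mathcomp Require Import ring lra zify.

Set Implicit Arguments.
Unset Strict Implicit.
Unset Printing Implicit Defensive.

Import Order.TTheory GRing.Theory Num.Theory.
Import numFieldNormedType.Exports.
Local Open Scope classical_set_scope.
Local Open Scope ring_scope.

(* The projection of the noise onto the column space of U_{j,k} has a chi-square
   squared norm with at most d_{j,k} degrees of freedom, so a union bound over K^*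
   shows that, up to probability eps / sqrt (2 log (p / eps)), the noise is
   dominated by the penalty on every group.  On that event the convexity of the
   criterion and the definition of C_pred give an oracle inequality whose
   stochastic term is C_pred^* times the sum over K^* of
   min (lambda^2, lambda ||fbar_{j,k}||).  The level k = k_* contributes
   M_{q0}^{q0,BR}.  For k > k_* and fixed j, the levels are cut at a real
   threshold: below it the minimum is interpolated with exponent q and summed
   against the alpha0-norm by Hoelder's inequality, above it it is summed against
   the alpha-norm by Cauchy-Schwarz; the best threshold yields J_{q,alpha,alpha0},
   and Hoelder's inequality over j yields the complexity measures. *)

(** * Gaussian noise *)

(** The failure probability carries the constant 1, and this shapes the first half. A group at level
    k_* may have about as many degrees of freedom as 2 log (p / eps), so the factor 1 / sqrt (2 log
    (p / eps)) and the sum over levels must come out of the Chernoff bound with almost no slack: the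
    shares of all levels add up to about 0.965, 0.992 and 0.995 for k_* = 0, 1, 2. Hence the
    explicit rational bounds on exponentials. Everything after the noise event is deterministic, so
    one event serves all indices q, q_0, alpha, alpha_0, q_1, q_2. The Sobolev norms, the complexity
    measures and C_pred may be +oo, and 0 times +oo is 0; the delicate case is a vanishing factor
    next to an infinite one. Bounds in the extended reals are therefore split into an infinite case,
    where the other factor is shown to be positive, and a computation in the reals. Zeroth powers at
    q = 0 are counted apart, because 0 to the power 0 is 1 in the library. *)

Section Density.
Import HBNNSimple.
Local Open Scope ereal_scope.

(** The usual passage from indicators to simple functions to monotone limits, with a weight [W]
    carried along. Three choices of [W] occur: a density ([X] the identity), the constant 1 (the law
    of [X]), and the product of the factors of the other coordinates (independence). *)
Lemma ge0_integral_change_measure (R : realType) d d' (T : measurableType d)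
    (T' : measurableType d') (mu : {measure set T -> \bar R})
    (nu : {measure set T' -> \bar R}) (X : T -> T') (W : T -> R)
    (c : R) (f : T' -> R) :
  measurable_fun setT X -> measurable_fun setT W -> (forall x, 0 <= W x)%R ->
  (0 <= c)%R ->
  (forall A, measurable A ->
    \int[mu]_x (W x * \1_A (X x))%:E = c%:E * nu A) ->
  measurable_fun setT f -> (forall y, 0 <= f y)%R ->
  \int[mu]_x (W x * f (X x))%:E = c%:E * \int[nu]_y (f y)%:E.
Proof.
move=> mX mW W0 c0 H mf f0.
have mfE : measurable_fun setT (EFin \o f) by exact/measurable_EFinP.
pose h := nnsfun_approx measurableT mfE.
have cvh y : EFin \o h^~ y @ \oo --> (f y)%:E.
  by apply: cvg_nnsfun_approx => // z _; rewrite lee_fin.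
have mWh n : measurable_fun setT (fun x => (W x * h n (X x))%:E).
  by apply/measurable_EFinP; apply: measurable_funM => //;
    apply: measurableT_comp.
have -> : \int[mu]_x (W x * f (X x))%:E =
    limn (fun n => \int[mu]_x (W x * h n (X x))%:E).
  rewrite -monotone_convergence//.
  - apply: eq_integral => x _; apply/esym/cvg_lim => //.
    rewrite EFinM; under eq_fun do rewrite EFinM.
    by apply: cvgeZl => //; exact: cvh.
  - by move=> n x _; rewrite lee_fin mulr_ge0.
  - move=> x _ m n mn; rewrite lee_fin ler_wpM2l//.
    exact/lefP/nd_nnsfun_approx.
have E n : \int[mu]_x (W x * h n (X x))%:E = c%:E * \int[nu]_y (h n y)%:E.
  rewrite integralT_nnsfun sintegralE ge0_mule_fsumr; last first.
    by move=> r; exact: nnsfun_mulemu_ge0.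
  transitivity (\int[mu]_x
     (\sum_(r \in range (h n)) (r * (W x * \1_(h n @^-1` [set r]) (X x)))%:E)).
    apply: eq_integral => x _; rewrite (fimfunE (h n) (X x)) fsumEFin//.
    by rewrite mulr_fsumr; congr EFin; apply: eq_fsbigr => r _; rewrite mulrCA.
  rewrite ge0_integral_fsum//; last 2 first.
  - move=> r; apply/measurable_EFinP; apply: measurable_funM => //.
    by apply: measurable_funM => //; apply: measurableT_comp.
  - move=> r x _; rewrite lee_fin mulrCA; apply: mulr_ge0 => //.
    exact: nnfun_muleindic_ge0.
  apply: eq_fsbigr => r; rewrite inE => -[y _ <-].
  under eq_integral do rewrite EFinM.
  rewrite ge0_integralZl_EFin//.
  - by rewrite H// muleCA.
  - by move=> x _; rewrite lee_fin mulr_ge0.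
  - apply/measurable_EFinP; apply: measurable_funM => //.
    by apply: measurableT_comp.
under eq_fun do rewrite E.
apply/cvg_lim => //; apply: cvgeZl => //.
rewrite [X in _ --> X](_ : _ = limn (fun n => \int[nu]_y (h n y)%:E)); last first.
  rewrite -monotone_convergence//.
  - by apply: eq_integral => y _; apply/esym/cvg_lim => //; exact: cvh.
  - by move=> n; exact/measurable_EFinP/measurable_funP.
  - by move=> n y _; rewrite lee_fin.
  - by move=> y _ m n mn; rewrite lee_fin; exact/lefP/nd_nnsfun_approx.
apply: ereal_nondecreasing_is_cvgn => m n mn.
apply: ge0_le_integral => //.
- by move=> y _; rewrite lee_fin.
- exact/measurable_EFinP/measurable_funP.
- exact/measurable_EFinP/measurable_funP.
- by move=> y _; rewrite lee_fin; exact/lefP/nd_nnsfun_approx.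
Qed.

End Density.

Section Independence.
Local Open Scope ereal_scope.
Context (R : realType) (disp : measure_display) (T : measurableType disp).
Variables (P : probability T R) (n : nat) (X : 'I_n -> {RV P >-> R}).

(** Independence is given for events only, so indicators are traded for general functions one
    coordinate at a time. *)
Lemma mutually_independent_integral_prod (f : 'I_n -> R -> R) (m : 'I_n -> R) :
  mutually_independent X ->
  (forall i, measurable_fun setT (f i)) -> (forall i y, 0 <= f i y)%R ->
  (forall i, \int[P]_x (f i (X i x))%:E = (m i)%:E) ->
  \int[P]_x (\prod_(i < n) f i (X i x))%:E = (\prod_(i < n) m i)%:E.
Proof.
move=> ind.
(* Induction on [k]: coordinates from [k] on still carry indicators, those before [k] arbitrary
   functions; [k = 0] is the product rule for events and [k = n] the claim. *)
suff H k : forall (f : 'I_n -> R -> R) (m : 'I_n -> R),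
    (forall i : 'I_n, (k <= i)%N ->
      exists2 A : set R, measurable A & f i = \1_A) ->
    (forall i, measurable_fun setT (f i)) -> (forall i y, 0 <= f i y)%R ->
    (forall i, \int[P]_x (f i (X i x))%:E = (m i)%:E) ->
    \int[P]_x (\prod_(i < n) f i (X i x))%:E = (\prod_(i < n) m i)%:E.
  by apply: (H n) => i; rewrite leqNgt ltn_ord.
elim: k => [|k IH] {}f {}m indf mf f0 Ef.
  have /choice[A HA] : forall i, exists A : set R, measurable A /\ f i = \1_A.
    by move=> i; have [A mA fA] := indf i (leq0n _); exists A.
  have mXA i : measurable (X i @^-1` A i).
    rewrite -[X in measurable X]setTI; apply: measurable_funP => //.
    exact: (HA i).1.
  transitivity (\int[P]_x (\1_(\bigcap_i (X i @^-1` A i)) x)%:E).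
    apply: eq_integral => x _; congr EFin.
    rewrite indicE; case: (asboolP ((\bigcap_i (X i @^-1` A i)) x)) => [h|h].
      rewrite mem_set// big1// => i _; rewrite (HA i).2 indicE mem_set//.
      exact: h.
    rewrite memNset//; apply/eqP/prodf_eq0.
    have /existsNP[i hi] : ~ (forall i, A i (X i x)).
      by move=> hh; apply: h => i _; exact: hh.
    by exists i => //; rewrite (HA i).2 indicE memNset.
  rewrite integral_indic//; last first.
    by apply: fin_bigcap_measurable.
  rewrite setIT; apply: etrans (ind A (fun i => (HA i).1)) _.
  rewrite -prodEFin; apply: eq_bigr => i _; rewrite -Ef (HA i).2.
  by rewrite (integral_indic P measurableT (mXA i)) setIT.
have [nk|kn] := leqP n k.
  apply: IH => // i ki; by have := ltn_ord i; rewrite ltnNge (leq_trans nk ki).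
pose i0 := Ordinal kn.
have m0 i : (0 <= m i)%R by rewrite -lee_fin -Ef; apply: integral_ge0 => x _; rewrite lee_fin.
pose W x := (\prod_(i < n | i != i0) f i (X i x))%R.
pose c := (\prod_(i < n | i != i0) m i)%R.
transitivity (\int[P]_x (W x * f i0 (X i0 x))%:E).
  by apply: eq_integral => x _; rewrite (bigD1 i0)//= mulrC.
rewrite (@ge0_integral_change_measure _ _ _ _ _ _ (distribution P (X i0)) _ _ c)//.
- rewrite ge0_integral_distribution//=; last 2 first.
  + exact/measurable_EFinP.
  + by move=> y; rewrite lee_fin.
  by rewrite Ef -EFinM (bigD1 i0)//= mulrC.
- rewrite (_ : W = fun x => \prod_(i <- [seq i <- index_enum 'I_n | i != i0])
      f i (X i x))%R; last by apply/funext => x; rewrite big_filter.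
  by apply: measurable_prod => i _; apply: measurableT_comp.
- by move=> x; apply: prodr_ge0.
- by apply: prodr_ge0.
- move=> A mA.
  have mXA : measurable (X i0 @^-1` A).
    by rewrite -[X in measurable X]setTI; apply: measurable_funP.
  pose g i := if i == i0 then \1_A else f i.
  pose mg i := if i == i0 then fine (P (X i0 @^-1` A)) else m i.
  (* With an indicator put back at coordinate [i0] the induction hypothesis applies, and it says
     that [W] weights the law of [X i0] by the constant [c]. *)
  transitivity (\int[P]_x (\prod_(i < n) g i (X i x))%:E).
    apply: eq_integral => x _; rewrite (bigD1 i0)//= {1}/g eqxx mulrC.
    by congr (_ * _)%:E; apply: eq_bigr => i /negbTE i0i; rewrite /g i0i.
  rewrite (IH g mg).
  + rewrite (bigD1 i0)//= {1}/mg eqxx EFinM fineK ?fin_num_measure// muleC.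
    by congr (_%:E * _); apply: eq_bigr => i /negbTE i0i; rewrite /mg i0i.
  + move=> i ki; rewrite /g; case: eqP => [_|i0i]; first by exists A.
    apply: indf; rewrite ltn_neqAle ki andbT; apply/eqP => h.
    by apply: i0i; apply: val_inj.
  + by move=> i; rewrite /g; case: ifP.
  + by move=> i y; rewrite /g; case: ifP.
  + move=> i; rewrite /g /mg; case: eqP => [->|]//.
    by rewrite fineK ?fin_num_measure// (integral_indic P measurableT mXA) setIT.
Qed.

End Independence.

Section Dot.
Variables (R : realType) (n : nat).
Implicit Types (u v w : 'cV[R]_n) (Q : seq 'cV[R]_n).

Definition dot u v : R := \sum_(i < n) u i 0 * v i 0.

Lemma dotC u v : dot u v = dot v u.
Proof. by apply: eq_bigr => i _; rewrite mulrC. Qed.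

Lemma dotDl u v w : dot (u + v) w = dot u w + dot v w.
Proof. by rewrite -big_split; apply: eq_bigr => i _; rewrite mxE mulrDl. Qed.

Lemma dotDr u v w : dot w (u + v) = dot w u + dot w v.
Proof. by rewrite dotC dotDl !(dotC w). Qed.

Lemma dotZl a u v : dot (a *: u) v = a * dot u v.
Proof. by rewrite mulr_sumr; apply: eq_bigr => i _; rewrite mxE mulrA. Qed.

Lemma dotZr a u v : dot u (a *: v) = a * dot u v.
Proof. by rewrite dotC dotZl dotC. Qed.

Lemma dotNl u v : dot (- u) v = - dot u v.
Proof. by rewrite -scaleN1r dotZl mulN1r. Qed.

Lemma dotNr u v : dot u (- v) = - dot u v.
Proof. by rewrite dotC dotNl dotC. Qed.

Lemma dotBl u v w : dot (u - v) w = dot u w - dot v w.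
Proof. by rewrite dotDl dotNl. Qed.

Lemma dotBr u v w : dot w (u - v) = dot w u - dot w v.
Proof. by rewrite dotDr dotNr. Qed.

Lemma dot0l u : dot 0 u = 0.
Proof. by rewrite -(scale0r 0) dotZl mul0r. Qed.

Lemma dot0r u : dot u 0 = 0.
Proof. by rewrite dotC dot0l. Qed.

Lemma dot_ge0 u : 0 <= dot u u.
Proof. by apply: sumr_ge0 => i _; rewrite -expr2 sqr_ge0. Qed.

Lemma dot_eq0 u : (dot u u == 0) = (u == 0).
Proof.
apply/idP/eqP => [|->]; last by rewrite dot0l.
rewrite psumr_eq0 => [/allP h|i _]; last by rewrite -expr2 sqr_ge0.
apply/colP => i; rewrite mxE; apply/eqP.
by have := h i (mem_index_enum _); rewrite /= -expr2 sqrf_eq0.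
Qed.

Lemma dot_suml (I : Type) (s : seq I) (P : pred I) (F : I -> 'cV[R]_n) v :
  dot (\sum_(i <- s | P i) F i) v = \sum_(i <- s | P i) dot (F i) v.
Proof. by apply: (big_morph (dot^~ v)) => [x y|]; rewrite ?dotDl ?dot0l. Qed.

(** Recursive on the list because both uses, [gram_schmidt] and [mgf_quadratic], add one vector at a
    time. *)
Fixpoint orthonormal_seq Q : Prop :=
  if Q is q :: Q' then
    [/\ dot q q = 1, (forall q', q' \in Q' -> dot q q' = 0) & orthonormal_seq Q']
  else True.

End Dot.

Section Gaussian.
Variable R : realType.
Local Open Scope ereal_scope.

Lemma integral_normal_prob (m s : R) (f : R -> R) :
  measurable_fun setT f -> (forall y, 0 <= f y)%R ->
  \int[normal_prob m s]_x (f x)%:E =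
  \int[lebesgue_measure]_x (normal_pdf m s x * f x)%:E.
Proof.
move=> mf f0.
rewrite [RHS](@ge0_integral_change_measure _ _ _ _ _ _ (normal_prob m s) idfun (normal_pdf m s) 1%R)//.
- by rewrite mul1e.
- exact: measurable_id.
- exact: measurable_normal_pdf.
- by move=> x; exact: normal_pdf_ge0.
- move=> A mA; rewrite mul1e /normal_prob [RHS]integral_mkcond.
  apply: eq_integral => x _; rewrite patchE indicE.
  by case: ifP => _; rewrite ?mulr1 ?mulr0.
Qed.

(** Completing the square: the density times the exponential is the claimed constant times the
    normal density of mean [a * tau ^+ 2] and deviation [tau], whose integral is 1. The condition on
    [t] keeps [th] positive. *)
Lemma integral_normal_exp_quadratic (s a t : R) :
  (s != 0)%R -> (2 * t * s ^+ 2 < 1)%R ->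
  \int[normal_prob 0 s]_x (expR (a * x + t * x ^+ 2))%:E =
  ((Num.sqrt (1 - 2 * t * s ^+ 2))^-1 *
   expR (a ^+ 2 * s ^+ 2 / (2 * (1 - 2 * t * s ^+ 2))))%:E.
Proof.
move=> s0 ts1; set th := (1 - 2 * t * s ^+ 2)%R.
have th0 : (0 < th)%R by rewrite subr_gt0.
have s20 : (0 < s ^+ 2)%R by rewrite exprn_even_gt0.
pose tau := (`|s| / Num.sqrt th)%R.
have sth0 : (0 < Num.sqrt th)%R by rewrite sqrtr_gt0.
have tau0 : (0 < tau)%R by rewrite divr_gt0// normr_gt0.
have tau2 : (tau ^+ 2 = s ^+ 2 / th)%R.
  by rewrite /tau expr_div_n real_normK ?num_real// sqr_sqrtr// ltW.
have tau20 : (0 < tau ^+ 2)%R by rewrite tau2 divr_gt0.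
rewrite integral_normal_prob; last 2 first.
- apply: measurableT_comp => //; apply: measurable_funD.
    by apply: measurable_funM.
  by apply: measurable_funM => //; exact: measurable_funX.
- by move=> y; exact: expR_ge0.
set c := (_ * expR _)%R.
have c0 : (0 <= c)%R by rewrite mulr_ge0 ?expR_ge0// invr_ge0 ltW.
transitivity (\int[lebesgue_measure]_x
    (c%:E * (normal_pdf (a * tau ^+ 2) tau x)%:E)); last first.
  rewrite ge0_integralZl_EFin//; first by rewrite integral_normal_pdf mule1.
  - by move=> x _; rewrite lee_fin normal_pdf_ge0.
  - by apply/measurable_EFinP; exact: measurable_normal_pdf.
apply: eq_integral => x _; rewrite -EFinM; congr EFin.
rewrite (normal_pdfE _ s0) (normal_pdfE _ (lt0r_neq0 tau0)).
have peakE : (normal_peak s = (Num.sqrt th)^-1 * normal_peak tau)%R.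
  rewrite /normal_peak -!mulrnAr tau2.
  rewrite (sqrtrM (pi *+ 2) (ltW s20)).
  rewrite (@sqrtrM _ (s ^+ 2 / th)%R) ?divr_ge0 ?ltW//.
  rewrite (@sqrtrM _ (s ^+ 2)%R) ?ltW// sqrtrV ?ltW//.
  have : (0 < Num.sqrt (s ^+ 2))%R by rewrite sqrtr_gt0.
  have : (0 < Num.sqrt (pi *+ 2 : R))%R by rewrite sqrtr_gt0 mulrn_wgt0// pi_gt0.
  by move=> p0 q0; field; rewrite !gt_eqF.
rewrite peakE /c /normal_fun.
have -> (e1 e2 : R) : ((Num.sqrt th)^-1 * normal_peak tau * expR e1 * expR e2 =
    (Num.sqrt th)^-1 * normal_peak tau * expR (e1 + e2))%R.
  by rewrite expRD mulrA.
have -> (e1 e2 : R) : ((Num.sqrt th)^-1 * expR e1 * (normal_peak tau * expR e2) =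
    (Num.sqrt th)^-1 * normal_peak tau * expR (e1 + e2))%R.
  by rewrite expRD; ring.
congr (_ * expR _)%R.
rewrite tau2 /th; field.
by rewrite s0 -/th gt_eqF.
Qed.

End Gaussian.

Section Mgf.
Variables (R : realType) (disp : measure_display) (T : measurableType disp).
Variables (P : probability T R) (n : nat) (Z : T -> 'cV[R]_n).
Hypothesis mZ : forall i, measurable_fun setT (fun w => Z w i 0).
Hypothesis mgfZ : forall c : 'cV[R]_n,
  (\int[P]_w (expR (dot c (Z w)))%:E = (expR (dot c c / 2))%:E)%E.

Lemma measurable_dot (c : 'cV[R]_n) : measurable_fun setT (fun w => dot c (Z w)).
Proof. by apply: measurable_sum => i; apply: measurable_funM. Qed.

(** Only exponential moments of linear forms are known, so each square is linearised: exp (s x^2) is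
    the mean of exp (sqrt (2 s) g x) over a standard normal g. The free linear term [c] absorbs sqrt
    (2 s) g q, which lets the induction on [Q] proceed. *)
Lemma mgf_quadratic (s : R) (Q : seq 'cV[R]_n) : 0 <= s -> 2 * s < 1 ->
  orthonormal_seq Q -> forall c : 'cV[R]_n,
  (\int[P]_w (expR (dot c (Z w) + s * \sum_(q <- Q) dot q (Z w) ^+ 2))%:E =
   ((Num.sqrt (1 - 2 * s))^-1 ^+ size Q *
    expR (dot c c / 2 + s / (1 - 2 * s) * \sum_(q <- Q) dot q c ^+ 2))%:E)%E.
Proof.
move=> s0 s1; have th0 : 0 < 1 - 2 * s by rewrite subr_gt0.
elim: Q => [_ c|q Q IH [qq qQ oQ] c].
  under eq_integral do rewrite big_nil mulr0 addr0.
  by rewrite mgfZ big_nil mulr0 addr0 expr0 mul1r.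
pose k := Num.sqrt (2 * s).
have k2 : k ^+ 2 = 2 * s by rewrite sqr_sqrtr// mulr_ge0.
pose f (z : T * R) :=
  expR (dot (c + (k * z.2) *: q) (Z z.1) + s * \sum_(q <- Q) dot q (Z z.1) ^+ 2).
have mf : measurable_fun setT (EFin \o f).
  apply/measurable_EFinP; apply: measurableT_comp => //.
  apply: measurable_funD.
    rewrite (_ : (fun _ => _) = fun z : T * R =>
      dot c (Z z.1) + k * z.2 * dot q (Z z.1)); last first.
      by apply/funext => z; rewrite dotDl dotZl.
    apply: measurable_funD.
      by apply: (measurableT_comp (measurable_dot c)); exact: measurable_fst.
    apply: measurable_funM.
      by apply: measurable_funM => //; exact: measurable_snd.
    by apply: (measurableT_comp (measurable_dot q)); exact: measurable_fst.
  apply: measurable_funM => //; apply: measurable_sum => q'.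
  apply: measurable_funX.
  by apply: (measurableT_comp (measurable_dot q')); exact: measurable_fst.
have f0 z : (0 <= (EFin \o f) z)%E by rewrite lee_fin expR_ge0.
transitivity (\int[P]_w \int[normal_prob 0%R 1%R]_g (f (w, g))%:E)%E.
  apply: eq_integral => w _.
  under eq_integral => g _.
    rewrite /f /= dotDl dotZl (_ : _ + _ =
      (dot c (Z w) + s * \sum_(q <- Q) dot q (Z w) ^+ 2) +
      ((k * dot q (Z w)) * g + 0 * g ^+ 2)); last by ring.
    rewrite expRD EFinM.
    over.
  rewrite ge0_integralZl_EFin ?expR_ge0//; last first.
    apply/measurable_EFinP; apply: measurableT_comp => //.
    apply: measurable_funD; first by apply: measurable_funM.
    by apply: measurable_funM => //; exact: measurable_funX.
  rewrite integral_normal_exp_quadratic ?oner_neq0 ?mulr0 ?mul0r//.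
  have -> : 1 - 0 = 1 :> R by ring.
  rewrite sqrtr1 invr1 mul1r -EFinM -expRD; congr (expR _)%:E.
  by rewrite big_cons exprMn k2; field.
(* By Tonelli the noise is integrated first, through the induction hypothesis, and the auxiliary
   normal variable last. *)
transitivity (\int[normal_prob 0%R 1%R]_g \int[P]_w (f (w, g))%:E)%E.
  exact: (@fubini_tonelli _ _ _ _ _ P (normal_prob 0 1) (EFin \o f) mf f0).
under eq_integral => g _.
  rewrite /f /= IH//.
  rewrite (_ : dot _ _ / 2 + _ = (dot c c / 2 +
      s / (1 - 2 * s) * \sum_(q <- Q) dot q c ^+ 2) +
      ((k * dot q c) * g + s * g ^+ 2)); last first.
    (* Moving [c] along [q] leaves its products with the remaining, orthogonal directions
       unchanged. *)
    have -> : \sum_(q0 <- Q) dot q0 (c + (k * g) *: q) ^+ 2 =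
              \sum_(q <- Q) dot q c ^+ 2.
      rewrite big_seq [RHS]big_seq; apply: eq_bigr => q' q'Q.
      by rewrite dotDr dotZr (dotC q' q) qQ// mulr0 addr0.
    rewrite dotDl !dotDr !dotZl !dotZr qq (dotC c q).
    have -> : s = k ^+ 2 / 2 by rewrite k2; field.
    field; rewrite k2; apply/eqP; lra.
  rewrite expRD mulrA EFinM.
  over.
rewrite ge0_integralZl_EFin; last 4 first.
- exact: measurableT.
- by move=> g _; rewrite lee_fin expR_ge0.
- apply/measurable_EFinP; apply: measurableT_comp => //.
  apply: measurable_funD; first by apply: measurable_funM.
  by apply: measurable_funM => //; exact: measurable_funX.
- by rewrite mulr_ge0 ?expR_ge0// exprn_ge0// invr_ge0.
rewrite integral_normal_exp_quadratic ?oner_neq0//; last by lra.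
rewrite -EFinM; congr EFin; rewrite big_cons /= !expr1n !mulr1 mulrACA.
rewrite (mulrC (_ ^+ size Q)) -expRD -exprS; congr (_ * expR _).
rewrite exprMn k2; field; apply/eqP; lra.
Qed.

End Mgf.

(** * Orthonormal bases and projections *)

Section GramSchmidt.
Variables (R : realType) (n : nat).
Implicit Types (u v w q : 'cV[R]_n) (Q : seq 'cV[R]_n).

Definition projs Q v : 'cV[R]_n := \sum_(q <- Q) dot q v *: q.

Lemma dot_orthonormal_sum Q (a : 'cV[R]_n -> R) q : orthonormal_seq Q -> q \in Q ->
  dot q (\sum_(q' <- Q) a q' *: q') = a q.
Proof.
elim: Q => // p Q IH /= [pp pQ oQ]; rewrite inE big_cons dotDr dotZr.
have [->|qp /= qQ] := eqVneq q p.
  move=> _; rewrite pp mulr1 dotC dot_suml big_seq big1 ?addr0// => q' q'Q.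
  by rewrite dotZl dotC pQ// mulr0.
by rewrite dotC pQ// mulr0 add0r IH.
Qed.

(** A vector whose residual [r] vanishes adds nothing to [Q], hence an inequality between the sizes;
    design matrices of deficient rank are thus covered. *)
Lemma gram_schmidt (s : seq 'cV[R]_n) : exists Q,
  [/\ orthonormal_seq Q, (size Q <= size s)%N & forall v, v \in s -> v = projs Q v].
Proof.
elim: s => [|v s [Q [oQ sQ vQ]]]; first by exists [::].
pose r := v - projs Q v.
have rQ q : q \in Q -> dot q r = 0.
  by move=> qQ; rewrite dotBr (@dot_orthonormal_sum Q (fun u => dot u v))// subrr.
have [r0|rN0] := eqVneq r 0.
  exists Q; split => //=; first exact: leqW.
  move=> u; rewrite inE => /orP[/eqP ->|]; last exact: vQ.
  by apply/eqP; rewrite -subr_eq0 -/(r) r0.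
have rr : 0 < dot r r by rewrite lt_def dot_eq0 rN0 dot_ge0.
have [k k0 kk] : exists2 k, 0 < k & dot r r = k ^+ 2.
  by exists (Num.sqrt (dot r r)); rewrite ?sqrtr_gt0// sqr_sqrtr// ltW.
pose q0 := k^-1 *: r.
have q0Q u : (forall q, q \in Q -> dot q u = 0) -> dot u (projs Q v) = 0.
  move=> h; rewrite dotC dot_suml big_seq big1// => q qQ.
  by rewrite dotZl h// mulr0.
exists (q0 :: Q); split => /=; last 1 first.
- move=> u; rewrite inE /projs big_cons => /orP[/eqP ->|us].
    rewrite -/(projs Q v) {2}/q0 scalerA dotZl.
    have -> : dot r v = dot r r.
      by rewrite [in RHS]/r dotBr q0Q ?subr0.
    rewrite kk (_ : _ * _ = 1) ?scale1r ?subrK//.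
    by field; rewrite gt_eqF.
  rewrite -/(projs Q u) -vQ// dotZl.
  rewrite (_ : dot r u = 0) ?mulr0 ?scale0r ?add0r//.
  rewrite (vQ u us) dotC dot_suml big_seq big1// => q qQ.
  by rewrite dotZl rQ// mulr0.
- split => //; first by rewrite dotZl dotZr kk; field; rewrite gt_eqF.
  by move=> q qQ; rewrite dotZl dotC rQ// mulr0.
- by rewrite ltnS.
Qed.

Lemma colspace_orthonormal d (U : 'M[R]_(n, d)) : exists Q,
  [/\ orthonormal_seq Q, (size Q <= d)%N & forall b : 'cV_d, U *m b = projs Q (U *m b)].
Proof.
have [Q [oQ sQ H]] := gram_schmidt [seq col j U | j <- enum 'I_d].
exists Q; split => //; first by move: sQ; rewrite size_map size_enum_ord.
move=> b.
have UbE : U *m b = \sum_j b j 0 *: col j U.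
  apply/colP => i; rewrite mxE summxE; apply: eq_bigr => j _.
  by rewrite !mxE mulrC.
rewrite [in LHS]UbE /projs UbE.
transitivity (\sum_j \sum_(q <- Q) (b j 0 * dot q (col j U)) *: q).
  apply: eq_bigr => j _; rewrite [in LHS](H (col j U)).
    by rewrite scaler_sumr; apply: eq_bigr => q _; rewrite scalerA.
  by apply: map_f; rewrite mem_enum.
rewrite exchange_big; apply: eq_bigr => q _ /=.
rewrite -scaler_suml; congr (_ *: _).
by rewrite dotC dot_suml; apply: eq_bigr => j _; rewrite dotZl dotC.
Qed.

Lemma dot_proj Q v w : v = projs Q v -> dot w v = \sum_(q <- Q) dot q v * dot q w.
Proof.
by move=> vE; rewrite dotC {1}vE dot_suml; apply: eq_bigr => q _; rewrite dotZl.
Qed.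

Lemma sum_sqr_dot_proj Q v : v = projs Q v ->
  \sum_(q <- Q) dot q v ^+ 2 = dot v v.
Proof. by move=> vE; rewrite (dot_proj v vE); apply: eq_bigr => q _; rewrite expr2. Qed.

Lemma cauchy_schwarz_seq (I : Type) (s : seq I) (f g : I -> R) :
  (\sum_(i <- s) f i * g i) ^+ 2 <=
  (\sum_(i <- s) f i ^+ 2) * (\sum_(i <- s) g i ^+ 2).
Proof.
set A := \sum_(i <- s) f i ^+ 2; set B := \sum_(i <- s) g i ^+ 2.
set C := \sum_(i <- s) f i * g i.
have H t : 0 <= A * t ^+ 2 - 2 * t * C + B.
  have -> : A * t ^+ 2 - 2 * t * C + B = \sum_(i <- s) (t * f i - g i) ^+ 2.
    rewrite mulr_suml mulr_sumr -sumrB -big_split; apply: eq_bigr => i _ /=; ring.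
  by apply: sumr_ge0 => i _; rewrite sqr_ge0.
have A0 : 0 <= A by apply: sumr_ge0 => i _; rewrite sqr_ge0.
have [A_0|AN0] := eqVneq A 0.
  (* With [A = 0] the form is affine in [t], and at this [t] it would equal -1 unless [C = 0]. *)
  rewrite A_0 mul0r; have := H ((B + 1) / (2 * C)).
  have [->|C0] := eqVneq C 0; first by rewrite expr0n.
  rewrite A_0 mul0r sub0r.
  have -> : 2 * ((B + 1) / (2 * C)) * C = B + 1 by field.
  lra.
have Ap : 0 < A by rewrite lt_def AN0.
have := H (C / A).
have -> : A * (C / A) ^+ 2 - 2 * (C / A) * C + B = (A * B - C ^+ 2) / A.
  by field; rewrite gt_eqF.
by rewrite pmulr_lge0 ?invr_gt0// subr_ge0.
Qed.

(** Only the projection of [w] on the span of [Q] is seen by [v]. This replaces the supremum over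
    all coefficient vectors of a group by a single chi-square variable. *)
Lemma dot_le_proj Q v w : v = projs Q v ->
  dot w v <= Num.sqrt (\sum_(q <- Q) dot q w ^+ 2) * Num.sqrt (dot v v).
Proof.
move=> vE; rewrite (dot_proj w vE) -sqrtrM; last first.
  by apply: sumr_ge0 => q _; rewrite sqr_ge0.
apply: le_trans (ler_norm _) _; rewrite -sqrtr_sqr ler_wsqrtr//.
by apply: le_trans (cauchy_schwarz_seq _ _ _) _; rewrite (sum_sqr_dot_proj vE) mulrC.
Qed.

End GramSchmidt.

(** * Chi-square tails from exponential moments *)

Section Tail.
Variables (R : realType) (disp : measure_display) (T : measurableType disp).
Variables (P : probability T R) (n : nat) (Z : T -> 'cV[R]_n).
Hypothesis mZ : forall i, measurable_fun setT (fun w => Z w i 0).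
Hypothesis mgfZ : forall c : 'cV[R]_n,
  (\int[P]_w (expR (dot c (Z w)))%:E = (expR (dot c c / 2))%:E)%E.

Lemma measurable_sum_sqr_dot Q :
  measurable_fun setT (fun w => \sum_(q <- Q) dot q (Z w) ^+ 2).
Proof.
by apply: measurable_sum => q; apply: measurable_funX; exact: measurable_dot.
Qed.

Lemma measurable_tail Q a :
  measurable [set w | a < \sum_(q <- Q) dot q (Z w) ^+ 2].
Proof.
rewrite (_ : [set w | _] =
  (fun w => \sum_(q <- Q) dot q (Z w) ^+ 2) @^-1` `]a, +oo[); last first.
  by apply/seteqP; split => w /=; rewrite in_itv/= andbT.
rewrite -[X in measurable X]setTI; apply: measurable_sum_sqr_dot => //.
Qed.

(* Markov's inequality for [exp (s W) - 1] rather than [exp (s W)]: the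
   subtracted 1 is what makes the union bound close for small group sizes. *)
Lemma chi2_tail (Q : seq 'cV[R]_n) d (th a : R) : orthonormal_seq Q ->
  (size Q <= d)%N -> 0 < th < 1 -> 0 < a ->
  (P [set w | (a < \sum_(q <- Q) dot q (Z w) ^+ 2)%R] <=
   (((Num.sqrt th)^-1 ^+ d - 1) / (expR ((1 - th) / 2 * a) - 1))%:E)%E.
Proof.
move=> oQ sQ /andP[th0 th1] a0; set A := [set w | _].
have [s [s0 s1 ths]] : exists s, [/\ 0 < s, 2 * s < 1 & 1 - 2 * s = th].
  by exists ((1 - th) / 2); split; [lra|lra|field].
have -> : (1 - th) / 2 = s by rewrite -ths; field.
have mA : measurable A by exact: measurable_tail.
have mS := measurable_sum_sqr_dot Q.
have e1 : 1 < expR (s * a) by rewrite expR_gt1 mulr_gt0.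
have := @mgf_quadratic _ _ _ P _ _ mZ mgfZ s Q (ltW s0) s1 oQ 0.
have -> : \sum_(q <- Q) dot q (0 : 'cV[R]_n) ^+ 2 = 0.
  by rewrite big1// => q _; rewrite dot0r expr0n.
rewrite ths dot0l mul0r add0r mulr0 expR0 mulr1 => E.
have c0 : 0 <= expR (s * a) - 1 by rewrite subr_ge0 ltW.
(* Pointwise, exp (s a) - 1 times the indicator of [A], plus 1, is at most exp (s W), where W >= 0
   is the sum of squares; this is integrated. *)
have le : ((expR (s * a) - 1)%:E * P A + 1 <= ((Num.sqrt th)^-1 ^+ size Q)%:E)%E.
  rewrite -E; apply: (@le_trans _ _
      (\int[P]_w (((expR (s * a) - 1) * \1_A w)%:E + 1))%E); last first.
    apply: ge0_le_integral => //.
    - by move=> w _; rewrite -EFinD lee_fin addr_ge0// mulr_ge0// indicE.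
    - apply/measurable_EFinP; apply: measurable_funD => //.
      by apply: measurable_funM => //; exact: measurable_indic.
    - apply/measurable_EFinP; apply: measurableT_comp => //.
      apply: measurable_funD; first exact: measurable_dot.
      exact: measurable_funM.
    - move=> w _; rewrite -EFinD lee_fin dot0l add0r indicE.
      have [wA|wA] := boolP (w \in A).
        rewrite mulr1 subrK ler_expR ler_wpM2l ?ltW//.
        by move: wA; rewrite inE.
      rewrite mulr0 add0r -expR0 ler_expR mulr_ge0 ?(ltW s0)//.
      by apply: sumr_ge0 => q _; rewrite sqr_ge0.
  rewrite ge0_integralD//; last 2 first.
  - by move=> w _; rewrite lee_fin mulr_ge0// indicE.
  - apply/measurable_EFinP.
    by apply: measurable_funM => //; exact: measurable_indic.
  have -> : (\int[P]_w 1 = 1)%E.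
    by apply: etrans (integral_cst P measurableT 1%E) _; rewrite mul1e; exact: probability_setT.
  rewrite leeD2r//.
  under eq_integral do rewrite EFinM.
  rewrite ge0_integralZl_EFin//; last first.
    by apply/measurable_EFinP; exact: measurable_indic.
  by rewrite (integral_indic P measurableT mA) setIT.
have PA : P A \is a fin_num by apply: fin_num_measure.
rewrite -(fineK PA) -EFinM -EFinD lee_fin in le.
rewrite -(fineK PA) lee_fin ler_pdivlMr ?subr_gt0// mulrC lerBrDr.
apply: le_trans le _.
have k1 : 1 <= (Num.sqrt th)^-1.
  have st0 : 0 < Num.sqrt th by rewrite sqrtr_gt0.
  by rewrite invf_ge1// -sqrtr1 ler_wsqrtr// ltW.
exact: ler_weXn2l.
Qed.

End Tail.

Section NormalNoise.
Variables (R : realType) (disp : measure_display) (T : measurableType disp).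
Variables (P : probability T R) (n : nat) (sigma : R).
Variable X : 'I_n -> {RV P >-> R}.
Hypothesis s0 : 0 < sigma.
Hypothesis normX : iid_normal sigma X.

Definition std_noise (w : T) : 'cV[R]_n := sigma^-1 *: \col_i X i w.

Lemma measurable_std_noise i : measurable_fun setT (fun w => std_noise w i 0).
Proof.
rewrite (_ : (fun w => _) = fun w => sigma^-1 * X i w).
  by apply: measurable_funM.
by apply/funext => w; rewrite !mxE.
Qed.

(** The product rule reduces this to scalar Gaussian integrals with no quadratic term. Beyond
    measurability, it is the only property of the noise that the tail bounds use. *)
Lemma mgf_std_noise (c : 'cV[R]_n) :
  (\int[P]_w (expR (dot c (std_noise w)))%:E = (expR (dot c c / 2))%:E)%E.
Proof.
pose f i (y : R) := expR (c i 0 / sigma * y).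
have mf i : measurable_fun setT (f i).
  by apply: measurableT_comp => //; apply: measurable_funM.
have f0 i y : 0 <= f i y by exact: expR_ge0.
transitivity (\int[P]_w (\prod_(i < n) f i (X i w))%:E)%E.
  apply: eq_integral => w _; rewrite -expR_sum; congr (expR _)%:E.
  by apply: eq_bigr => i _; rewrite !mxE mulrA.
rewrite (mutually_independent_integral_prod (m := fun i => expR (c i 0 ^+ 2 / 2)))//.
- rewrite -expR_sum; congr (expR _)%:E.
  by rewrite mulr_suml; apply: eq_bigr => i _; rewrite expr2.
- exact: normX.1.
- move=> i.
  have mXi A : measurable A -> measurable (X i @^-1` A).
    by move=> mA; rewrite -[X in measurable X]setTI; exact: measurable_funP.
  transitivity (\int[P]_w (1 * f i (X i w))%:E)%E.
    by apply: eq_integral => w _; rewrite mul1r.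
  rewrite (@ge0_integral_change_measure _ _ _ _ _ P (normal_prob 0 sigma)
    (X i) (cst 1) 1 (f i))//; last 3 first.
  - exact (measurable_funPT (X i)).
  - move=> A mA; rewrite mul1e.
    apply: etrans (normX.2 i A mA); under eq_integral do rewrite mul1r.
    by rewrite (integral_indic P measurableT (mXi A mA)) setIT.
  - exact (mf i).
  transitivity (\int[normal_prob 0 sigma]_y
      (expR (c i 0 / sigma * y + 0 * y ^+ 2))%:E)%E.
    by rewrite mul1e; apply: eq_integral => y _; rewrite mul0r addr0.
  rewrite integral_normal_exp_quadratic ?mulr0 ?mul0r ?gt_eqF//.
  rewrite subr0 sqrtr1 invr1 mul1r; congr (expR _)%:E.
  by field; rewrite gt_eqF.
Qed.

End NormalNoise.

(** * Numerical chi-square tail bounds *)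

Section Numerics.
Variable R : realType.

Lemma expR_taylor_le (n : nat) (x : R) : 0 <= x ->
  \sum_(0 <= k < n) x ^+ k / k`!%:R <= expR x.
Proof.
move=> x0; apply: (@nondecreasing_cvgn_le _ (series (exp_coeff x))).
- by apply: nondecreasing_series => k _ _; rewrite /exp_coeff divr_ge0// exprn_ge0.
- exact: is_cvg_series_exp_coeff.
Qed.

(** Taylor polynomial of degree six in Horner form: for rational [x] and [c] the premise is rational
    arithmetic, which [lra] decides. *)
Lemma expR_lb6 (x c : R) : 0 <= x ->
  c <= 1 + x * (1 + x / 2 * (1 + x / 3 * (1 + x / 4 * (1 + x / 5 * (1 + x / 6))))) ->
  c <= expR x.
Proof.
move=> x0 /le_trans; apply; apply: le_trans (expR_taylor_le 7 x0).
rewrite !big_nat_recr//= big_geq// !factS fact0 !natrM.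
rewrite [leLHS](_ : _ = 0 + x ^+ 0 / 1 + x ^+ 1 / 1 + x ^+ 2 / 2 + x ^+ 3 / 6 + x ^+ 4 / 24
  + x ^+ 5 / 120 + x ^+ 6 / 720); last by field.
by rewrite le_eqVlt; apply/orP; left; apply/eqP; field.
Qed.

(** Halving the argument keeps the degree-six polynomial accurate for larger [x]. *)
Lemma expR_half_le (x c : R) : 0 <= c -> c <= expR (x / 2) -> c ^+ 2 <= expR x.
Proof.
move=> c0 h; rewrite (splitr x) expRD -expr2.
by rewrite ler_pXn2r// nnegrE expR_ge0.
Qed.

Lemma expRN_le (x c : R) : 0 < c -> c^-1 <= expR x -> expR (- x) <= c.
Proof. by move=> c0 h; rewrite expRN -(invrK c) lef_pV2// posrE ?invr_gt0// expR_gt0. Qed.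

Lemma sqrt2_bounds : 1414 / 1000 <= Num.sqrt (2 : R) <= 2829 / 2000.
Proof.
have h : Num.sqrt (2 : R) ^+ 2 = 2 by rewrite sqr_sqrtr.
have := sqrtr_ge0 (2 : R); set c := Num.sqrt 2 in h * => c0.
apply/andP; split; nra.
Qed.

(* The bound of [chi2_tail] on the probability that a chi-square variable with [d]
   degrees of freedom exceeds [a]. *)
Definition tail_bound (th : R) d (a : R) :=
  ((Num.sqrt th)^-1 ^+ d - 1) / (expR ((1 - th) / 2 * a) - 1).

Lemma frac_sub1_le (x y : R) : x <= y -> 1 < y -> (x - 1) / (y - 1) <= x / y.
Proof.
move=> xy y1; rewrite ler_pdivrMr ?subr_gt0// mulrAC ler_pdivlMr; nra.
Qed.

(** Sharper than [frac_sub1_le]: the numerator keeps its 1 and the denominator costs only k / (k -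
    1). It serves groups of size 2, where losing the 1 in the numerator would be too costly. *)
Lemma frac_sub1_le_scale (x y k : R) : 0 <= x - 1 -> 1 < k -> k <= y ->
  (x - 1) / (y - 1) <= (x - 1) * (k / (k - 1)) / y.
Proof.
move=> x1 k1 ky; rewrite -mulrA ler_wpM2l//.
rewrite -[leLHS]mul1r ler_pdivrMr ?subr_gt0; last by lra.
rewrite mulrAC ler_pdivlMr; last by lra.
rewrite mulrAC ler_pdivlMr; last by lra.
nra.
Qed.

(** The exponent is what remains of the Chernoff exponent - 3/8 (s + v)^2 once - v^2 / 2 and the
    term in s^2 are split off; the factor [v] comes from the 1 / v of the target. The product is
    largest at [v = 1], as v <= exp (v - 1) shows. *)
Lemma mul_exp_le1 (v s : R) : 1 <= v -> v ^+ 2 <= s ^+ 2 / 2 -> 2 <= s ->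
  v * expR (v ^+ 2 / 8 - 3 / 4 * s * v) <= expR (1 / 8 - 3 / 4 * s).
Proof.
move=> v1 vs s2.
have h : v <= expR (v - 1) by have := expR_ge1Dx (v - 1); lra.
apply: (@le_trans _ _ (expR (v - 1) * expR (v ^+ 2 / 8 - 3 / 4 * s * v))).
  by rewrite ler_wpM2r// expR_ge0.
rewrite -expRD ler_expR.
have vs' : v <= (7072 / 10000) * s by nra.
nra.
Qed.


Lemma sqrt_quarter_inv : (Num.sqrt (1 / 4 : R))^-1 = 2.
Proof.
rewrite (_ : 1 / 4 = (2^-1) ^+ 2); last by field.
by rewrite sqrtr_sqr ger0_norm ?invrK// invr_ge0.
Qed.

Lemma tail_bound_quarter d (a : R) :
  tail_bound (1 / 4) d a = (2 ^+ d - 1) / (expR (3 / 8 * a) - 1).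
Proof. by rewrite /tail_bound sqrt_quarter_inv (_ : (1 - 1 / 4) / 2 = 3 / 8)//; field. Qed.

Lemma exp2_le (c x : R) d : 2 <= expR c -> 0 <= c -> d%:R * c <= x -> (2 : R) ^+ d <= expR x.
Proof.
move=> c2 c0 dx; apply: (@le_trans _ _ (expR c ^+ d)).
  by apply: lerXn2r; rewrite ?nnegrE ?expR_ge0.
by rewrite -expRM_natr ler_expR mulrC.
Qed.

Lemma expR_3_4 : 2116 / 1000 <= expR (3 / 4 : R).
Proof. by apply: expR_lb6; lra. Qed.

(* Chernoff's bound at [th = 1/4], where [th ^- (d/2)] is the integer [2 ^ d]. *)
Lemma tail_bound_later (d : nat) (v s : R) : (2 <= d)%N -> 1 <= v ->
  v ^+ 2 <= d%:R -> 0 <= s -> s ^+ 2 = 2 * d%:R ->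
  tail_bound (1 / 4) d ((s + v) ^+ 2) <=
  (2 * expR (- (3 / 4))) ^+ d * expR (1 / 8 - 3 / 4 * s) *
  (expR (- (v ^+ 2 / 2)) / v).
Proof.
move=> d2 v1 vd s0 sd; rewrite tail_bound_quarter.
have d2R : 2 <= d%:R :> R by rewrite ler_nat.
have v0 : 0 < v by lra.
have e1 : 1 < expR (3 / 8 * (s + v) ^+ 2) by rewrite expR_gt1; nra.
have x2 : (2 : R) ^+ d <= expR (3 / 8 * (s + v) ^+ 2).
  by apply: (@exp2_le (3 / 4)); [have := expR_3_4; lra|lra|nra].
apply: le_trans (frac_sub1_le x2 e1) _.
rewrite -expRN.
have -> : - (3 / 8 * (s + v) ^+ 2) = - (3 / 4) * d%:R +
    (v ^+ 2 / 8 - 3 / 4 * s * v) - v ^+ 2 / 2.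
  by have -> : d%:R = s ^+ 2 / 2; [rewrite sd; field|field].
rewrite 2!expRD expRM_natr exprMn.
set A := 2 ^+ d; set B := _ ^+ d; set q := v ^+ 2 / 8 - _.
set Z := expR (- (v ^+ 2 / 2)); set Y := expR (1 / 8 - _).
rewrite [leRHS](_ : _ = A * B * Z * Y / v); last by field; rewrite gt_eqF.
rewrite ler_pdivlMr// [leLHS](_ : _ = A * B * Z * (v * expR q)); last by ring.
apply: ler_wpM2l; first by rewrite !mulr_ge0 ?exprn_ge0 ?expR_ge0.
by apply: mul_exp_le1 => //; nra.
Qed.

(* Rounded upper bounds for the ratio of [tail_bound] at level [kl + m], [m >= 1],
   to [expR (- (v ^+ 2 / 2)) / v]; [late_weight_sum m] dominates their sum from [m] on. *)
Definition late_weight (m : nat) : R :=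
  match m with
  | 0 => 0 | 1 => 176 / 1000 | 2 => 109 / 1000
  | m'.+3 => 46 / 1000 * (3 / 10) ^+ m'
  end.

Definition late_weight_sum (m : nat) : R :=
  match m with
  | 0 => 0 | 1 => 352 / 1000 | 2 => 175 / 1000
  | m'.+3 => 66 / 1000 * (3 / 10) ^+ m'
  end.

Lemma late_weight_sumS m : (0 < m)%N ->
  late_weight m + late_weight_sum m.+1 <= late_weight_sum m.
Proof.
rewrite /late_weight /late_weight_sum.
case: m => [|[|[|m]]] Hm.
- case: (notF Hm).
- lra.
- rewrite expr0; lra.
have : 0 <= (3 / 10 : R) ^+ m by apply: exprn_ge0; lra.
by rewrite exprS; lra.
Qed.

Lemma expR_N23_8 : expR (1 / 8 - 3 / 4 * 4 : R) <= 177 / 3125.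
Proof.
rewrite (_ : _ - _ = - (23 / 8)); last by field.
apply: expRN_le; first lra.
apply: (@le_trans _ _ ((2101 / 500) ^+ 2)); first lra.
by apply: expR_half_le; [lra|apply: expR_lb6; lra].
Qed.

Lemma expR_27_8 : 29 <= expR (27 / 8 : R).
Proof.
apply: (@le_trans _ _ ((2693 / 500) ^+ 2)); first lra.
by apply: expR_half_le; [lra|apply: expR_lb6; lra].
Qed.

Lemma expR_N1996 : expR (- (1996 / 1000) : R) <= 136 / 1000.
Proof.
apply: expRN_le; first lra.
apply: (@le_trans _ _ ((339 / 125) ^+ 2)); first lra.
by apply: expR_half_le; [lra|apply: expR_lb6; lra].
Qed.

(** The gain from [m] to [m + 1] for m >= 3: [s] starts at 4 or more and grows by sqrt 2, and 3/4 *
    4 * (1.414 - 1) = 1.242. This is the ratio 3/10 in [late_weight]. *)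
Lemma expR_N1242 : expR (- (1242 / 1000) : R) <= 3 / 10.
Proof. by apply: expRN_le; [lra|apply: expR_lb6; lra]. Qed.

Lemma two_expR_N3_4 : 2 * expR (- (3 / 4)) <= 1891 / 2000 :> R.
Proof.
have : expR (- (3 / 4)) <= 1000 / 2116 :> R.
  by apply: expRN_le; [lra|rewrite invf_div; exact: expR_3_4].
lra.
Qed.

Lemma tail_bound_late_weight1 (v : R) : 1 <= v -> v ^+ 2 <= 2 ->
  tail_bound (1 / 4) 2 ((2 + v) ^+ 2) <=
  176 / 1000 * (expR (- (v ^+ 2 / 2)) / v).
Proof.
move=> v1 vm; have v0 : 0 < v by lra.
rewrite tail_bound_quarter.
have ky : 29 <= expR (3 / 8 * (2 + v) ^+ 2).
  by apply: le_trans expR_27_8 _; rewrite ler_expR; nra.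
apply: le_trans (frac_sub1_le_scale _ _ ky) _; [lra|lra|].
have h := @mul_exp_le1 v 2 v1 ltac:(lra) (lexx _).
rewrite -expRN (_ : - (3 / 8 * (2 + v) ^+ 2) = - (3 / 2) +
   (v ^+ 2 / 8 - 3 / 4 * 2 * v) - v ^+ 2 / 2); last by field.
rewrite 2!expRD; move: h.
set q := v ^+ 2 / 8 - _; set Z := expR (- (v ^+ 2 / 2)) => h.
rewrite [leRHS](_ : _ = 176 / 1000 * Z / v); last by field; rewrite gt_eqF.
rewrite ler_pdivlMr// [leLHS](_ : _ = (87 / 28 * (expR (- (3 / 2)) * (v * expR q))) * Z);
  last by field.
apply: ler_wpM2r; first exact: expR_ge0.
apply: (@le_trans _ _ (87 / 28 * (expR (- (3 / 2)) * expR (1 / 8 - 3 / 4 * 2)))).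
  by apply: ler_wpM2l; [lra|apply: ler_wpM2l => //; exact: expR_ge0].
rewrite -expRD (_ : - (3 / 2) + _ = 1 / 8 - 3 / 4 * 4); last by field.
have := expR_N23_8; lra.
Qed.

(** The weight is divided by 8/10 because the accompanying power of 2 exp (- 3/4) supplies that
    factor once the group has at least 4 members. *)
Lemma late_weight_sqrt (m : nat) : (2 <= m)%N ->
  expR (1 / 8 - 3 / 4 * Num.sqrt (2 ^+ m.+1 : R)) <= late_weight m / (8 / 10).
Proof.
have /andP[c1 c2] := sqrt2_bounds; move=> m2.
have [m_2|m3] := leqP m 2.
  have -> : m = 2%N by apply/eqP; rewrite eqn_leq m_2 m2.
  rewrite exprS sqrtrM// sqrtr_sqr ger0_norm//.
  apply: (@le_trans _ _ (expR (- (1996 / 1000)))); first by rewrite ler_expR; lra.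
  by apply: le_trans expR_N1996 _; rewrite /late_weight; lra.
have {m3 m2} -> : m = (m - 3).+3 by lia.
elim: (m - 3)%N => [|k IH].
  rewrite (_ : (2 : R) ^+ 4 = 4 ^+ 2); last by lra.
  rewrite sqrtr_sqr ger0_norm// /late_weight expr0.
  by have := expR_N23_8; lra.
set s := Num.sqrt _ in IH.
have s4 : 4 <= s.
  rewrite -(ger0_norm (ler0n R 4)) -sqrtr_sqr ler_wsqrtr//.
  by rewrite (_ : 4 ^+ 2 = 2 ^+ 4 :> R) ?ler_weXn2l//; lra.
rewrite [X in Num.sqrt X]exprS sqrtrM// -/s.
apply: (@le_trans _ _ (expR (1 / 8 - 3 / 4 * s) * expR (- (1242 / 1000)))).
  by rewrite -expRD ler_expR; nra.
have -> : late_weight k.+4 / (8 / 10) = late_weight k.+3 / (8 / 10) * (3 / 10).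
  by rewrite /late_weight exprS; field.
apply: ler_pM; [exact: expR_ge0|exact: expR_ge0|exact: IH|exact: expR_N1242].
Qed.

Lemma tail_bound_late_weight (m : nat) (v : R) : (1 <= m)%N -> 1 <= v ->
  v ^+ 2 <= 2 ^+ m ->
  tail_bound (1 / 4) (2 ^ m) ((Num.sqrt (2 ^+ m.+1) + v) ^+ 2) <=
  late_weight m * (expR (- (v ^+ 2 / 2)) / v).
Proof.
move=> m1 v1 vm; have v0 : 0 < v by lra.
have := m1; rewrite leq_eqVlt => /orP[/eqP m_1|m2].
  rewrite -m_1 (_ : (2 : R) ^+ 2 = 2 ^+ 2)// sqrtr_sqr ger0_norm//.
  by apply: tail_bound_late_weight1 => //; rewrite -m_1 expr1 in vm.
have d4 : (4 <= 2 ^ m)%N by rewrite -[4%N]/(2 ^ 2)%N leq_exp2l.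
have s0 := sqrtr_ge0 (2 ^+ m.+1 : R).
have s2 : Num.sqrt (2 ^+ m.+1 : R) ^+ 2 = 2 * (2 ^ m)%:R.
  by rewrite sqr_sqrtr ?exprn_ge0// exprS natrX.
apply: le_trans (tail_bound_later _ v1 _ s0 s2) _.
- exact: leq_trans d4.
- by rewrite natrX.
apply: ler_wpM2r; first by rewrite divr_ge0 ?expR_ge0// ltW.
have q1 : 0 <= 2 * expR (- (3 / 4)) :> R by rewrite mulr_ge0 ?expR_ge0.
have q3 : (2 * expR (- (3 / 4))) ^+ (2 ^ m) <= 8 / 10 :> R.
  have := two_expR_N3_4; move: q1; clear -d4; set x := 2 * _ => q1 q2.
  apply: (@le_trans _ _ (x ^+ 4)); first by apply: ler_wiXn2l => //; lra.
  have x2 : x ^+ 2 <= 894 / 1000 by nra.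
  by rewrite (exprM _ 2 2); have := sqr_ge0 x; nra.
apply: (@le_trans _ _ (8 / 10 * (late_weight m / (8 / 10)))); last first.
  by rewrite le_eqVlt; apply/orP; left; apply/eqP; field.
apply: ler_pM; [exact: exprn_ge0|exact: expR_ge0|exact: q3|].
exact: late_weight_sqrt.
Qed.

End Numerics.

Section Numerics.
Variable R : realType.

(** For k_* = 0 both the group size and [v] equal 1. Taking [th = 1 / 2] brings the share below 0.4,
    where [th = 1 / 4] would give about 0.47. *)
Lemma tail_bound_first_kl0 :
  @tail_bound R (1 / 2) 1 ((1 + 1) ^+ 2) <= 398 / 1000 * (expR (- (1 ^+ 2 / 2)) / 1).
Proof.
rewrite /tail_bound expr1n divr1 expr1.
rewrite (_ : (1 - 1 / 2) / 2 * (1 + 1) ^+ 2 = 1 / 2 + 1 / 2); last by field.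
rewrite expRD expRN.
have -> : (Num.sqrt (1 / 2 : R))^-1 = Num.sqrt 2.
  by rewrite div1r sqrtrV// invrK.
have /andP[c1 c2] := sqrt2_bounds R.
have : 4121 / 2500 <= expR (1 / 2 : R) by apply: expR_lb6; lra.
set e := expR _ => e1; set c := Num.sqrt 2 in c1 c2 *.
rewrite ler_pdivrMr; last by nra.
rewrite [leRHS](_ : _ = 398 / 1000 * (e - e^-1)); last first.
  by field; rewrite gt_eqF//; lra.
have : e^-1 <= 2500 / 4121.
  by rewrite -[2500 / _]invrK invf_div lef_pV2// posrE; lra.
lra.
Qed.

(** The level after k_* = 0 still has a single degree of freedom, the size exponent being the
    maximum of k - 1 and k_*, so [late_weight] does not cover it. *)
Lemma tail_bound_second_kl0 :
  @tail_bound R (1 / 4) 1 ((Num.sqrt 2 + 1) ^+ 2) <=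
  215 / 1000 * (expR (- (1 ^+ 2 / 2)) / 1).
Proof.
rewrite tail_bound_quarter expr1n divr1 expr1.
have /andP[c1 c2] := sqrt2_bounds R.
have h : Num.sqrt (2 : R) ^+ 2 = 2 by rewrite sqr_sqrtr.
set c := Num.sqrt 2 in c1 c2 h *.
have e1 : 526 / 100 <= expR (3 / 8 * (c + 1) ^+ 2 - 1 / 2).
  apply: (@le_trans _ _ (expR (1685 / 1000))); last by rewrite ler_expR; nra.
  by apply: expR_lb6; lra.
have e2 : expR (- (1 / 2)) <= 608 / 1000 :> R.
  by apply: expRN_le; [lra|apply: expR_lb6; lra].
have e0 : 0 < expR (- (1 / 2)) :> R by exact: expR_gt0.
rewrite ler_pdivrMr; last by rewrite subr_gt0 expR_gt1; nra.
have -> : 215 / 1000 * expR (- (1 / 2)) * (expR (3 / 8 * (c + 1) ^+ 2) - 1) =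
  215 / 1000 * (expR (3 / 8 * (c + 1) ^+ 2 - 1 / 2) - expR (- (1 / 2))).
  by rewrite (expRD (3 / 8 * _)); ring.
lra.
Qed.

(** Tangent of the exponential, with equality at [v = k]. The value 1.2 is taken for [v] between 1
    and sqrt 2, and about sqrt 2 for the larger groups. *)
Lemma le_scale_expR (k v : R) : 0 < k -> v <= k * expR (v / k - 1).
Proof.
move=> k0; rewrite mulrC -ler_pdivrMr//.
by have := expR_ge1Dx (v / k - 1); rewrite addrCA subrr addr0.
Qed.

Lemma expR_N1621 : expR (- (1621 / 1000) : R) <= 1984 / 10000.
Proof.
apply: expRN_le; first lra.
apply: (@le_trans _ _ ((2246 / 1000) ^+ 2)); first lra.
by apply: expR_half_le; [lra|apply: expR_lb6; lra].
Qed.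

Lemma expR_2039 : 76 / 10 <= expR (2039 / 1000 : R).
Proof.
apply: (@le_trans _ _ ((276 / 100) ^+ 2)); first lra.
by apply: expR_half_le; [lra|apply: expR_lb6; lra].
Qed.

Lemma tail_bound_first_kl1 (v : R) : 1 <= v -> v ^+ 2 <= 2 ->
  tail_bound (3 / 10) 2 ((Num.sqrt 2 + v) ^+ 2) <=
  640 / 1000 * (expR (- (v ^+ 2 / 2)) / v).
Proof.
have k0 : 0 < 12 / 10 :> R by lra.
have /andP[c1 c2] := sqrt2_bounds R.
have h : Num.sqrt (2 : R) ^+ 2 = 2 by rewrite sqr_sqrtr.
move=> v1 v2; have v0 : 0 < v by lra.
rewrite /tail_bound exprVn sqr_sqrtr; last by clear; lra.
set c := Num.sqrt 2 in c1 c2 h *.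
have ky : 76 / 10 <= expR ((1 - 3 / 10) / 2 * (c + v) ^+ 2).
  by apply: le_trans expR_2039 _; rewrite ler_expR; nra.
apply: le_trans (frac_sub1_le_scale _ _ ky) _; [clear; lra|clear; lra|].
have e1 : v / (12 / 10) - 1 + (v ^+ 2 / 2 - (1 - 3 / 10) / 2 * (c + v) ^+ 2) <=
    - (1621 / 1000).
  by clear -v1 v2 c1 c2 h; nra.
rewrite -expRN (_ : - ((1 - 3 / 10) / 2 * (c + v) ^+ 2) =
  (v ^+ 2 / 2 - (1 - 3 / 10) / 2 * (c + v) ^+ 2) - v ^+ 2 / 2); last by field.
set q := (v ^+ 2 / 2 - _) in e1 *; rewrite expRD; set Z := expR (- _).
rewrite [leRHS](_ : _ = 640 / 1000 * Z / v); last by field; rewrite gt_eqF.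
rewrite ler_pdivlMr// [leLHS](_ : _ = (7 / 3 * (76 / 66)) * (v * expR q) * Z);
  last by field.
apply: ler_wpM2r; first exact: expR_ge0.
suff : v * expR q <= 12 / 10 * (1984 / 10000) by clear; lra.
apply: (@le_trans _ _ (12 / 10 * expR (v / (12 / 10) - 1) * expR q)).
  by apply: ler_wpM2r; [exact: expR_ge0|exact: le_scale_expR].
rewrite -mulrA -expRD; apply: ler_wpM2l; first exact: ltW.
by apply: le_trans expR_N1621; rewrite ler_expR.
Qed.

Lemma two_le_expR : 2 <= expR (694 / 1000 : R).
Proof. by apply: expR_lb6; lra. Qed.

Lemma expR_N55 : 1415 / 1000 * expR (- (55 / 100)) <= 820 / 1000 :> R.
Proof.
suff : expR (- (55 / 100)) <= 579 / 1000 :> R by lra.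
by apply: expRN_le; [lra|apply: expR_lb6; lra].
Qed.

(** Three products of nonnegative factors, valid on the wedge 0.707 t <= v <= t with t >= 2, make
    the claim linear in the monomials of degree two. *)
Lemma first_exponent_le (t v : R) : 2 <= t -> v <= t -> 707 / 1000 * t <= v ->
  694 / 1000 * t ^+ 2 + (v / (1415 / 1000) - 1) +
    (v ^+ 2 / 2 - 3 / 8 * (t + v) ^+ 2) <= - (55 / 100).
Proof.
move=> t2 vt tv.
have h1 : 0 <= (t - v) * (v - 707 / 1000 * t) by apply: mulr_ge0; lra.
have h2 : 0 <= (t - 2) * (v - 707 / 1000 * t) by apply: mulr_ge0; lra.
have h3 : 0 <= (t - 2) * (t - 2) by apply: mulr_ge0; lra.
lra.
Qed.

(** At the first level the group size and [v ^+ 2] differ by a factor of at most 2, so 2^d competes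
    with the exponential. It is carried as exp (0.694 t^2), with 0.694 just above ln 2. *)
Lemma tail_bound_first (d : nat) (t v : R) : 2 <= t -> t ^+ 2 = d%:R ->
  0 < v -> t ^+ 2 / 2 < v ^+ 2 <= t ^+ 2 ->
  tail_bound (1 / 4) d ((t + v) ^+ 2) <=
  820 / 1000 * (expR (- (v ^+ 2 / 2)) / v).
Proof.
have k0 : 0 < 1415 / 1000 :> R by lra.
have k1 : 0 <= 694 / 1000 :> R by lra.
move=> t2 td v0 /andP[vt tv]; rewrite tail_bound_quarter.
have tv' : v <= t by clear td; nra.
have tv2 : 707 / 1000 * t <= v by clear td; nra.
have y1 : 694 / 1000 * t ^+ 2 <= 3 / 8 * (t + v) ^+ 2.
  by clear td vt tv; nra.
have y2 : 1 < expR (3 / 8 * (t + v) ^+ 2).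
  by rewrite expR_gt1; clear td vt tv y1; nra.
have x2 : (2 : R) ^+ d <= expR (694 / 1000 * t ^+ 2).
  by apply: (@exp2_le R _ _ _ two_le_expR); [exact: k1|rewrite -td mulrC].
have x3 : (2 : R) ^+ d <= expR (3 / 8 * (t + v) ^+ 2).
  by apply: le_trans x2 _; rewrite ler_expR.
apply: le_trans (frac_sub1_le x3 y2) _.
have e1 := first_exponent_le t2 tv' tv2.
rewrite -expRN (_ : - (3 / 8 * (t + v) ^+ 2) =
  (v ^+ 2 / 2 - 3 / 8 * (t + v) ^+ 2) - v ^+ 2 / 2); last by field.
set q := (v ^+ 2 / 2 - _) in e1 *; rewrite expRD; set Z := expR (- _).
rewrite [leRHS](_ : _ = 820 / 1000 * Z / v); last by field; rewrite gt_eqF.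
rewrite ler_pdivlMr// [leLHS](_ : _ = (2 ^+ d * (v * expR q)) * Z); last by ring.
apply: ler_wpM2r; first exact: expR_ge0.
apply: (@le_trans _ _ (expR (694 / 1000 * t ^+ 2) *
  (1415 / 1000 * expR (v / (1415 / 1000) - 1) * expR q))).
  apply: ler_pM; [exact: exprn_ge0| |exact: x2|].
    by rewrite mulr_ge0 ?expR_ge0// ltW.
  by apply: ler_wpM2r; [exact: expR_ge0|exact: le_scale_expR].
rewrite [leLHS](_ : _ = 1415 / 1000 * (expR (694 / 1000 * t ^+ 2) *
  expR (v / (1415 / 1000) - 1) * expR q)); last by ring.
rewrite -!expRD.
apply: le_trans expR_N55.
apply: ler_wpM2l; first exact: ltW k0.
by rewrite ler_expR.
Qed.

End Numerics.

(** * Allocation of the failure probability among the levels *)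

Section Weights.
Variable R : realType.

Lemma ler_sum_potential (p S : nat -> R) a : (forall k, 0 <= S k) ->
  (forall k, (a <= k)%N -> p k + S k.+1 <= S k) ->
  forall N, \sum_(a <= k < N) p k <= S a.
Proof.
move=> S0 pS N; have [aN|Na] := leqP a N; last by rewrite big_geq// ltnW.
suff : \sum_(a <= k < N) p k + S N <= S a by have := S0 N; lra.
rewrite -(subnKC aN); elim: (N - a)%N => [|k IH]; first by rewrite addn0 big_geq ?add0r.
rewrite addnS big_nat_recr ?leq_addr//= -addrA.
by apply: le_trans IH; rewrite lerD2l; apply: pS; exact: leq_addr.
Qed.

Lemma late_weight_sum_ge0 m : 0 <= late_weight_sum R m.
Proof.
rewrite /late_weight_sum; case: m => [|[|[|m]]]; [lra|lra|lra|].
by apply: mulr_ge0; [lra|apply: exprn_ge0; lra].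
Qed.

Lemma late_weight_sum_le m : (3 <= m)%N -> late_weight_sum R m <= 66 / 1000.
Proof.
case: m => [|[|[|m]]]// _; rewrite /late_weight_sum.
have : (3 / 10 : R) ^+ m <= 1 by apply: exprn_ile1; lra.
lra.
Qed.

(* With [v ^+ 2 = 2 log (p / eps)] one has [expR (- (v ^+ 2 / 2)) / v = (eps / p) / v]:
   [p k] is the share of the failure probability allotted to level [k]. *)
Lemma tail_weights (kl : nat) (v : R) : 1 <= v -> 2 ^+ kl / 2 < v ^+ 2 <= 2 ^+ kl ->
  exists2 p : nat -> R,
    forall k, (kl <= k)%N -> exists2 th, 0 < th < 1 &
      tail_bound th (2 ^ maxn k.-1 kl) ((Num.sqrt (2 ^+ k) + v) ^+ 2) <=
      p k * (expR (- (v ^+ 2 / 2)) / v) &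
    forall N, \sum_(kl <= k < N) p k <= 1.
Proof.
move=> v1 /andP[vl vu].
have v0 : 0 < v by lra.
have th4 : 0 < (1 / 4 : R) < 1 by apply/andP; split; lra.
have late k : (1 <= k.-1)%N -> (kl < k)%N ->
    tail_bound (1 / 4) (2 ^ maxn k.-1 kl) ((Num.sqrt (2 ^+ k) + v) ^+ 2) <=
    late_weight R k.-1 * (expR (- (v ^+ 2 / 2)) / v).
  move=> k1 klk; have -> : maxn k.-1 kl = k.-1 by lia.
  have -> : (2 : R) ^+ k = 2 ^+ k.-1.+1 by congr (_ ^+ _); lia.
  apply: tail_bound_late_weight => //; apply: le_trans vu _.
  by apply: ler_weXn2l; [lra|lia].
have lws k := late_weight_sum_ge0 k.
case: kl vl vu late => [|kl] vl vu late.
  have vE : v = 1 by rewrite expr0 in vu; nra.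
  exists (fun k => match k with 0 => 398 / 1000 | 1 => 215 / 1000
                   | k.+1 => late_weight R k end).
    move=> [|[|k]] _.
    - exists (1 / 2); first by apply/andP; split; lra.
      by rewrite vE expr0 sqrtr1; exact: tail_bound_first_kl0.
    - exists (1 / 4) => //; rewrite vE expr1; exact: tail_bound_second_kl0.
    - exists (1 / 4) => //; exact: late.
  (* Bounds for the shares still to come: 0.398 + 0.6 <= 1, then 0.215 + 0.352 <= 0.6. *)
  pose S k : R := match k with 0 => 1 | 1 => 6 / 10
                   | k.+1 => late_weight_sum R k end.
  apply: (@ler_sum_potential _ S).
    by move=> [|[|k]]; rewrite /S; [lra|lra|exact: lws].
  move=> [|[|k]] _; rewrite /S.
  - lra.
  - rewrite /late_weight_sum; lra.
  - exact: late_weight_sumS.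
(* Here [kl] stands for k_* - 1. The first share must fit with the later ones: 0.640 + 0.352 for k_*
   = 1, 0.820 + 0.175 for k_* = 2. *)
pose q0 : R := if kl is 0 then 640 / 1000 else 820 / 1000.
exists (fun k => if k == kl.+1 then q0 else late_weight R k.-1).
  move=> k klk; have [kE|kN] := eqVneq k kl.+1; last first.
    by exists (1 / 4) => //; apply: late; lia.
  rewrite kE /q0 (_ : maxn _ _ = kl.+1); last by lia.
  case: kl {klk kE late q0} vl vu => [|kl] vl vu.
    exists (3 / 10); first by apply/andP; split; lra.
    by rewrite expr1; apply: tail_bound_first_kl1 => //; rewrite expr1 in vu.
  exists (1 / 4) => //; apply: tail_bound_first => //.
  - have -> : (2 : R) = Num.sqrt (2 ^+ 2) by rewrite sqrtr_sqr ger0_norm.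
    by apply: ler_wsqrtr; rewrite [in leRHS]sqrtr_sqr ger0_norm//; apply: ler_weXn2l; [lra|].
  - by rewrite sqr_sqrtr ?exprn_ge0// natrX.
  - by rewrite sqr_sqrtr ?exprn_ge0// vl vu.
pose S k : R := if k == kl.+1 then 1 else late_weight_sum R k.-1.
move=> N; rewrite (_ : 1 = S kl.+1); last by rewrite /S eqxx.
apply: ler_sum_potential => [k|k klk]; first by rewrite /S; case: ifP.
rewrite /S (_ : (k.+1 == kl.+1) = false); last by lia.
have [->|kN] := eqVneq k kl.+1; last first.
  have -> : k.+1.-1 = k.-1.+1 by lia.
  by apply: late_weight_sumS; lia.
rewrite /q0; case: {late q0 S klk vl vu} kl => [|[|kl]].
- rewrite /=; lra.
- rewrite /=; lra.
- have := @late_weight_sum_le kl.+3 isT.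
  change (late_weight_sum R kl.+3 <= 66 / 1000 ->
    820 / 1000 + late_weight_sum R kl.+3 <= 1); lra.
Qed.

End Weights.

(** * The noise event *)

Section Event.
Variable R : realType.

Lemma measure_bigsetU_le d (T : measurableType d) (mu : {measure set T -> \bar R})
    (I : Type) (s : seq I) (Q : pred I) (A : I -> set T) :
  (forall i, measurable (A i)) ->
  (mu (\big[setU/set0]_(i <- s | Q i) A i) <= \sum_(i <- s | Q i) mu (A i))%E.
Proof.
move=> mA; elim: s => [|i s IH]; first by rewrite !big_nil measure0.
rewrite !big_cons; case: ifP => // _.
apply: le_trans (measureU2 _ _ _) _ => //.
  by apply: bigsetU_measurable.
by rewrite leeD2l.
Qed.

Lemma tail_bound_ge0 (th : R) d a : 0 < th < 1 -> 0 < a -> 0 <= tail_bound th d a.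
Proof.
move=> /andP[th0 th1] a0; rewrite /tail_bound divr_ge0// subr_ge0.
  apply: exprn_ege1; have st0 : 0 < Num.sqrt th by rewrite sqrtr_gt0.
  by rewrite invf_ge1// -sqrtr1 ler_wsqrtr// ltW.
by rewrite ltW// expR_gt1; apply: mulr_gt0 => //; lra.
Qed.

Lemma powR2_half k : 2 `^ (k%:R / 2) = Num.sqrt (2 ^+ k : R).
Proof.
by rewrite powRrM powR12_sqrt ?powR_ge0// powR_mulrn.
Qed.

Lemma norm2nE n (u : 'cV[R]_n) : norm2n u = Num.sqrt (dot u u) / Num.sqrt n%:R.
Proof. by rewrite /norm2n; congr (Num.sqrt _ / _); apply: eq_bigr => i _; rewrite expr2. Qed.

(** Parametric groups of size at most 2^kl share the chi-square bound of level [kl]. *)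
Lemma gdim_le p (J1 : {set 'I_p}) (dpar : 'I_p -> nat) kl j k :
  (forall j, j \notin J1 -> (0 < dpar j <= 2 ^ kl)%N) -> inK J1 kl j k ->
  (gdim J1 dpar kl j k <= 2 ^ maxn k.-1 kl)%N.
Proof.
move=> hd; rewrite /inK /gdim; case: ifP => //= jJ /andP[_ /eqP ->].
by have /andP[_] := hd j (negbT jJ) => /leq_trans; apply; rewrite leq_exp2l// leq_maxr.
Qed.

(** The event controls all coefficient vectors of a group at once, so it involves neither the
    estimator nor any smoothness index. On it the projected noise has norm at most sigma (sqrt (2^k)
    + v), which is [lambda] up to the normalisation by sqrt n. *)
Lemma noise_event (n p : nat) (J1 : {set 'I_p}) (dpar : 'I_p -> nat) (kl ku : nat)
    (U : design R n J1 dpar kl) (sigma eps : R)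
    (disp : measure_display) (T : measurableType disp) (P : probability T R)
    (noise : 'I_n -> {RV P >-> R}) :
  (0 < n)%N ->
  (forall j, j \notin J1 -> (0 < dpar j <= 2 ^ kl)%N) ->
  0 < sigma -> iid_normal sigma noise -> 0 < eps <= 1 -> 1 <= Lpe p eps ->
  2 `^ (kl%:R - 1) < Lpe p eps <= 2 `^ kl%:R ->
  exists E : set T,
    [/\ measurable E, ((1 - eps / Num.sqrt (Lpe p eps))%:E <= P E)%E &
     forall w, E w -> forall jk : 'I_p * 'I_ku.+1, jk \in Kstar J1 kl ku ->
       forall b : 'cV_(gdim J1 dpar kl jk.1 jk.2),
       dot (\col_i noise i w) (U jk.1 jk.2 *m b) <=
       n%:R * lambda (sigma / Num.sqrt n%:R) p eps jk.2 *
         norm2n (U jk.1 jk.2 *m b)].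
Proof.
move=> n0 hd s0 hN /andP[e0 e1] L1 /andP[Ll Lu].
set L := Lpe p eps in L1 Ll Lu *; pose v := Num.sqrt L.
have v1 : 1 <= v by rewrite -sqrtr1 ler_wsqrtr.
have v2 : v ^+ 2 = L by rewrite sqr_sqrtr//; lra.
have hv : 2 ^+ kl / 2 < v ^+ 2 <= 2 ^+ kl.
  rewrite v2 -!powR_mulrn//; apply/andP; split => //; apply: le_lt_trans Ll.
  by rewrite powRD ?pnatr_eq0 ?implybT// powRN powRr1.
have [pw Hp sump] := tail_weights v1 hv.
pose K := expR (- (v ^+ 2 / 2)) / v.
have K0 : 0 < K by rewrite divr_gt0 ?expR_gt0//; lra.
have /choice[Q HQ] : forall jk : 'I_p * 'I_ku.+1, exists Q : seq 'cV[R]_n,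
    [/\ orthonormal_seq Q, (size Q <= gdim J1 dpar kl jk.1 jk.2)%N &
     forall b, U jk.1 jk.2 *m b = projs Q (U jk.1 jk.2 *m b)].
  by move=> jk; exact: colspace_orthonormal.
pose Z := std_noise sigma noise.
have mZ : forall i, measurable_fun setT (fun w => Z w i 0).
  by move=> i; exact: measurable_std_noise.
pose a (k : nat) := (Num.sqrt (2 ^+ k) + v) ^+ 2.
have sa k : 0 <= Num.sqrt (2 ^+ k) + v by rewrite addr_ge0 ?sqrtr_ge0//; lra.
have a0 k : 0 < a k.
  by rewrite exprn_gt0// ltr_wpDl ?sqrtr_ge0//; lra.
pose B (jk : 'I_p * 'I_ku.+1) := [set w | a jk.2 < \sum_(q <- Q jk) dot q (Z w) ^+ 2].
have mB jk : measurable (B jk) by exact: measurable_tail.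
pose bad := \big[setU/set0]_(jk in Kstar J1 kl ku) B jk.
have mbad : measurable bad by apply: bigsetU_measurable.
have pK0 k : (kl <= k)%N -> 0 <= pw k.
  move=> klk; have [th th01 h] := Hp k klk.
  rewrite -(pmulr_lge0 _ K0); apply: le_trans h; exact: (tail_bound_ge0 _ th01 (a0 k)).
have PB jk : jk \in Kstar J1 kl ku -> (P (B jk) <= (pw jk.2 * K)%:E)%E.
  rewrite inE => jkK; have [oQ sQ _] := HQ jk.
  have klk : (kl <= jk.2)%N by move: jkK => /andP[].
  have [th th01 h] := Hp jk.2 klk.
  apply: le_trans (_ : ((tail_bound th (2 ^ maxn jk.2.-1 kl) (a jk.2))%:E <= _)%E) => //.
  apply: chi2_tail => //.
  - by move=> c; exact: mgf_std_noise.
  - exact: leq_trans sQ (gdim_le hd jkK).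
have Pbad : (P bad <= (eps / v)%:E)%E.
  apply: le_trans (measure_bigsetU_le _ _ _ mB) _.
  apply: le_trans (lee_sum _ PB) _; rewrite sumEFin lee_fin.
  (* The index set is enlarged to all [p] components at every level, so that the shares of the
     levels can be summed first. *)
  apply: (@le_trans _ _ (\sum_(j < p) \sum_(k < ku.+1 | (kl <= k)%N) pw k * K)).
    rewrite pair_big_dep/= [leLHS]big_mkcond [leRHS]big_mkcond /=.
    apply: ler_sum => jk _; rewrite inE /inK.
    by case: (leqP kl jk.2) => //= h; case: ifP => // _; rewrite mulr_ge0 ?pK0// ltW.
  rewrite sumr_const card_ord -mulr_suml.
  have -> : \sum_(k < ku.+1 | (kl <= k)%N) pw k = \sum_(kl <= k < ku.+1) pw k.
    by rewrite big_geq_mkord.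
  rewrite -mulr_natl.
  apply: (@le_trans _ _ (p%:R * (1 * K))).
    by rewrite ler_wpM2l// ler_wpM2r// ltW.
  have p0 : 0 < p%:R :> R.
    rewrite ltr0n lt0n; apply/eqP => p_0; move: L1.
    by rewrite /L /Lpe p_0 mul0r ln0// mulr0; lra.
  rewrite mul1r /K v2 /L /Lpe mulrC (mulrC 2) mulfK// expRN lnK ?posrE ?divr_gt0//.
  by rewrite invf_div mulrAC mulfVK ?gt_eqF.
exists (~` bad); split.
- exact: measurableC.
- rewrite probability_setC// EFinB leeB//.
- move=> w nbad jk jkK b.
  have [_ _ Hproj] := HQ jk.
  have W : \sum_(q <- Q jk) dot q (Z w) ^+ 2 <= a jk.2.
    rewrite leNgt; apply/negP => h; apply: nbad; rewrite /bad.
    by rewrite -bigcup_pred; exists jk.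
  have sn0 : 0 < Num.sqrt n%:R :> R by rewrite sqrtr_gt0 ltr0n.
  have zE : \col_i noise i w = sigma *: Z w.
    by rewrite /Z /std_noise scalerA divff ?scale1r// gt_eqF.
  rewrite zE dotZl norm2nE /lambda powR2_half -/L -/v.
  have h := dot_le_proj (Z w) (Hproj b).
  have -> : n%:R = Num.sqrt n%:R ^+ 2 :> R by rewrite sqr_sqrtr.
  set V := Num.sqrt (dot _ _) in h *.
  apply: (@le_trans _ _ (sigma * ((Num.sqrt (2 ^+ jk.2) + v) * V))).
    rewrite ler_wpM2l ?(ltW s0)//; apply: le_trans h _.
    rewrite ler_wpM2r ?sqrtr_ge0// -[leRHS]ger0_norm// -sqrtr_sqr.
    exact: ler_wsqrtr.
  rewrite sqrtr_sqr ger0_norm ?sqrtr_ge0// le_eqVlt; apply/orP; left; apply/eqP.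
  by field; rewrite gt_eqF.
Qed.

End Event.

(** * Oracle inequality *)

Section Norm2n.
Variables (R : realType) (n : nat).
Implicit Types (u v w : 'cV[R]_n).

Lemma norm2n_ge0 u : 0 <= norm2n u.
Proof. by rewrite /norm2n divr_ge0// sqrtr_ge0. Qed.

Lemma norm2n_sqr u : norm2n u ^+ 2 = dot u u / n%:R.
Proof. by rewrite norm2nE expr_div_n !sqr_sqrtr ?dot_ge0. Qed.

Lemma norm2nZ a u : norm2n (a *: u) = `|a| * norm2n u.
Proof.
by rewrite !norm2nE dotZl dotZr mulrA -expr2 sqrtrM ?sqr_ge0// sqrtr_sqr mulrA.
Qed.

Lemma norm2nN u : norm2n (- u) = norm2n u.
Proof. by rewrite -scaleN1r norm2nZ normrN1 mul1r. Qed.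

Lemma norm2n0 : norm2n (0 : 'cV[R]_n) = 0.
Proof. by rewrite -(scale0r 0) norm2nZ normr0 mul0r. Qed.

Lemma dot_le u v : dot u v <= n%:R * (norm2n u * norm2n v).
Proof.
have [n0|n0] := posnP n.
  by move: u v; rewrite n0 => u v; rewrite mul0r /dot big_ord0.
have n0' : 0 < n%:R :> R by rewrite ltr0n.
have h : dot u v ^+ 2 <= (n%:R * (norm2n u * norm2n v)) ^+ 2.
  rewrite 2!exprMn !norm2n_sqr.
  rewrite [leRHS](_ : _ = dot u u * dot v v); last by field; rewrite gt_eqF.
  apply: le_trans (cauchy_schwarz_seq _ _ _) _.
  by rewrite le_eqVlt; apply/orP; left; apply/eqP; congr (_ * _);
    apply: eq_bigr => i _; rewrite expr2.
apply: le_trans (ler_norm _) _; rewrite -[leRHS]ger0_norm; last first.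
  by rewrite !mulr_ge0 ?norm2n_ge0.
by rewrite -!sqrtr_sqr ler_wsqrtr.
Qed.

Lemma norm2nD u v : norm2n (u + v) <= norm2n u + norm2n v.
Proof.
have [n0|n0] := posnP n.
  by move: u v; rewrite n0 => u v; rewrite /norm2n sqrtr0 invr0 !mulr0 addr0.
have n0' : 0 < n%:R :> R by rewrite ltr0n.
rewrite -[leRHS]ger0_norm ?addr_ge0 ?norm2n_ge0//.
rewrite -[leLHS]ger0_norm ?norm2n_ge0// -!sqrtr_sqr ler_wsqrtr//.
have h : dot u v / n%:R <= norm2n u * norm2n v.
  by rewrite ler_pdivrMr// mulrC; exact: dot_le.
rewrite sqrrD !norm2n_sqr dotDl !dotDr (dotC v u) !mulrDl; lra.
Qed.

Lemma norm2n_sum (I : Type) (s : seq I) (P : pred I) (F : I -> 'cV[R]_n) :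
  norm2n (\sum_(i <- s | P i) F i) <= \sum_(i <- s | P i) norm2n (F i).
Proof.
elim/big_ind2: _ => //; first by rewrite norm2n0.
by move=> x1 x2 y1 y2 h1 h2; apply: le_trans (norm2nD _ _) _; exact: lerD.
Qed.

End Norm2n.

Section Oracle.
Variables (R : realType) (n p : nat) (J1 : {set 'I_p}) (dpar : 'I_p -> nat).
Variables (kl ku : nat) (U : design R n J1 dpar kl) (lam : nat -> R).
Implicit Types (b c : coefs R J1 dpar kl) (A : {set 'I_p * 'I_ku.+1}).
Notation K := (Kstar J1 kl ku).

(** Coefficient families are dependent functions, so combinations are formed by hand: weights 1 - t
    and t give the segment towards a competitor, weights 1 and -1 a difference. *)
Definition coefs_comb (t s : R) b c : coefs R J1 dpar kl :=
  fun j k => t *: b j k + s *: c j k.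

Lemma block_comb t s b c j k :
  block U (coefs_comb t s b c) j k = t *: block U b j k + s *: block U c j k.
Proof. by rewrite /block mulmxDr -!scalemxAr. Qed.

Lemma fit_comb t s b c :
  fit ku U (coefs_comb t s b c) = t *: fit ku U b + s *: fit ku U c.
Proof.
rewrite /fit !scaler_sumr -big_split; apply: eq_bigr => jk _.
exact: block_comb.
Qed.

Hypothesis n0 : (0 < n)%N.
Hypothesis lam_gt0 : forall k, 0 < lam k.

Lemma pen_ge0 A b : 0 <= pen U lam A b.
Proof. by apply: sumr_ge0 => jk _; rewrite mulr_ge0 ?norm2n_ge0// ltW. Qed.

Lemma pen_comb_le t s A b c : 0 <= t -> 0 <= s ->
  pen U lam A (coefs_comb t s b c) <= t * pen U lam A b + s * pen U lam A c.
Proof.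
move=> t0 s0; rewrite /pen !mulr_sumr -big_split; apply: ler_sum => jk _ /=.
rewrite block_comb [leRHS](_ : _ = lam jk.2 * (t * norm2n (block U b jk.1 jk.2) +
  s * norm2n (block U c jk.1 jk.2))); last by ring.
rewrite ler_wpM2l ?(ltW (lam_gt0 _))//.
by apply: le_trans (norm2nD _ _) _; rewrite !norm2nZ !ger0_norm.
Qed.

(** Division by [t] followed by t -> 0, made explicit: if [c] were negative, the witness is small
    enough that [t * d] stays below [- c]. *)
Lemma linear_part_ge0 (c d : R) :
  (forall t, 0 < t <= 1 -> 0 <= t * c + t ^+ 2 * d) -> 0 <= c.
Proof.
move=> h; rewrite leNgt; apply/negP => c0.
pose t := - c / (`|d| + 1 - c).
have d0 := normr_ge0 d; have dd := ler_norm d.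
have D0 : 0 < `|d| + 1 - c by lra.
have t0 : 0 < t by rewrite divr_gt0//; lra.
have t1 : t <= 1 by rewrite ler_pdivrMr//; lra.
have /h : 0 < t <= 1 by rewrite t0 t1.
rewrite expr2 -mulrA -mulrDr pmulr_rge0//.
have : t * d < - c; last by lra.
rewrite /t mulrAC ltr_pdivrMr//; nra.
Qed.

(** First-order condition without subgradients: on the segment from [bhat] to [b] the penalty is
    convex and the quadratic part exact, so the coefficient of [t] must be nonnegative. *)
Lemma mrgl_optimality (A0 : R) y bhat b : is_mrgl ku U lam A0 y bhat -> 0 <= A0 ->
  0 <= dot (y - fit ku U bhat) (fit ku U bhat - fit ku U b) / n%:R +
    A0 * (pen U lam K b - pen U lam K bhat).
Proof.
move=> hmin A00; set r := y - _; set h := fit ku U bhat - _.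
have n0' : 0 < n%:R :> R by rewrite ltr0n.
have E t : y - fit ku U (coefs_comb (1 - t) t bhat b) = r + t *: h.
  rewrite fit_comb /r /h scalerBl scale1r scalerBr !opprD !addrA opprK.
  by congr (_ - _); rewrite addrC !addrA.
have E0 : mrgl_loss ku U lam A0 y bhat =
    2^-1 * norm2n r ^+ 2 + A0 * pen U lam K bhat by [].
clearbody r h.
apply: (@linear_part_ge0 _ (dot h h / n%:R / 2)) => t /andP[t0 t1].
have := hmin (coefs_comb (1 - t) t bhat b).
rewrite E0 /mrgl_loss E !norm2n_sqr dotDl !dotDr !dotZl !dotZr (dotC h r) => H.
have hp := @pen_comb_le (1 - t) t K bhat b ltac:(lra) (ltW t0).
set pc := pen _ _ _ (coefs_comb _ _ _ _) in H hp.
set pb := pen U lam K b in hp *; set ph := pen U lam K bhat in H hp *.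
have hA : A0 * pc <= A0 * ((1 - t) * ph + t * pb) by rewrite ler_wpM2l.
move: H hA; rewrite !mulrDl.
set X := dot r r / _; set Y := dot r h; set W := dot h h.
rewrite [t * Y / _]mulrAC [t * (t * W) / _](_ : _ = t ^+ 2 * (W / n%:R)); last by field; rewrite gt_eqF.
rewrite [t / n%:R * Y](_ : _ = t * (Y / n%:R)); last by field; rewrite gt_eqF.
lra.
Qed.

(** Triangle inequality on [A]; off [A], |b| - |c| = 2 |b| - (|b| + |c|) <= 2 |b| - |c - b|, so the
    error enters there with a minus sign. *)
Lemma pen_diff_le A b c : A \subset K ->
  pen U lam K b - pen U lam K c <=
  pen U lam A (coefs_comb 1 (-1) c b) + 2 * pen U lam (K :\: A) b -
  pen U lam (K :\: A) (coefs_comb 1 (-1) c b).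
Proof.
move=> AK.
have split x : pen U lam K x = pen U lam A x + pen U lam (K :\: A) x.
  rewrite /pen (big_setID A)/=; congr (_ + _).
  by apply: eq_bigl => jk; rewrite (finset.setIidPr AK).
rewrite !split.
have h1 : pen U lam A b - pen U lam A c <= pen U lam A (coefs_comb 1 (-1) c b).
  rewrite lerBlDr /pen -big_split; apply: ler_sum => jk _ /=.
  rewrite block_comb -mulrDr ler_wpM2l ?(ltW (lam_gt0 _))// scale1r scaleN1r.
  rewrite -[X in norm2n X <= _](subKr (block U c jk.1 jk.2)).
  by apply: le_trans (norm2nD _ _) _; rewrite norm2nN addrC.
have h2 : pen U lam (K :\: A) (coefs_comb 1 (-1) c b) <=
    pen U lam (K :\: A) b + pen U lam (K :\: A) c.
  rewrite /pen -big_split; apply: ler_sum => jk _ /=.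
  rewrite block_comb -mulrDr ler_wpM2l ?(ltW (lam_gt0 _))// scale1r scaleN1r.
  by apply: le_trans (norm2nD _ _) _; rewrite norm2nN addrC.
lra.
Qed.

Lemma dot_fit_le (z : 'cV[R]_n) b :
  (forall jk, jk \in K -> forall x : 'cV_(gdim J1 dpar kl jk.1 jk.2),
    dot z (U jk.1 jk.2 *m x) <= n%:R * lam jk.2 * norm2n (U jk.1 jk.2 *m x)) ->
  dot z (fit ku U b) / n%:R <= pen U lam K b.
Proof.
move=> hz; have n0' : 0 < n%:R :> R by rewrite ltr0n.
rewrite ler_pdivrMr// dotC /fit dot_suml mulr_suml; apply: ler_sum => jk jkK.
by rewrite dotC mulrC mulrA; exact: hz.
Qed.

(** The inner product in the first-order condition polarises into the three squared norms. The noise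
    costs one more unit of penalty everywhere, which turns [A0] into A0 + 1 on [A] and into A0 - 1
    off [A]; their ratio is xi. *)
Lemma basic_inequality (A0 : R) (z f : 'cV[R]_n) bhat b A : 1 < A0 -> A \subset K ->
  (forall jk, jk \in K -> forall x : 'cV_(gdim J1 dpar kl jk.1 jk.2),
    dot z (U jk.1 jk.2 *m x) <= n%:R * lam jk.2 * norm2n (U jk.1 jk.2 *m x)) ->
  is_mrgl ku U lam A0 (f + z) bhat ->
  norm2n (fit ku U bhat - fit ku U b) ^+ 2 + norm2n (fit ku U bhat - f) ^+ 2 <=
  norm2n (f - fit ku U b) ^+ 2 +
  2 * (A0 + 1) * (pen U lam A (coefs_comb 1 (-1) bhat b) -
    ((A0 + 1) / (A0 - 1))^-1 * pen U lam (K :\: A) (coefs_comb 1 (-1) bhat b)) +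
  4 * A0 * pen U lam (K :\: A) b.
Proof.
move=> A01 AK hz hmin; set dl := coefs_comb 1 (-1) bhat b.
set xi := (A0 + 1) / (A0 - 1).
have n0' : 0 < n%:R :> R by rewrite ltr0n.
have := mrgl_optimality b hmin ltac:(lra).
set fh := fit ku U bhat; set fb := fit ku U b.
have hzd := dot_fit_le dl hz.
rewrite fit_comb scale1r scaleN1r -/fh -/fb in hzd.
have -> : f + z - fh = z - (fh - f) by rewrite [in RHS]opprB [RHS]addrCA [RHS]addrA.
have -> : f - fb = (fh - fb) - (fh - f) by rewrite [in RHS]opprB [RHS]addrC [RHS]addrA subrK.
move: hzd; set h := fh - fb; set a := fh - f => hzd; clearbody h a.
have hpen := @pen_diff_le A b bhat AK; rewrite -/dl in hpen.
have hsplit : pen U lam K dl = pen U lam A dl + pen U lam (K :\: A) dl.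
  rewrite /pen (big_setID A)/=; congr (_ + _).
  by apply: eq_bigl => jk; rewrite (finset.setIidPr AK).
rewrite hsplit in hzd.
rewrite !norm2n_sqr !dotBl !dotBr (dotC h a) !mulrBl.
set pb := pen U lam K b in hpen *; set ph := pen U lam K bhat in hpen *.
set pS := pen U lam A dl in hzd hpen *.
set pSc := pen U lam (K :\: A) dl in hzd hpen *.
have xiE : 2 * (A0 + 1) * (pS - xi^-1 * pSc) = 2 * (A0 + 1) * pS - 2 * (A0 - 1) * pSc.
  by rewrite /xi; field; apply/andP; split; apply/eqP; lra.
rewrite xiE => H.
have hA : A0 * (pb - ph) <= A0 * (pS + 2 * pen U lam (K :\: A) b - pSc).
  by rewrite ler_wpM2l//; lra.
lra.
Qed.

End Oracle.

Section OracleBound.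
Variables (R : realType) (n p : nat) (J1 : {set 'I_p}) (dpar : 'I_p -> nat).
Variables (kl ku : nat) (U : design R n J1 dpar kl) (lam : nat -> R).
Variables (A0 : R) (b : coefs R J1 dpar kl).
Notation K := (Kstar J1 kl ku).
Notation S := (strong_set ku U lam A0 b).
Notation xi := ((A0 + 1) / (A0 - 1)).
Hypothesis n0 : (0 < n)%N.
Hypothesis lam_gt0 : forall k, 0 < lam k.
Hypothesis A01 : 1 < A0.

Definition min_sum : R :=
  \sum_(jk in K) Num.min (lam jk.2 ^+ 2) (lam jk.2 * norm2n (block U b jk.1 jk.2)).

Lemma strong_sub : S \subset K.
Proof. by apply/fintype.subsetP => jk; rewrite inE => /andP[]. Qed.

(** On [S] the block is at least [A0 * lam], hence at least [lam], and the minimum is the square.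
    Off [S] the block divided by [A0] is below [lam], so its penalty divided by [A0] is below both
    entries. *)
Lemma strong_split_le :
  \sum_(jk in S) lam jk.2 ^+ 2 + pen U lam (K :\: S) b / A0 <= min_sum.
Proof.
rewrite /min_sum [leRHS](big_setID S)/= /pen mulr_suml; apply: lerD.
  rewrite (finset.setIidPr strong_sub); apply: ler_sum => jk.
  rewrite inE => /andP[_ h]; have l0 := lam_gt0 jk.2.
  by rewrite le_min lexx/= expr2 ler_wpM2l ?(ltW l0)//; apply: le_trans h; rewrite ler_peMl// ltW.
apply: ler_sum => jk; rewrite !inE => /andP[hS jkK].
move: hS; rewrite jkK /= -ltNge => h; have l0 := lam_gt0 jk.2.
have f0 := norm2n_ge0 (block U b jk.1 jk.2).
have A00 : 0 < A0 by apply: lt_trans A01.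
rewrite le_min !ler_pdivrMr//; apply/andP; split; first by nra.
by rewrite ler_peMr ?mulr_ge0// ltW.
Qed.

Lemma Cpred_ge (c : coefs R J1 dpar kl) :
  ((Num.max 0 (pen U lam S c - xi^-1 * pen U lam (K :\: S) c) ^+ 2)%:E /
   ((\sum_(jk in S) lam jk.2 ^+ 2) * norm2n (fit ku U c) ^+ 2)%:E <=
   Cpred U lam xi S)%E.
Proof. by apply: ereal_sup_ubound; exists c. Qed.

Lemma sum_sqr_ge0 : 0 <= \sum_(jk in S) lam jk.2 ^+ 2.
Proof. by apply: sumr_ge0 => jk _; rewrite sqr_ge0. Qed.

Lemma Cpred_ge0 : (0 <= Cpred U lam xi S)%E.
Proof.
apply: le_trans (Cpred_ge b); rewrite mule_ge0// ?lee_fin ?sqr_ge0// inve_ge0.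
by rewrite lee_fin mulr_ge0 ?sqr_ge0// sum_sqr_ge0.
Qed.

(** An infinite prediction factor thus forces [S] to be nonempty, which makes [min_sum] positive;
    +oo times 0 would otherwise leave only the bias in the oracle inequality. *)
Lemma Cpred_strong0 : S = finset.set0 -> Cpred U lam xi S = 0%E.
Proof.
move=> S0; apply/eqP; rewrite eq_le Cpred_ge0 andbT; apply: ub_ereal_sup.
move=> _ [c _ <-]; rewrite S0 {1}/pen !big_set0 sub0r.
have -> : Num.max 0 (- (xi^-1 * pen U lam (K :\: finset.set0) c)) = 0.
  apply: max_l; rewrite oppr_le0 mulr_ge0 ?pen_ge0//.
  by have hA := A01; rewrite invr_ge0 divr_ge0//; lra.
by rewrite expr0n mul0e.
Qed.

(** A null denominator is harmless when the supremum is finite: a positive numerator over 0 would be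
    +oo. *)
Lemma Cpred_real_bound (c : R) (x : coefs R J1 dpar kl) :
  Cpred U lam xi S = c%:E ->
  Num.max 0 (pen U lam S x - xi^-1 * pen U lam (K :\: S) x) ^+ 2 <=
  c * ((\sum_(jk in S) lam jk.2 ^+ 2) * norm2n (fit ku U x) ^+ 2).
Proof.
move=> cE; have := Cpred_ge x; rewrite cE.
set N := Num.max _ _ ^+ 2; set D := _ * _.
have D0 : 0 <= D by rewrite mulr_ge0 ?sqr_ge0 ?sum_sqr_ge0.
have N0 : 0 <= N by rewrite sqr_ge0.
rewrite inver; case: ifPn => [/eqP D_0|DN].
  move=> h; rewrite D_0 mulr0 leNgt; apply/negP => Np.
  by move: h; rewrite gt0_muley ?lte_fin// leye_eq.
have Dp : 0 < D by rewrite lt_def DN.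
by rewrite -EFinM lee_fin ler_pdivrMr.
Qed.

(** [amgm] trades the prediction term against half of the first squared error. Doubling what remains
    produces the factor 2 on the bias and the constants 4 (A0 + 1)^2 and 8 A0^2 of [Cpred_star], the
    latter by writing 8 A0 pen as 8 A0^2 (pen / A0). *)
Lemma oracle_inequality (z f : 'cV[R]_n) bhat :
  (forall jk, jk \in K -> forall x : 'cV_(gdim J1 dpar kl jk.1 jk.2),
    dot z (U jk.1 jk.2 *m x) <= n%:R * lam jk.2 * norm2n (U jk.1 jk.2 *m x)) ->
  is_mrgl ku U lam A0 (f + z) bhat ->
  ((norm2n (fit ku U bhat - fit ku U b) ^+ 2 + norm2n (fit ku U bhat - f) ^+ 2)%:E <=
   (2 * norm2n (f - fit ku U b) ^+ 2)%:E +
   Cpred_star U lam A0 xi S * min_sum%:E)%E.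
Proof.
move=> hz hmin.
have := basic_inequality n0 lam_gt0 b A01 strong_sub hz hmin.
set dl := coefs_comb 1 (-1) bhat b.
have fitdl : fit ku U dl = fit ku U bhat - fit ku U b.
  by rewrite fit_comb scale1r scaleN1r.
have hs := strong_split_le; have L0 := sum_sqr_ge0.
have pSc0 : 0 <= pen U lam (K :\: S) b by exact: pen_ge0.
have hA := A01; have A00 : 0 < A0 by lra.
have pA0 : 0 <= pen U lam (K :\: S) b / A0 by rewrite divr_ge0// ltW.
rewrite /Cpred_star.
case E : (Cpred U lam xi S) => [c| |]; last 2 first.
- move=> _; rewrite gt0_muley; last first.
    by rewrite lte_fin mulr_gt0// exprn_gt0//; lra.
  rewrite maxey.
  have [S0|/finset.set0Pn[jk jkS]] := eqVneq S finset.set0.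
    by move: E; rewrite Cpred_strong0.
  have m0 : 0 < min_sum.
    apply: lt_le_trans hs; rewrite (bigD1 jk)//=.
    rewrite -addrA ltr_pwDl ?exprn_gt0// addr_ge0//.
    by apply: sumr_ge0 => i _; rewrite sqr_ge0.
  by rewrite gt0_mulye ?lte_fin// addey ?leey.
- by have := Cpred_ge0; rewrite E.
have hc := Cpred_real_bound dl E.
rewrite fitdl in hc.
set X1 := norm2n (fit ku U bhat - fit ku U b) ^+ 2 in hc *.
set X2 := norm2n (fit ku U bhat - f) ^+ 2.
set B := norm2n (f - fit ku U b) ^+ 2.
set Lm := \sum_(jk in S) _ in hc hs L0.
set D := pen U lam S dl - _ in hc *; set t := Num.max 0 D in hc.
have Dt : D <= t by rewrite le_max lexx orbT.
have t0 : 0 <= t by rewrite le_max lexx.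
have c0 : 0 <= c by have := Cpred_ge0; rewrite E lee_fin.
set ps := pen U lam (K :\: S) b in hs pSc0 pA0 *.
have X10 : 0 <= X1 by rewrite sqr_ge0.
have X20 : 0 <= X2 by rewrite sqr_ge0.
move=> H.
have amgm : 2 * (A0 + 1) * t <= 2 * (A0 + 1) ^+ 2 * (c * Lm) + X1 / 2.
  set u := 2 * (A0 + 1) ^+ 2 * (c * Lm); set w := X1 / 2.
  have u0 : 0 <= u.
    by apply: mulr_ge0; [apply: mulr_ge0 => //; exact: sqr_ge0|exact: mulr_ge0].
  have w0 : 0 <= w by rewrite /w; lra.
  have sq : (2 * (A0 + 1) * t) ^+ 2 <= (u + w) ^+ 2.
    apply: (@le_trans _ _ (4 * u * w)); last by have := sqr_ge0 (u - w); nra.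
    rewrite [leRHS](_ : _ = (2 * (A0 + 1)) ^+ 2 * (c * (Lm * X1))).
      by rewrite exprMn ler_wpM2l// sqr_ge0.
    by rewrite /u /w; field.
  rewrite -[leRHS]ger0_norm ?addr_ge0// -sqrtr_sqr.
  by apply: le_trans (ler_norm _) _; rewrite -sqrtr_sqr ler_wsqrtr.
have hD : 2 * (A0 + 1) * D <= 2 * (A0 + 1) * t by rewrite ler_wpM2l//; lra.
rewrite -EFinM -EFin_max -EFinM -EFinD lee_fin.
set k := Num.max _ _.
have k1 : 8 * A0 ^+ 2 <= k by rewrite le_max lexx.
have k2 : 4 * (A0 + 1) ^+ 2 * c <= k by rewrite le_max lexx orbT.
have k0 : 0 <= k by apply: le_trans k1; rewrite mulr_ge0 ?sqr_ge0.
have h1 : 4 * (A0 + 1) ^+ 2 * c * Lm <= k * Lm by rewrite ler_wpM2r.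
have h2 : 8 * A0 * ps <= k * (ps / A0).
  apply: le_trans (_ : 8 * A0 ^+ 2 * (ps / A0) <= _); last by rewrite ler_wpM2r.
  by rewrite le_eqVlt; apply/orP; left; apply/eqP; field; rewrite gt_eqF.
have h3 : k * (Lm + ps / A0) <= k * min_sum by rewrite ler_wpM2l.
rewrite mulrDr in h3.
have h4 : 2 * (A0 + 1) ^+ 2 * (c * Lm) = (4 * (A0 + 1) ^+ 2 * c * Lm) / 2 by field.
clear -H amgm hD h1 h2 h3 h4 X20; lra.
Qed.

End OracleBound.

(** * Sums over the resolution levels *)

Section RealLemmas.
Variable R : realType.
Implicit Types (x y t s : R).

(** Tangent to the exponential at the weighted mean [m] of the two logarithms, averaged with weights
    [th] and [1 - th]. *)
Lemma young_powR (th x y : R) : 0 <= th <= 1 -> 0 <= x -> 0 <= y ->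
  x `^ th * y `^ (1 - th) <= th * x + (1 - th) * y.
Proof.
move=> /andP[t0 t1] x0 y0.
have [->|tN0] := eqVneq th 0.
  by rewrite powRr0 !subr0 powRr1// mul0r !mul1r add0r.
have [->|tN1] := eqVneq th 1.
  by rewrite subrr powRr0 powRr1// mul0r !mul1r addr0 mulr1.
have [->|xN0] := eqVneq x 0.
  by rewrite powR0// mul0r mulr0 add0r mulr_ge0//; lra.
have [->|yN0] := eqVneq y 0.
  by rewrite powR0 ?mulr0 ?addr0 ?mulr_ge0// subr_eq0 eq_sym.
rewrite /powR (negbTE xN0) (negbTE yN0) -expRD.
have xp : 0 < x by rewrite lt_def xN0.
have yp : 0 < y by rewrite lt_def yN0.
set m := _ + _.
have tangent z : 0 < z -> expR m * (1 + (ln z - m)) <= z.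
  move=> z0; apply: (@le_trans _ _ (expR m * expR (ln z - m))).
    by rewrite ler_wpM2l ?expR_ge0// expR_ge1Dx.
  by rewrite -expRD addrC subrK lnK.
have hx : expR m * (1 + (ln x - m)) <= x.
  exact: tangent.
have hy : expR m * (1 + (ln y - m)) <= y.
  exact: tangent.
have : th * (expR m * (1 + (ln x - m))) + (1 - th) * (expR m * (1 + (ln y - m))) =
  expR m by rewrite /m; ring.
have : th * (expR m * (1 + (ln x - m))) <= th * x by rewrite ler_wpM2l.
have : (1 - th) * (expR m * (1 + (ln y - m))) <= (1 - th) * y.
  by rewrite ler_wpM2l//; lra.
lra.
Qed.

Lemma sum_eq0_imp (I : Type) (s : seq I) (P : pred I) (u v : I -> R) :
  (forall i, P i -> 0 <= u i) -> (forall i, P i -> u i = 0 -> v i = 0) ->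
  \sum_(i <- s | P i) u i = 0 -> \sum_(i <- s | P i) v i = 0.
Proof.
move=> u0 uv; elim: s => [|i l IH]; first by rewrite !big_nil.
rewrite !big_cons; case: ifP => // Pi /eqP.
rewrite paddr_eq0 ?u0 ?sumr_ge0// => /andP[/eqP ui /eqP /IH ->].
by rewrite uv// addr0.
Qed.

Lemma powRVl (x r : R) : 0 <= x -> x^-1 `^ r = (x `^ r)^-1.
Proof. by move=> x0; rewrite -powR_inv1// -powRrM mulN1r powRN. Qed.

(** Young's inequality after normalising both sums to 1. The endpoints are treated first, as a zero
    base may there meet the power 0. *)
Lemma hoelder_sum (I : Type) (s : seq I) (P : pred I) (x y : I -> R) (th : R) :
  0 <= th <= 1 -> (forall i, P i -> 0 <= x i) -> (forall i, P i -> 0 <= y i) ->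
  \sum_(i <- s | P i) x i `^ th * y i `^ (1 - th) <=
  (\sum_(i <- s | P i) x i) `^ th * (\sum_(i <- s | P i) y i) `^ (1 - th).
Proof.
move=> th01 x0 y0.
set X := \sum_(i <- s | P i) x i; set Y := \sum_(i <- s | P i) y i.
have X0 : 0 <= X by exact: sumr_ge0.
have Y0 : 0 <= Y by exact: sumr_ge0.
have /andP[t0 t1] := th01.
have [t_0|tN0] := eqVneq th 0.
  rewrite t_0 powRr0 subr0 powRr1// mul1r.
  by apply: ler_sum => i Pi; rewrite powRr0 powRr1 ?mul1r// y0.
have [t_1|tN1] := eqVneq th 1.
  rewrite t_1 subrr powRr0 powRr1// mulr1.
  by apply: ler_sum => i Pi; rewrite powRr0 powRr1 ?mulr1// x0.
have tN1' : 1 - th != 0 by rewrite subr_eq0 eq_sym.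
have [X_0|XN0] := eqVneq X 0.
  rewrite (sum_eq0_imp x0 _ X_0) ?mulr_ge0 ?powR_ge0// => i Pi ->.
  by rewrite powR0// mul0r.
have [Y_0|YN0] := eqVneq Y 0.
  rewrite (sum_eq0_imp y0 _ Y_0) ?mulr_ge0 ?powR_ge0// => i Pi ->.
  by rewrite powR0// mulr0.
have Xp : 0 < X by rewrite lt_def XN0.
have Yp : 0 < Y by rewrite lt_def YN0.
have XYp : 0 < X `^ th * Y `^ (1 - th) by rewrite mulr_gt0 ?powR_gt0.
rewrite -[leRHS]mul1r -ler_pdivrMr// mulr_suml.
apply: (@le_trans _ _ (\sum_(i <- s | P i) (th * (x i / X) + (1 - th) * (y i / Y)))).
  apply: ler_sum => i Pi.
  have -> : x i `^ th * y i `^ (1 - th) / (X `^ th * Y `^ (1 - th)) =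
      (x i / X) `^ th * (y i / Y) `^ (1 - th).
    by rewrite !powRM ?invr_ge0 ?x0 ?y0// !powRVl// invfM mulrACA.
  by apply: young_powR; rewrite ?divr_ge0 ?x0 ?y0.
by rewrite big_split/= -!mulr_sumr -!mulr_suml !divff// !mulr1 addrC subrK.
Qed.

(** The minimum m is m^(1-q) m^q, and the two factors are bounded by different entries. *)
Lemma min_powR_le (q x t : R) : 0 <= q <= 1 -> 0 < x -> 0 <= t ->
  Num.min (x ^+ 2) (x * t) <= x `^ (2 - q) * t `^ q.
Proof.
move=> /andP[q0 q1] x0; rewrite le0r => /orP[/eqP ->|t0].
  by rewrite mulr0 ge_min mulr_ge0 ?powR_ge0// orbT.
set m := Num.min _ _.
have u0 : 0 < x ^+ 2 by rewrite exprn_gt0.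
have v0 : 0 < x * t by rewrite mulr_gt0.
have m0 : 0 < m by rewrite lt_min u0 v0.
have -> : x `^ (2 - q) * t `^ q = (x ^+ 2) `^ (1 - q) * (x * t) `^ q.
  rewrite powRM ?ltW// mulrA -powR_mulrn ?ltW// -powRrM -powRD ?(gt_eqF x0) ?implybT//.
  by congr (_ `^ _ * _); ring.
have mE : m = m `^ (1 - q) * m `^ q.
  by rewrite -powRD ?(gt_eqF m0) ?implybT// subrK powRr1// ltW.
rewrite [leLHS]mE; apply: ler_pM; rewrite ?powR_ge0//; apply: ge0_ler_powR;
  rewrite ?nnegrE ?(ltW m0) ?(ltW u0) ?(ltW v0) ?subr_ge0// /m ge_min lexx ?orbT//.
Qed.

(** The cut [kp] is real. A top index above it drops out; otherwise that index costs at most 2^(c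
    kp) and all others lie below [kp - 1], so the cut moves down with the induction. Keeping [N]
    terms reproduces the finite sum of [Jc]. *)
Lemma geo_low (c kp : R) kl N : 0 <= c ->
  \sum_(kl.+1 <= k < (kl + N).+1 | k%:R <= kp) 2 `^ (c * k%:R) <=
  2 `^ (c * kp) * \sum_(0 <= i < N) 2 `^ (- c * i%:R).
Proof.
move=> c0; elim: N kp => [|N IH] kp.
  by rewrite addn0 big_geq// big_geq// mulr0.
rewrite addnS big_mkcond big_nat_recr ?ltnS ?leq_addr//= -big_mkcond.
case: ifPn => [h|h]; last first.
  rewrite addr0; apply: le_trans (IH kp) _; rewrite ler_wpM2l ?powR_ge0//.
  by rewrite big_nat_recr//= lerDl powR_ge0.
rewrite big_nat_recl//= mulrDr mulr0 powRr0 mulr1 addrC; apply: lerD.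
  by rewrite ler_powR ?ler1n// ler_wpM2l.
have -> : 2 `^ (c * kp) * \sum_(0 <= i < N) 2 `^ (- c * i.+1%:R) =
  2 `^ (c * (kp - 1)) * \sum_(0 <= i < N) 2 `^ (- c * i%:R) :> R.
  rewrite !mulr_sumr; apply: eq_bigr => i _.
  by rewrite -!powRD ?pnatr_eq0 ?implybT//; congr (_ `^ _); rewrite -natr1; ring.
apply: le_trans (IH (kp - 1)).
rewrite [leLHS]big_nat_cond [leRHS]big_nat_cond [leLHS]big_mkcond [leRHS]big_mkcond.
apply: ler_sum => k _; case: ifP => [/andP[/andP[k1 k2] kk]|_]; last first.
  by case: ifP => _; rewrite ?powR_ge0.
rewrite k1 k2 /= ifT// lerBrDr; apply: le_trans h.
by rewrite natr1 ler_nat.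
Qed.

Lemma geo_high (c kp : R) kl N : 0 <= c ->
  \sum_(kl.+1 <= k < (kl + N).+1 | kp < k%:R) 2 `^ (- c * k%:R) <=
  2 `^ (- c * kp) * \sum_(0 <= i < N) 2 `^ (- c * i%:R).
Proof.
move=> c0; elim: N kl kp => [|N IH] kl kp.
  by rewrite addn0 big_geq// big_geq// mulr0.
rewrite addnS big_mkcond big_ltn ?ltnS ?leq_addr//= -big_mkcond.
have h2 x : kp < x -> 2 `^ (- c * x) <= 2 `^ (- c * kp) :> R.
  by move=> kx; rewrite ler_powR ?ler1n// !mulNr lerN2 ler_wpM2l// ltW.
case: ifPn => [h|h]; last first.
  rewrite add0r -addSn; apply: le_trans (IH kl.+1 kp) _.
  rewrite ler_wpM2l ?powR_ge0//.
  by rewrite big_nat_recr//= lerDl powR_ge0.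
rewrite big_nat_recl//= mulrDr mulr0 powRr0 mulr1; apply: lerD; first exact: h2.
have -> : 2 `^ (- c * kp) * \sum_(0 <= i < N) 2 `^ (- c * i.+1%:R) =
  2 `^ (- c * (kp + 1)) * \sum_(0 <= i < N) 2 `^ (- c * i%:R) :> R.
  rewrite !mulr_sumr; apply: eq_bigr => i _.
  by rewrite -!powRD ?pnatr_eq0 ?implybT//; congr (_ `^ _); rewrite -natr1; ring.
rewrite -addSn; apply: le_trans (IH kl.+1 (kp + 1)).
rewrite [leLHS]big_nat_cond [leRHS]big_nat_cond [leLHS]big_mkcond [leRHS]big_mkcond.
apply: ler_sum => k _; case: ifP => [/andP[/andP[k1 k2] kk]|_]; last first.
  by case: ifP => _; rewrite ?powR_ge0.
rewrite k1 k2 /= ifT//; apply: (lt_le_trans (_ : _ < kl.+2%:R)); last by rewrite ler_nat.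
by rewrite -natr1 ltrD2r.
Qed.

End RealLemmas.

Section LevelSums.
Variable R : realType.
Implicit Types (a b q alpha sigma : R) (t : nat -> R).

Definition level_min sigma t (k : nat) : R :=
  Num.min ((sigma * 2 `^ (k%:R / 2)) ^+ 2) (sigma * 2 `^ (k%:R / 2) * t k).

Lemma pow2D (x y : R) : 2 `^ (x + y) = 2 `^ x * 2 `^ y :> R.
Proof. by rewrite powRD// pnatr_eq0 implybT. Qed.

Lemma low_sum_le q (alpha0 : R) sigma t a kl m (Q : pred nat) :
  0 <= q <= 1 -> 0 < sigma -> (forall k, 0 <= t k) -> 0 <= a ->
  \sum_(kl <= k < m) 2 `^ (2 * alpha0 * k%:R) * t k ^+ 2 <= a ^+ 2 ->
  \sum_(kl <= k < m | Q k) level_min sigma t k <=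
  sigma `^ (2 - q) * (\sum_(kl <= k < m | Q k)
     2 `^ ((1 - q / 2 - alpha0 * q) * k%:R / (1 - q / 2))) `^ (1 - q / 2) * a `^ q.
Proof.
move=> q01 s0 t0 a0 ha; have /andP[q0 q1] := q01.
set c := 1 - q / 2 - alpha0 * q; set s := 1 - q / 2.
have sN0 : s != 0 by rewrite /s gt_eqF//; lra.
pose y k := 2 `^ (2 * alpha0 * k%:R) * t k ^+ 2.
have y0 k : 0 <= y k by rewrite mulr_ge0 ?powR_ge0 ?sqr_ge0.
have hy : (\sum_(kl <= k < m | Q k) y k) `^ (1 - s) <= a `^ q.
  have -> : a `^ q = (a ^+ 2) `^ (1 - s).
    by rewrite -powR_mulrn// -powRrM; congr (_ `^ _); rewrite /s; field.
  apply: ge0_ler_powR; rewrite ?nnegrE ?sqr_ge0 ?sumr_ge0//; first by rewrite /s; lra.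
  apply: le_trans ha; rewrite [leLHS]big_mkcond; apply: ler_sum => k _.
  by case: ifP => // _; exact: y0.
apply: (@le_trans _ _ (sigma `^ (2 - q) * ((\sum_(kl <= k < m | Q k)
    2 `^ (c * k%:R / s)) `^ s * (\sum_(kl <= k < m | Q k) y k) `^ (1 - s)))); last first.
  rewrite -[leRHS]mulrA ler_wpM2l ?powR_ge0//.
  by rewrite ler_wpM2l ?powR_ge0.
apply: (@le_trans _ _ (sigma `^ (2 - q) * \sum_(kl <= k < m | Q k)
    (2 `^ (c * k%:R / s)) `^ s * y k `^ (1 - s))); last first.
  rewrite ler_wpM2l ?powR_ge0//; apply: hoelder_sum.
  - by rewrite /s; apply/andP; split; lra.
  - by move=> k _; rewrite powR_ge0.
  - by move=> k _; exact: y0.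
rewrite mulr_sumr; apply: ler_sum => k _.
apply: le_trans (min_powR_le q01 _ (t0 k)) _; first by rewrite mulr_gt0 ?powR_gt0.
rewrite powRM ?powR_ge0 ?(ltW s0)//. rewrite -!mulrA ler_wpM2l ?powR_ge0//.
rewrite /y powRM ?powR_ge0 ?sqr_ge0// -powR_mulrn// -!powRrM mulrA -pow2D.
rewrite le_eqVlt; apply/orP; left; apply/eqP; congr (2 `^ _ * _ `^ _).
  by rewrite /c /s; field; apply/eqP; lra.
by rewrite /s; field.
Qed.

(** The exponent is spelled [1 - 1 / 2] to match [Jc] at [q = 1]. *)
Lemma high_sum_le alpha sigma t b kl m (Q : pred nat) :
  0 < sigma -> (forall k, 0 <= t k) -> 0 <= b ->
  \sum_(kl <= k < m) 2 `^ (2 * alpha * k%:R) * t k ^+ 2 <= b ^+ 2 ->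
  \sum_(kl <= k < m | Q k) level_min sigma t k <=
  sigma * (\sum_(kl <= k < m | Q k)
     2 `^ (- (alpha - 2^-1) * k%:R / (1 - 1 / 2))) `^ (1 - 1 / 2) * b.
Proof.
move=> s0 t0 b0 hb.
have h12 : 1 - 1 / 2 = 1 / 2 :> R by field.
pose y k := 2 `^ (2 * alpha * k%:R) * t k ^+ 2.
have y0 k : 0 <= y k by rewrite mulr_ge0 ?powR_ge0 ?sqr_ge0.
have hy : (\sum_(kl <= k < m | Q k) y k) `^ (1 - (1 - 1 / 2)) <= b.
  have bE : (b ^+ 2) `^ (1 - (1 - 1 / 2)) = b.
    rewrite -powR_mulrn// -powRrM -[RHS]powRr1//; congr (_ `^ _); by field.
  rewrite -[leRHS]bE.
  apply: ge0_ler_powR; rewrite ?nnegrE ?sqr_ge0 ?sumr_ge0//.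
  apply: le_trans hb; rewrite [leLHS]big_mkcond; apply: ler_sum => k _.
  by case: ifP => // _; exact: y0.
apply: (@le_trans _ _ (sigma * ((\sum_(kl <= k < m | Q k)
    2 `^ (- (alpha - 2^-1) * k%:R / (1 - 1 / 2))) `^ (1 - 1 / 2) *
    (\sum_(kl <= k < m | Q k) y k) `^ (1 - (1 - 1 / 2))))); last first.
  rewrite -[leRHS]mulrA ler_wpM2l ?(ltW s0)//.
  by rewrite ler_wpM2l ?powR_ge0.
apply: (@le_trans _ _ (sigma * \sum_(kl <= k < m | Q k)
    (2 `^ (- (alpha - 2^-1) * k%:R / (1 - 1 / 2))) `^ (1 - 1 / 2) *
    y k `^ (1 - (1 - 1 / 2)))); last first.
  rewrite ler_wpM2l ?(ltW s0)//; apply: hoelder_sum.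
  - by apply/andP; split; lra.
  - by move=> k _; rewrite powR_ge0.
  - by move=> k _; exact: y0.
rewrite mulr_sumr; apply: ler_sum => k _.
rewrite ge_min; apply/orP; right.
rewrite -mulrA ler_wpM2l ?(ltW s0)//.
rewrite /y powRM ?powR_ge0 ?sqr_ge0// -powR_mulrn// -!powRrM mulrA -pow2D.
rewrite le_eqVlt; apply/orP; left; apply/eqP; rewrite -[in LHS](powRr1 (t0 k)).
by congr (2 `^ _ * _ `^ _); field.
Qed.

Lemma Jc_ge0 (c q : R) k1 k2 : 0 <= Jc c q k1 k2.
Proof. by rewrite powR_ge0. Qed.

Lemma Jc_gt0 (c q : R) k1 k2 : (k1 < k2)%N -> 0 < Jc c q k1 k2.
Proof.
move=> k12; rewrite powR_gt0//; case: ifP => _.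
  rewrite big_ltn//= ltr_pwDl ?powR_gt0//.
  by apply: sumr_ge0 => k _; exact: powR_ge0.
rewrite big_ltn ?subn_gt0//= ltr_pwDl ?powR_gt0//.
by apply: sumr_ge0 => k _; exact: powR_ge0.
Qed.

Lemma gapE q (alpha0 : R) : gap q alpha0 = Num.max 0 (1 - q / 2 - alpha0 * q).
Proof. by rewrite /gap (mulrC q alpha0). Qed.

Lemma gap_ge0 q (alpha0 : R) : 0 <= gap q alpha0.
Proof. by rewrite le_max lexx. Qed.

Lemma rho_ge0 q alpha (alpha0 : R) : 2^-1 < alpha -> 0 <= rho q alpha alpha0.
Proof.
by move=> ha; rewrite divr_ge0 ?gap_ge0// addr_ge0 ?gap_ge0// subr_ge0 ltW.
Qed.

Lemma rho_lt1 q alpha (alpha0 : R) : 2^-1 < alpha -> rho q alpha alpha0 < 1.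
Proof.
move=> ha; have g0 := gap_ge0 q alpha0.
by rewrite /rho ltr_pdivrMr; lra.
Qed.

(** The low levels give sigma the power 2 - q and the high levels the power 1; the best cut weights
    them by 1 - rho and rho. *)
Lemma gamma_rho q alpha (alpha0 : R) : 2^-1 < alpha ->
  gamma q alpha alpha0 = (2 - q) * (1 - rho q alpha alpha0) + rho q alpha alpha0.
Proof.
move=> ha; have g0 := gap_ge0 q alpha0; rewrite /gamma /rho; field.
by apply/eqP; lra.
Qed.

(* Minimises [A x ^ r + B x ^ (r - 1)] over [x > 0]; [Jprefactor] is the
   resulting constant. *)
Lemma Jprefactor_opt (A B r : R) : 0 < A -> 0 < B -> 0 < r < 1 ->
  exists2 x : R, 0 < x &
    A * x `^ r + B * x `^ (r - 1) = Jprefactor r * A `^ (1 - r) * B `^ r.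
Proof.
move=> A0 B0 /andP[r0 r1].
have u0 : 0 < r^-1 - 1 by rewrite subr_gt0 invf_gt1.
(* The zero of the derivative: r A x^(r-1) = (1 - r) B x^(r-2). *)
exists ((r^-1 - 1) * (B / A)); first by rewrite mulr_gt0// divr_gt0.
rewrite /Jprefactor gt_eqF//.
have BA0 : 0 <= B / A by rewrite divr_ge0 ?ltW.
have u0' := ltW u0; have A0' := ltW A0; have B0' := ltW B0.
rewrite !powRM ?invr_ge0// !powRVl//.
have pA (x y : R) : A `^ (x + y) = A `^ x * A `^ y by rewrite powRD// ?(gt_eqF A0) ?(gt_eqF B0) implybT.
have pB (x y : R) : B `^ (x + y) = B `^ x * B `^ y by rewrite powRD// ?(gt_eqF A0) ?(gt_eqF B0) implybT.
have A1 : A `^ (1 - r) * A `^ r = A by rewrite -pA subrK powRr1// ltW.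
have B1 : B `^ (r - 1) * B = B `^ r.
  by rewrite -[X in _ * X](powRr1 (ltW B0)) -pB subrK.
have Ar : 0 < A `^ r by rewrite powR_gt0.
have A2 : (A `^ (r - 1))^-1 = A `^ (1 - r) by rewrite -powRN opprB.
rewrite A2 -B1 mulrDl mulrDl; congr (_ + _); last by ring.
rewrite -[X in X * _]A1; field; rewrite gt_eqF//.
Qed.

End LevelSums.

Section LevelSumBound.
Variable R : realType.
Implicit Types (a b q alpha sigma : R) (t : nat -> R).

Lemma low_geo_le (c s kp : R) kl ku : 0 < c -> 0 < s -> (kl <= ku)%N ->
  (\sum_(kl.+1 <= k < ku.+1 | k%:R <= kp) 2 `^ (c * k%:R / s)) `^ s <=
  2 `^ (c * kp) * (\sum_(0 <= k < ku - kl) 2 `^ (- c * k%:R / s)) `^ s.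
Proof.
move=> c0 s0 klu; have cs0 : 0 <= c / s by rewrite divr_ge0 ?ltW.
have := @geo_low R (c / s) kp kl (ku - kl) cs0; rewrite subnKC// => h.
have -> : 2 `^ (c * kp) = (2 `^ (c / s * kp)) `^ s :> R.
  by rewrite -powRrM; congr (_ `^ _); field; rewrite gt_eqF.
rewrite -powRM ?powR_ge0 ?sumr_ge0//.
apply: ge0_ler_powR; rewrite ?nnegrE ?mulr_ge0 ?powR_ge0 ?sumr_ge0 ?(ltW s0)//.
have E (k : nat) : c * k%:R / s = c / s * k%:R by rewrite mulrAC.
have E' (k : nat) : - c * k%:R / s = - (c / s) * k%:R by field; rewrite gt_eqF.
under eq_bigr do rewrite E.
by under [X in _ <= _ * X]eq_bigr do rewrite E'.
Qed.

Lemma high_geo_le (c s kp : R) kl ku : 0 < c -> 0 < s -> (kl <= ku)%N ->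
  (\sum_(kl.+1 <= k < ku.+1 | kp < k%:R) 2 `^ (- c * k%:R / s)) `^ s <=
  2 `^ (- c * kp) * (\sum_(0 <= k < ku - kl) 2 `^ (- c * k%:R / s)) `^ s.
Proof.
move=> c0 s0 klu; have cs0 : 0 <= c / s by rewrite divr_ge0 ?ltW.
have := @geo_high R (c / s) kp kl (ku - kl) cs0; rewrite subnKC// => h.
have -> : 2 `^ (- c * kp) = (2 `^ (- (c / s) * kp)) `^ s :> R.
  by rewrite -powRrM; congr (_ `^ _); field; rewrite gt_eqF.
rewrite -powRM ?powR_ge0 ?sumr_ge0//.
have E (k : nat) : - c * k%:R / s = - (c / s) * k%:R by field; rewrite gt_eqF.
apply: ge0_ler_powR; rewrite ?nnegrE ?mulr_ge0 ?powR_ge0 ?sumr_ge0 ?(ltW s0)//.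
under eq_bigr do rewrite E.
by under [X in _ <= _ * X]eq_bigr do rewrite E.
Qed.

Lemma Jprefactor_ge0 (r : R) : 0 <= Jprefactor r.
Proof. by rewrite /Jprefactor; case: ifP => // _; rewrite addr_ge0 ?powR_ge0. Qed.

Lemma Jrate_ge0 q alpha (alpha0 : R) kl ku : 0 <= Jrate q alpha alpha0 kl ku.
Proof.
by rewrite /Jrate mulr_ge0 ?powR_ge0// mulr_ge0 ?powR_ge0// Jprefactor_ge0.
Qed.

(** The bound in alpha is asked for only when the gap is positive, so that the case rho = 0 also
    covers components of infinite alpha-norm. *)
Lemma level_sum_le q alpha (alpha0 : R) sigma t a b kl ku :
  0 <= q <= 1 -> 2^-1 < alpha -> 0 < sigma -> (forall k, 0 <= t k) ->
  (kl <= ku)%N -> 0 < a -> 0 < b ->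
  \sum_(kl.+1 <= k < ku.+1) 2 `^ (2 * alpha0 * k%:R) * t k ^+ 2 <= a ^+ 2 ->
  (0 < gap q alpha0 ->
   \sum_(kl.+1 <= k < ku.+1) 2 `^ (2 * alpha * k%:R) * t k ^+ 2 <= b ^+ 2) ->
  \sum_(kl.+1 <= k < ku.+1) level_min sigma t k <=
  sigma `^ gamma q alpha alpha0 * Jrate q alpha alpha0 kl ku *
  (a `^ (q * (1 - rho q alpha alpha0)) * b `^ rho q alpha alpha0).
Proof.
move=> q01 halpha s0 t0 klu a0 b0 ha hb; have /andP[q0 q1] := q01.
(* Without fine levels both [Jc] vanish, and the optimisation over the cut would degenerate. *)
have [kE|kN] := eqVneq kl ku.
  rewrite kE big_geq//. apply: mulr_ge0; last by rewrite mulr_ge0 ?powR_ge0.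
  by rewrite mulr_ge0 ?powR_ge0 ?Jrate_ge0.
have klu' : (kl < ku)%N by rewrite ltn_neqAle kN.
have rho1 := rho_lt1 q alpha0 halpha.
rewrite gamma_rho// /Jrate; move: hb rho1; rewrite {1}gapE /rho gapE.
set c := 1 - q / 2 - alpha0 * q.
(* For [c <= 0] the low bound is kept on every level, without a cut: rho = 0 and gamma = 2 - q. *)
have [c0|c0] := leP c 0.
  rewrite mul0r => _ _.
  rewrite [leRHS](_ : _ = sigma `^ (2 - q) * Jc c q kl ku * a `^ q).
    by rewrite /Jc c0; apply: (low_sum_le xpredT q01 s0 t0 (ltW a0)).
  move: (Jc c q kl ku) (Jc_ge0 c q kl ku) (Jc (alpha - 2^-1) 1 kl ku) => J J0 J'.
  by rewrite subr0 !mulr1 addr0 !powRr0 (powRr1 J0) /Jprefactor eqxx mul1r !mulr1.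
set c' := alpha - 2^-1; set r := c / (c' + c) => hb r1.
have {}hb := hb c0; have c'0 : 0 < c' by rewrite subr_gt0.
have cc0 : 0 < c' + c by rewrite addr_gt0.
have r0 : 0 < r by rewrite divr_gt0.
set J := Jc c q kl ku; set J' := Jc c' 1 kl ku.
have J0 : 0 < J by exact: Jc_gt0.
have J'0 : 0 < J' by exact: Jc_gt0.
pose A := sigma `^ (2 - q) * J * a `^ q; pose B := sigma * J' * b.
have A0 : 0 < A := mulr_gt0 (mulr_gt0 (powR_gt0 _ s0) J0) (powR_gt0 _ a0).
have B0 : 0 < B := mulr_gt0 (mulr_gt0 s0 J'0) b0.
have [x x0 hx] := Jprefactor_opt A0 B0 (introT andP (conj r0 r1)).
have l2 : 0 < ln 2 :> R by rewrite ln_gt0// ltr1n.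
(* The cut solves 2^((c' + c) kp) = x for the optimal [x]. *)
pose kp := ln x / (ln 2 * (c' + c)).
have E e : 2 `^ (e * (c' + c) * kp) = x `^ e.
  rewrite /powR pnatr_eq0 (gt_eqF x0)/=; congr expR; rewrite /kp; field.
  by rewrite !gt_eqF.
have rc : r * (c' + c) = c by rewrite /r divfK// gt_eqF.
have E1 : 2 `^ (c * kp) = x `^ r by rewrite -(E r) rc.
have E2 : 2 `^ (- c' * kp) = x `^ (r - 1).
  have -> : - c' = (r - 1) * (c' + c) by rewrite mulrBl rc; ring.
  exact: E.
clearbody kp r.
have q2 : 0 < 1 - q / 2 by lra.
have h1 : \sum_(kl.+1 <= k < ku.+1 | k%:R <= kp) level_min sigma t k <= A * x `^ r.
  apply: le_trans (low_sum_le (fun k => k%:R <= kp) q01 s0 t0 (ltW a0) ha) _.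
  rewrite [leRHS](_ : _ = sigma `^ (2 - q) * (2 `^ (c * kp) * J) * a `^ q);
    last by rewrite E1 /A; ring.
  rewrite -/c ler_wpM2r ?powR_ge0// ler_wpM2l ?powR_ge0// /J /Jc (lt_geF c0).
  exact: low_geo_le.
have h2 : \sum_(kl.+1 <= k < ku.+1 | ~~ (k%:R <= kp)) level_min sigma t k <=
    B * x `^ (r - 1).
  under eq_bigl do rewrite -ltNge.
  apply: le_trans (high_sum_le (fun k => kp < k%:R) s0 t0 (ltW b0) hb) _.
  rewrite [leRHS](_ : _ = sigma * (2 `^ (- c' * kp) * J') * b);
    last by rewrite E2 /B; ring.
  rewrite -/c' ler_wpM2r ?(ltW b0)// ler_wpM2l ?(ltW s0)// /J' /Jc (lt_geF c'0).
  by apply: high_geo_le => //; lra.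
rewrite (bigID (fun k => k%:R <= kp))/=; apply: le_trans (lerD h1 h2) _.
rewrite hx le_eqVlt; apply/orP; left; apply/eqP.
clearbody J J'.
have Ae e : A `^ e = sigma `^ ((2 - q) * e) * J `^ e * a `^ (q * e).
  rewrite /A (powRM _ (mulr_ge0 (powR_ge0 _ _) (ltW J0)) (powR_ge0 _ _)).
  by rewrite (powRM _ (powR_ge0 _ _) (ltW J0)) -!powRrM.
have Be e : B `^ e = sigma `^ e * J' `^ e * b `^ e.
  by rewrite /B (powRM _ (mulr_ge0 (ltW s0) (ltW J'0)) (ltW b0)) (powRM _ (ltW s0) (ltW J'0)).
rewrite Ae Be (_ : sigma `^ (_ + r) = sigma `^ ((2 - q) * (1 - r)) * sigma `^ r).
  2: by rewrite powRD// (gt_eqF s0) implybT.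
by ring.
Qed.

End LevelSumBound.

(** * Complexity measures *)

Section Sobolev.
Variables (R : realType) (n p : nat) (J1 : {set 'I_p}) (dpar : 'I_p -> nat).
Variables (kl : nat) (U : design R n J1 dpar kl) (beta : coefs R J1 dpar kl).

Definition level_norm (j : 'I_p) (k : nat) : R := norm2n (block U beta j k).

Lemma level_norm_ge0 j k : 0 <= level_norm j k.
Proof. exact: norm2n_ge0. Qed.

Lemma sobolev_ge0 a j : (0 <= sobolev U beta a j)%E.
Proof. exact: poweR_ge0. Qed.

Let term a j k : \bar R := (2 `^ (2 * a * k%:R) * level_norm j k ^+ 2)%:E.

Let term_ge0 a j k : (0 <= term a j k)%E.
Proof. by rewrite lee_fin mulr_ge0 ?powR_ge0 ?sqr_ge0. Qed.

Let series_ge0 a j : (0 <= \sum_(kl.+1 <= k <oo) term a j k)%E.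
Proof. by apply: nneseries_ge0 => k _ _; exact: term_ge0. Qed.

Lemma sobolev_partial a j (r : R) m : sobolev U beta a j = r%:E ->
  \sum_(kl.+1 <= k < m) 2 `^ (2 * a * k%:R) * level_norm j k ^+ 2 <= r ^+ 2.
Proof.
move=> sE; rewrite -lee_fin -sumEFin.
apply: le_trans (nneseries_lim_ge (P := xpredT) _ _) _.
  by move=> k _ _; exact: term_ge0.
have r0 : 0 <= r by rewrite -lee_fin -sE sobolev_ge0.
have : (sobolev U beta a j `^ 2 = (r ^+ 2)%:E)%E.
  by rewrite sE poweR_EFin powR_mulrn.
rewrite /sobolev -poweRrM mulVf ?pnatr_eq0// poweRe1 => [-> //|].
exact: series_ge0.
Qed.

Lemma sobolev_eq0P a j : sobolev U beta a j = 0%E <->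
  (forall k, (kl < k)%N -> level_norm j k = 0).
Proof.
split=> [sE k klk|h].
  have := sobolev_partial k.+1 sE; rewrite expr0n big_nat_recr//=.
  have : 0 <= \sum_(kl.+1 <= i < k) 2 `^ (2 * a * i%:R) * level_norm j i ^+ 2.
    by apply: sumr_ge0 => i _; rewrite mulr_ge0 ?powR_ge0 ?sqr_ge0.
  set X := \sum_(_ <= _ < _) _ => X0 hX.
  have h0 : 2 `^ (2 * a * k%:R) * level_norm j k ^+ 2 <= 0 by lra.
  rewrite pmulr_rle0 ?powR_gt0// in h0.
  by apply/eqP; rewrite -sqrf_eq0 eq_le h0 sqr_ge0.
rewrite /sobolev eseries0 ?poweR0r ?invr_eq0 ?pnatr_eq0// => k klk _.
by rewrite -/(level_norm j k) h// expr0n mulr0.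
Qed.

(** Both norms vanish exactly when all fine blocks do, whatever the weights. This matches zero and
    nonzero components between alpha0 and alpha. *)
Lemma sobolev_eq0_indep a a' j :
  (sobolev U beta a j == 0%E) = (sobolev U beta a' j == 0%E).
Proof. by apply/eqP/eqP => /sobolev_eq0P h; apply/sobolev_eq0P. Qed.

Lemma sobolev_le a a' j : a <= a' -> (sobolev U beta a j <= sobolev U beta a' j)%E.
Proof.
move=> aa; apply: gt0_ler_poweR; rewrite ?in_itv/= ?leey ?andbT ?invr_ge0//.
- exact: series_ge0.
- exact: series_ge0.
apply: lee_nneseries => k; first by move=> _ _; exact: term_ge0.
move=> _; rewrite lee_fin ler_wpM2r ?sqr_ge0// ler_powR ?ler1n//.
by rewrite ler_wpM2r// ler_wpM2l.
Qed.

Lemma M_ge0 a (q : \bar R) : (0 < q)%E -> (0 <= M U beta a q)%E.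
Proof.
case: q => [r| |]//=; last by move=> _; exact: bigmax_ge_id.
by rewrite lte_fin => r0; rewrite gt_eqF// poweR_ge0.
Qed.

Lemma sobolev_le_M a j (q : \bar R) : j \in J1 -> (0 < q)%E ->
  (sobolev U beta a j <= M U beta a q)%E.
Proof.
move=> jJ; case: q => [r| |]//=; last by move=> _; apply: le_bigmax_cond.
rewrite lte_fin => r0; rewrite gt_eqF//.
rewrite -[leLHS](@poweRe1 _ _ (sobolev_ge0 a j)) -(mulfV (lt0r_neq0 r0)) poweRrM.
apply: gt0_ler_poweR; rewrite ?in_itv/= ?leey ?andbT ?invr_ge0 ?poweR_ge0 ?(ltW r0)//.
  by apply: sume_ge0 => i _; exact: poweR_ge0.
by rewrite (bigD1 j)//= leeDl// sume_ge0// => i _; exact: poweR_ge0.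
Qed.

Lemma M_fin a (s : 'I_p -> R) (r : R) : 0 < r ->
  (forall j, j \in J1 -> sobolev U beta a j = (s j)%:E) ->
  M U beta a r%:E = ((\sum_(j in J1) s j `^ r) `^ r^-1)%:E.
Proof.
move=> r0 sE; rewrite /= gt_eqF// /Mpos -poweR_EFin -sumEFin.
by congr (_ `^ _)%E; apply: eq_bigr => j jJ; rewrite sE.
Qed.

Lemma M_fin_oo a (s : 'I_p -> R) :
  (forall j, j \in J1 -> sobolev U beta a j = (s j)%:E) ->
  M U beta a +oo%E = (\big[Num.max/0]_(j in J1) s j)%:E.
Proof. by move=> sE; rewrite -EFin_bigmax; apply: eq_bigr. Qed.

Lemma sobolev_fin_or a : (exists2 j, j \in J1 & sobolev U beta a j = +oo%E) \/
  exists2 s : 'I_p -> R, (forall j, j \in J1 -> sobolev U beta a j = (s j)%:E) &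
    (forall j, 0 <= s j).
Proof.
have [[j jJ E]|h] := pselect (exists2 j, j \in J1 & sobolev U beta a j = +oo%E).
  by left; exists j.
right; exists (fun j => fine (sobolev U beta a j)).
  move=> j jJ; rewrite fineK// ge0_fin_numE ?sobolev_ge0//.
  by rewrite ltey; apply/eqP => E; apply: h; exists j.
by move=> j; rewrite fine_ge0 ?sobolev_ge0.
Qed.

End Sobolev.

(** * Hoelder's inequality across the components *)

Section ConjugateCases.
Variable R : realType.

(** [q2 = 0] is excluded because e / 0 = +oo, and two infinite exponents because the sum would be 0;
    one infinite exponent determines the other. *)
Lemma conjugate_cases (e r : R) (q1 q2 : \bar R) : 0 < e -> 0 < r ->
  (r%:E <= q1)%E -> (0 <= q2)%E -> (e%:E / q2 + r%:E / q1 = 1)%E ->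
  [\/ exists x y, [/\ 0 < x, 0 < y, q2 = x%:E, q1 = y%:E & e / x + r / y = 1],
      q2 = e%:E /\ q1 = +oo%E | q2 = +oo%E /\ q1 = r%:E].
Proof.
move=> e0 r0; case: q1 => [y| |]//; case: q2 => [x| |]//;
  rewrite ?lee_fin ?invey ?mule0 ?adde0 ?add0e.
- move=> ry x0; have y0 : 0 < y by exact: lt_le_trans ry.
  rewrite !inver (gt_eqF y0); case: eqVneq => [_|xN0].
    by rewrite gt0_muley ?lte_fin// -EFinM addye.
  rewrite -!EFinM -EFinD => -[h]; apply: Or31; exists x, y; split => //.
  by rewrite lt_def xN0.
- move=> ry _; have y0 : 0 < y by exact: lt_le_trans ry.
  rewrite inver (gt_eqF y0) -EFinM => -[h]; apply: Or33; split=> //.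
  by congr EFin; move/divr1_eq: h.
- move=> _ x0; rewrite inver; case: eqVneq => [_|xN0].
    by rewrite gt0_muley ?lte_fin.
  rewrite -EFinM => -[h]; apply: Or32; split=> //.
  by congr EFin; move/divr1_eq: h.
- by move=> _ _ /esym /eqP; rewrite onee_eq0.
Qed.

Lemma conjugate0 (e : R) (q1 q2 : \bar R) : 0 < e ->
  (0 <= q2)%E -> (e%:E / q2 + 0%:E / q1 = 1)%E -> q2 = e%:E.
Proof.
move=> e0; rewrite mul0e adde0; case: q2 => [x| |]//; rewrite ?lee_fin ?invey ?mule0.
- move=> x0; rewrite inver; case: eqVneq => [_|xN0].
    by rewrite gt0_muley ?lte_fin.
  by rewrite -EFinM => -[h]; congr EFin; move/divr1_eq: h.
- by move=> _ /esym /eqP; rewrite onee_eq0.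
Qed.

Lemma Jrate_gt0 q alpha (alpha0 : R) kl ku : 2^-1 < alpha -> (kl < ku)%N ->
  0 < Jrate q alpha alpha0 kl ku.
Proof.
move=> ha klu; have r0 := rho_ge0 q alpha0 ha; have r1 := rho_lt1 q alpha0 ha.
rewrite /Jrate; set r := rho _ _ _ in r0 r1 *.
apply: mulr_gt0; last by apply: powR_gt0; exact: Jc_gt0.
apply: mulr_gt0; last by apply: powR_gt0; exact: Jc_gt0.
rewrite /Jprefactor; case: eqVneq => // rN0.
have rp : 0 < r by rewrite lt_def rN0.
have u0 : 0 < r^-1 - 1 by rewrite subr_gt0 invf_gt1.
by rewrite addr_gt0 ?powR_gt0.
Qed.

Lemma gap_q0 (alpha0 : R) : gap 0 alpha0 = 1.
Proof. by rewrite /gap !mul0r !subr0 max_r. Qed.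

Lemma rho_eq0_q (q alpha alpha0 : R) : 2^-1 < alpha -> rho q alpha alpha0 = 0 ->
  gap q alpha0 = 0.
Proof.
move=> ha /eqP; rewrite /rho mulf_eq0 invr_eq0 => /orP[/eqP //|/eqP h].
have := gap_ge0 q alpha0; lra.
Qed.

End ConjugateCases.

Section RateSum.
Variables (R : realType) (n p : nat) (J1 : {set 'I_p}) (dpar : 'I_p -> nat).
Variables (kl ku : nat) (U : design R n J1 dpar kl) (beta : coefs R J1 dpar kl).
Variables (sigma q alpha alpha0 : R) (q1 q2 : \bar R).
Hypotheses (q01 : 0 <= q <= 1) (a0a : 0 <= alpha0 <= alpha) (ha : 2^-1 < alpha).
Hypotheses (s0 : 0 < sigma) (klu : (kl <= ku)%N).
Notation r := (rho q alpha alpha0).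
Notation g := (gamma q alpha alpha0).
Notation S j := (\sum_(kl.+1 <= k < ku.+1) level_min sigma (level_norm U beta j) k).
Notation G := (sigma `^ g * Jrate q alpha alpha0 kl ku).
Hypotheses (rq1 : (r%:E <= q1)%E) (q20 : (0 <= q2)%E) (conj : conjugate q r q1 q2).

Lemma rate_coef_ge0 : 0 <= G.
Proof. by rewrite mulr_ge0 ?powR_ge0 ?Jrate_ge0. Qed.

Lemma level_sum0 a j : sobolev U beta a j = 0%E -> S j = 0.
Proof.
move=> /sobolev_eq0P h; rewrite big_nat_cond big1// => k /andP[/andP[k1 _] _].
by rewrite /level_min h// mulr0 min_r ?sqr_ge0.
Qed.

Lemma level_sum_sobolev j (s u : R) : sobolev U beta alpha0 j = s%:E -> s != 0 ->
  (r = 0 \/ sobolev U beta alpha j = u%:E) ->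
  S j <= G * (s `^ (q * (1 - r)) * (if r == 0 then 1 else u `^ r)).
Proof.
move=> sE sN0 uE.
have sp : 0 < s by rewrite lt_def sN0 -lee_fin -sE sobolev_ge0.
have [r_0|rN0] := eqVneq r 0.
  have := @level_sum_le _ q alpha alpha0 sigma (level_norm U beta j) s 1 kl ku.
  rewrite powR1; apply => //.
  - by move=> k; exact: level_norm_ge0.
  - exact: sobolev_partial.
  - by rewrite (rho_eq0_q ha r_0) ltxx.
have {}uE : sobolev U beta alpha j = u%:E by case: uE => // h; rewrite h eqxx in rN0.
apply: level_sum_le => //.
- by move=> k; exact: level_norm_ge0.
- rewrite lt_def -[u == 0]/(u%:E == 0%E) -uE (sobolev_eq0_indep _ _ _ alpha0).
  by rewrite sE eqe sN0/= -lee_fin -uE sobolev_ge0.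
- exact: sobolev_partial.
- by move=> _; exact: sobolev_partial.
Qed.

Lemma Mfactor_ge0 : (0 <= Mfactor U beta alpha0 q r q1 q2)%E.
Proof.
rewrite /Mfactor; case: ifP => _; first by rewrite lee_fin powR_ge0.
exact: poweR_ge0.
Qed.

(** Treated apart because the power 0 of the alpha-measure is 1 even when that measure is infinite;
    conjugacy then forces [q2 = q], since [q = 0] would make rho positive. *)
Lemma rate_sum_rho0 : r = 0 ->
  ((\sum_(j in J1) S j)%:E <=
   G%:E * Mfactor U beta alpha0 q r q1 q2 * (M U beta alpha q1 `^ r))%E.
Proof.
move=> r_0; have [kE|kN] := eqVneq kl ku.
  rewrite big1 => [|j _]; last by rewrite big_geq// ltnS -kE.
  by rewrite !mule_ge0 ?Mfactor_ge0 ?poweR_ge0// lee_fin rate_coef_ge0.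
have qN0 : q != 0.
  apply/eqP => q_0; have := rho_eq0_q ha r_0; rewrite q_0 gap_q0 => /eqP.
  by rewrite oner_eq0.
have qp : 0 < q by rewrite lt_def qN0; case/andP: q01.
have q2E : q2 = q%:E.
  case: conj => [[/eqP]|]; first by rewrite (negbTE qN0).
  by rewrite r_0 subr0 mulr1 => /conjugate0; apply.
rewrite /Mfactor (negbTE qN0) q2E.
have Gp : 0 < G by rewrite mulr_gt0 ?powR_gt0// Jrate_gt0// ltn_neqAle kN.
have [[j jJ sE]|[s sE s_ge0]] := sobolev_fin_or U beta alpha0.
  have : (sobolev U beta alpha0 j <= M U beta alpha0 q%:E)%E.
    by apply: sobolev_le_M; rewrite ?lte_fin.
  rewrite sE leye_eq => /eqP ->.
  by rewrite r_0 subr0 mulr1 poweRyr// poweRe0 mule1 gt0_muley ?lte_fin// leey.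
rewrite (M_fin qp sE) poweR_EFin [X in (_ * (_ `^ X)%E)%E]r_0 poweRe0 mule1.
rewrite -powRrM r_0 subr0 mulr1 mulVf// powRr1; last first.
  by apply: sumr_ge0 => j _; exact: powR_ge0.
rewrite -EFinM lee_fin mulr_sumr; apply: ler_sum => j jJ.
have [s_0|sN0] := eqVneq (s j) 0.
  by rewrite (level_sum0 (a := alpha0)) ?sE ?s_0// mulr_ge0 ?powR_ge0 ?ltW.
have := @level_sum_sobolev j (s j) 0 (sE j jJ) sN0 (or_introl r_0).
by rewrite r_0 eqxx subr0 !mulr1.
Qed.

Lemma level_sum_sobolev_fin (s u : 'I_p -> R) j : 0 < r ->
  (forall j, j \in J1 -> sobolev U beta alpha0 j = (s j)%:E) ->
  (forall j, j \in J1 -> sobolev U beta alpha j = (u j)%:E) -> j \in J1 ->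
  S j <= G * ((if s j == 0 then 0 else s j `^ (q * (1 - r))) * u j `^ r).
Proof.
move=> rp sE uE jJ; case: eqVneq => [s_0|sN0].
  by rewrite (level_sum0 (a := alpha0)) ?sE ?s_0// mul0r mulr0.
have := level_sum_sobolev (sE j jJ) sN0 (or_intror (uE j jJ)).
by rewrite gt_eqF.
Qed.

Lemma rate_sum_fin (s u : 'I_p -> R) : 0 < r ->
  (forall j, j \in J1 -> sobolev U beta alpha0 j = (s j)%:E) ->
  (forall j, j \in J1 -> sobolev U beta alpha j = (u j)%:E) ->
  (forall j, 0 <= s j) -> (forall j, 0 <= u j) ->
  ((\sum_(j in J1) (if s j == 0 then 0 else s j `^ (q * (1 - r))) * u j `^ r)%:E <=
   Mfactor U beta alpha0 q r q1 q2 * (M U beta alpha q1 `^ r))%E.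
Proof.
move=> rp sE uE s_ge0 u_ge0; have r1 := rho_lt1 q alpha0 ha.
have rN0 : r != 0 by rewrite gt_eqF.
have u_max j : j \in J1 -> u j <= \big[Num.max/0]_(j in J1) u j.
  by move=> jJ; apply: le_bigmax_cond.
have s_max j : j \in J1 -> s j <= \big[Num.max/0]_(j in J1) s j.
  by move=> jJ; apply: le_bigmax_cond.
have pow_le (x y e : R) : 0 <= x -> x <= y -> 0 <= e -> x `^ e <= y `^ e.
  move=> x0 xy e0; apply: ge0_ler_powR; rewrite ?nnegrE//.
  exact: le_trans xy.
have sum_ge0 (v : 'I_p -> R) e : 0 <= \sum_(j in J1) v j `^ e.
  by apply: sumr_ge0 => j _; exact: powR_ge0.
(* For [q = 0] and finite [q1], Hoelder's inequality is applied against the constant 1 on the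
   nonzero components, with weight r / q1 <= 1; the count receives the exponent 1 - r / q1. *)
have [q_0|qN0] := eqVneq q 0.
  have sumE : \sum_(j in J1) (if s j == 0 then 0 else s j `^ (q * (1 - r))) * u j `^ r =
      \sum_(j in J1 | s j != 0) u j `^ r.
    rewrite [RHS]big_mkcondr; apply: eq_bigr => j _.
    by rewrite q_0 mul0r powRr0; case: eqP; rewrite ?mul0r ?mul1r.
  rewrite sumE /Mfactor ifT; last exact/eqP.
  have -> : #|[pred j in J1 | sobolev U beta alpha0 j != 0%E]| =
      #|[pred j in J1 | s j != 0]|.
    apply: eq_card => j; rewrite !inE; case: (boolP (j \in J1)) => //= jJ.
    by rewrite sE.
  set N := #|_|.
  have sum1 : \sum_(j in J1 | s j != 0) (1 : R) = N%:R.
    by rewrite sumr_const /N; congr (_ *+ _); apply: eq_card => j; rewrite !inE.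
  case: q1 rq1 => [y| |]// ry; last first.
    rewrite invey mule0 subr0 (M_fin_oo uE) poweR_EFin -EFinM lee_fin.
    rewrite powRr1// -sum1 mulr_suml; apply: ler_sum => j /andP[jJ _].
    by rewrite mul1r; apply: pow_le => //; [exact: u_max|exact: ltW].
  rewrite lee_fin in ry; have y0 : 0 < y by exact: lt_le_trans ry.
  rewrite (M_fin y0 uE) poweR_EFin inver gt_eqF// -!EFinM lee_fin /=.
  rewrite -powRrM (mulrC y^-1) -sum1 [leRHS]mulrC.
  apply: (@le_trans _ _ ((\sum_(j in J1 | s j != 0) u j `^ y) `^ (r / y) *
      (\sum_(j in J1 | s j != 0) 1) `^ (1 - r / y))).
    have th01 : 0 <= r / y <= 1.
      by rewrite divr_ge0 ?(ltW rp) ?(ltW y0)//= ler_pdivrMr// mul1r.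
    apply: le_trans (hoelder_sum _ th01 _ _) => [|j _|j _ //]; last exact: powR_ge0.
    apply: ler_sum => j _; rewrite powR1 mulr1 -powRrM mulrC divfK ?gt_eqF//.
  rewrite ler_wpM2r ?powR_ge0//; apply: pow_le.
  - by apply: sumr_ge0 => j _; exact: powR_ge0.
  - rewrite big_mkcondr; apply: ler_sum => j _; case: ifP => // _.
    exact: powR_ge0.
  - by rewrite divr_ge0// ltW.
have qp : 0 < q by rewrite lt_def qN0; case/andP: q01.
have e0 : 0 < q * (1 - r) by rewrite mulr_gt0// subr_gt0.
set e := q * (1 - r) in e0 *.
rewrite /Mfactor (negbTE qN0) -/e.
apply: (@le_trans _ _ (\sum_(j in J1) s j `^ e * u j `^ r)%:E).
  rewrite lee_fin; apply: ler_sum => j _; case: eqVneq => // ->.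
  by rewrite powR0 ?gt_eqF// mul0r.
have cj : (e%:E / q2 + r%:E / q1 = 1)%E.
  by case: conj => [[/eqP]|//]; rewrite (negbTE qN0).
case: (conjugate_cases e0 rp rq1 q20 cj) => [[x [y [x0 y0 -> -> xy]]]|[-> ->]|[-> ->]].
- rewrite (M_fin x0 sE) (M_fin y0 uE) !poweR_EFin -EFinM lee_fin -!powRrM.
  have th01 : 0 <= r / y <= 1.
    have ex0 : 0 < e / x by rewrite divr_gt0.
    by rewrite divr_ge0 ?(ltW rp) ?(ltW y0)//= -xy lerDr ltW.
  have xE : e / x = 1 - r / y by rewrite -xy addrK.
  rewrite (mulrC x^-1) (mulrC y^-1) xE [leRHS]mulrC.
  apply: le_trans (hoelder_sum _ th01 _ _) => [|j _|j _]; rewrite ?powR_ge0//.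
  apply: ler_sum => j _; rewrite -xE -!powRrM !(mulrC _ (_ / _)) !divfK ?gt_eqF//.
  by rewrite mulrC.
- rewrite (M_fin e0 sE) (M_fin_oo uE) !poweR_EFin -EFinM lee_fin -powRrM.
  rewrite mulVf ?gt_eqF// powRr1// mulr_suml; apply: ler_sum => j jJ.
  by rewrite ler_wpM2l ?powR_ge0//; apply: pow_le; [|exact: u_max|exact: ltW].
- rewrite (M_fin_oo sE) (M_fin rp uE) !poweR_EFin -EFinM lee_fin -powRrM.
  rewrite mulVf ?gt_eqF// powRr1// mulr_sumr; apply: ler_sum => j jJ.
  by rewrite ler_wpM2r ?powR_ge0//; apply: pow_le; [|exact: s_max|exact: ltW].
Qed.

Lemma rate_sum :
  ((\sum_(j in J1) S j)%:E <=
   G%:E * Mfactor U beta alpha0 q r q1 q2 * (M U beta alpha q1 `^ r))%E.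
Proof.
have [r_0|rN0] := eqVneq r 0; first exact: rate_sum_rho0.
have rp : 0 < r by rewrite lt_def rN0 rho_ge0.
have [kE|kN] := eqVneq kl ku.
  rewrite big1 => [|j _]; last by rewrite big_geq// ltnS -kE.
  by rewrite !mule_ge0 ?Mfactor_ge0 ?poweR_ge0// lee_fin rate_coef_ge0.
have Gp : 0 < G by rewrite mulr_gt0 ?powR_gt0// Jrate_gt0// ltn_neqAle kN.
have q1p : (0 < q1)%E by apply: lt_le_trans rq1; rewrite lte_fin.
have r1 := rho_lt1 q alpha0 ha.
have [[j jJ uE]|[u uE u_ge0]] := sobolev_fin_or U beta alpha.
  have := sobolev_le_M U beta alpha jJ q1p.
  rewrite uE leye_eq => /eqP ->; rewrite poweRyr//.
  (* The alpha-measure is infinite, so the right side is +oo once the other factor is positive; the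
     component of infinite alpha-norm has a nonzero alpha0-norm. *)
  suff F0 : (0 < Mfactor U beta alpha0 q r q1 q2)%E.
    by rewrite gt0_muley ?leey// mule_gt0// lte_fin.
  have aj : sobolev U beta alpha0 j != 0%E.
    by rewrite (sobolev_eq0_indep _ _ _ alpha) uE.
  rewrite /Mfactor; case: eqVneq => [_|qN0].
    rewrite lte_fin powR_gt0// ltr0n; apply/card_gt0P; exists j.
    by rewrite !inE jJ.
  have qp : 0 < q by rewrite lt_def qN0; case/andP: q01.
  have e0 : 0 < q * (1 - r) by rewrite mulr_gt0// subr_gt0.
  have cj : ((q * (1 - r))%:E / q2 + r%:E / q1 = 1)%E.
    by case: conj => [[/eqP]|//]; rewrite (negbTE qN0).
  have q2p : (0 < q2)%E.
    by case: (conjugate_cases e0 rp rq1 q20 cj) => [[x [y [x0 y0 -> _ _]]]|[-> _]|[-> _]] //;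
      rewrite lte_fin.
  apply: poweR_gt0; apply: lt_le_trans (sobolev_le_M U beta alpha0 jJ q2p).
  by rewrite lt_def aj sobolev_ge0.
have [[j jJ sE]|[s sE s_ge0]] := sobolev_fin_or U beta alpha0.
  have /andP[_ aa] := a0a.
  by have := sobolev_le U beta j aa; rewrite sE uE.
rewrite -muleA.
apply: le_trans (_ : G%:E * (\sum_(j in J1) (if s j == 0 then 0
    else s j `^ (q * (1 - r))) * u j `^ r)%:E <= _)%E; last first.
  by rewrite lee_wpmul2l ?lee_fin ?(ltW Gp)//; exact: (rate_sum_fin rp sE uE s_ge0 u_ge0).
rewrite -EFinM lee_fin mulr_sumr; apply: ler_sum => j jJ.
exact: level_sum_sobolev_fin.
Qed.

End RateSum.

Section MinSum.
Variables (p : nat) (J1 : {set 'I_p}) (kl ku : nat).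
Hypothesis klu : (kl <= ku)%N.

Lemma Kstar_sum (V : nmodType) (F : 'I_p -> nat -> V) :
  \sum_(jk in Kstar J1 kl ku) F jk.1 jk.2 =
  \sum_(j < p) F j kl + \sum_(j in J1) \sum_(kl.+1 <= k < ku.+1) F j k.
Proof.
rewrite (eq_bigl (fun jk : 'I_p * 'I_ku.+1 => true && inK J1 kl jk.1 jk.2)); last by move=> jk; rewrite inE.
rewrite -(pair_big_dep xpredT (fun j k => inK J1 kl j (k : 'I_ku.+1)) F)/=.
rewrite [X in _ + X]big_mkcond -big_split; apply: eq_bigr => j _ /=.
rewrite -(big_mkord (fun k => inK J1 kl j k) (F j)) (big_cat_nat (n := kl))//=; last exact: leqW.
rewrite big_nat_cond big1 ?add0r => [|k /andP[/andP[_ h1] /andP[h2 _]]]; last first.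
  by move: h1; rewrite ltnNge h2.
rewrite big_ltn_cond ?ltnS// /inK leqnn eqxx orbT /=; congr (_ + _).
case: ifP => jJ; rewrite big_nat_cond.
  rewrite [in RHS]big_nat_cond; apply: eq_bigl => k.
  by case: (ltnP kl k) => //= h; rewrite (ltnW h) andbT.
by rewrite big1// => k /andP[/andP[h _] /andP[_]] /=; rewrite (gtn_eqF h).
Qed.

End MinSum.

Section MinSumBound.
Variables (R : realType) (n p : nat) (J1 : {set 'I_p}) (dpar : 'I_p -> nat).
Variables (kl ku : nat) (U : design R n J1 dpar kl) (beta : coefs R J1 dpar kl).
Variables (sigma eps : R).
Hypotheses (n0 : (0 < n)%N) (s0 : 0 < sigma) (klu : (kl <= ku)%N).
Hypotheses (L1 : 1 <= Lpe p eps) (Lu : Lpe p eps <= 2 `^ kl%:R).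
Notation lam := (lambda sigma p eps).
Notation lam0 := (lambda0 sigma p eps).

Lemma lambda0_gt0 : 0 < lam0.
Proof. by rewrite mulr_gt0// sqrtr_gt0 (lt_le_trans _ L1). Qed.

Lemma lambda_gt0 k : 0 < lam k.
Proof. by rewrite mulr_gt0// ltr_wpDr ?powR_gt0// sqrtr_ge0. Qed.

(** At fine levels 2 log (p / eps) <= 2^kl <= 2^k, so the first part of [lambda] dominates the
    second. The square of this 2 is the factor 4 in front of the rate. *)
Lemma lambda_late_le k : (kl < k)%N -> lam k <= 2 * (sigma * 2 `^ (k%:R / 2)).
Proof.
move=> klk; rewrite /lambda mulrCA ler_wpM2l ?(ltW s0)//.
suff : Num.sqrt (Lpe p eps) <= 2 `^ (k%:R / 2) by lra.
rewrite powR2_half ler_wsqrtr//; apply: le_trans Lu _.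
by rewrite powR_mulrn// ler_weXn2l ?ler1n// ltnW.
Qed.

Lemma min_sum_le q : 0 <= q <= 1 ->
  min_sum ku U lam beta <= lam0 `^ (2 - q) * MBR U lam lam0 beta q +
  4 * \sum_(j in J1) \sum_(kl.+1 <= k < ku.+1) level_min sigma (level_norm U beta j) k.
Proof.
move=> q01; rewrite /min_sum.
rewrite (Kstar_sum J1 klu (fun j k =>
  Num.min (lam k ^+ 2) (lam k * norm2n (block U beta j k)))); apply: lerD.
  rewrite /MBR mulr_sumr; apply: ler_sum => j _.
  rewrite mulrA [lam0 `^ _ * _](_ : _ = lam kl `^ (2 - q)); last first.
    rewrite -powRM ?(ltW lambda0_gt0) ?divr_ge0 ?(ltW (lambda_gt0 _)) ?(ltW lambda0_gt0)//.
    by rewrite mulrCA divff ?mulr1// gt_eqF ?lambda0_gt0.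
  case: ifPn => [/eqP ->|bN0].
    by rewrite norm2n0 !mulr0 min_r ?sqr_ge0.
  have t0 : 0 <= norm2n (block U beta j kl) by exact: norm2n_ge0.
  exact: min_powR_le (lambda_gt0 _) t0.
rewrite mulr_sumr; apply: ler_sum => j _; rewrite mulr_sumr.
rewrite big_nat_cond [leRHS]big_nat_cond; apply: ler_sum => k /andP[/andP[klk _] _].
have := lambda_late_le klk; have := lambda_gt0 k; have := norm2n_ge0 (block U beta j k).
rewrite /level_min -/(level_norm U beta j k).
move: (lam k) (level_norm _ _ _ _) (sigma * _) => l t s t_ge0 l0 ls.
rewrite minr_pMr// le_min !ge_min; apply/andP; split; apply/orP; [left|right]; nra.
Qed.

End MinSumBound.

Lemma powR_gt1 (R : realType) (x a : R) : 1 < x -> 0 < a -> 1 < x `^ a.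
Proof.
move=> x1 a0; have := gt0_ltr_powR a0 _ _ x1; rewrite powR1; apply.
- by rewrite nnegrE.
- by rewrite nnegrE ltW// (lt_trans _ x1).
Qed.

(** * Bias *)

Section NormLimit.
Variables (R : realType) (n : nat).

Lemma norm2n_lim_le (u : nat -> 'cV[R]_n) (c : R) : 0 <= c -> (0 < n)%N ->
  cvg (u @ \oo) -> (forall N, norm2n (u N) ^+ 2 <= c) ->
  norm2n (lim (u @ \oo)) ^+ 2 <= c.
Proof.
move=> c0 n0 cu hu; set l := lim _.
have n0' : 0 < n%:R :> R by rewrite ltr0n.
have hc : (fun N => \sum_(i < n) u N i 0 ^+ 2) @ \oo --> \sum_(i < n) l i 0 ^+ 2.
  rewrite [X in X @ _](_ : _ = \sum_(i < n) (fun N => u N i 0 ^+ 2)); last first.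
    by apply/funext => N; rewrite fct_sumE.
  elim/big_ind2: _ => [|f a g b hf hg|i _]; [exact: cvg_cst|exact: cvgD|].
  have hi : (fun N => u N i 0) @ \oo --> l i 0.
    exact: continuous_cvg (@coord_continuous _ _ _ i 0 l) cu.
  exact: (cvgM hi hi).
have dE (v : 'cV[R]_n) : dot v v = \sum_(i < n) v i 0 ^+ 2.
  by rewrite /dot; apply: eq_bigr => i _; rewrite expr2.
rewrite norm2n_sqr dE ler_pdivrMr// -(cvg_lim (@Rhausdorff R) hc).
apply: limr_le; first by apply/cvg_ex; exists (\sum_(i < n) l i 0 ^+ 2).
by near=> N; have := hu N; rewrite norm2n_sqr dE ler_pdivrMr.
Unshelve. all: by end_near.
Qed.

Lemma geometric_tail_le (x : R) k m : 0 < x < 1 ->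
  \sum_(k.+1 <= i < m) x ^+ i <= x ^+ k / (x^-1 - 1).
Proof.
move=> /andP[x0 x1].
have d0 : 0 < x^-1 - 1 by rewrite subr_gt0 invf_gt1.
rewrite ler_pdivlMr//; have [km|mk] := leqP k.+1 m; last first.
  by rewrite big_geq 1?ltnW// mul0r exprn_ge0// ltW.
suff -> : (\sum_(k.+1 <= i < m) x ^+ i) * (x^-1 - 1) = x ^+ k - x ^+ m.-1.
  by rewrite gerBl exprn_ge0// ltW.
rewrite mulr_suml; case: m km => // m; rewrite ltnS => km /=.
elim: m km => [|m IH]; first by rewrite leqn0 => /eqP ->; rewrite big_geq// subrr.
rewrite leq_eqVlt => /orP[/eqP ->|km]; first by rewrite big_geq// subrr.
rewrite big_nat_recr//= IH// mulrBr mulr1 [x ^+ m.+1 / x](_ : _ = x ^+ m) ?addrA ?subrK//.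
by rewrite exprSr mulfK// gt_eqF.
Qed.

End NormLimit.

Section Bias.
Variables (R : realType) (n p : nat) (J1 : {set 'I_p}) (dpar : 'I_p -> nat).
Variables (kl ku : nat) (U : design R n J1 dpar kl) (beta : coefs R J1 dpar kl).
Hypotheses (n0 : (0 < n)%N) (klu : (kl <= ku)%N) (bc : fcomp_cvg U beta).

Lemma tail_cvg j : j \in J1 ->
  cvg ((fun N : nat => \sum_(ku.+1 <= k < N) block U beta j k) @ \oo).
Proof.
move=> jJ; have := bc jJ.
by rewrite (is_cvg_series_restrict kl) -(is_cvg_series_restrict ku.+1).
Qed.

Lemma fcomp_split j : j \in J1 ->
  fcomp U beta j = \sum_(kl <= k < ku.+1) block U beta j k + fcomp_tail ku U beta j.
Proof.
move=> jJ; rewrite /fcomp jJ; set c := \sum_(_ <= _ < _) _.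
apply: cvg_lim; first exact: norm_hausdorff.
have h : (fun N => c + \sum_(ku.+1 <= k < N) block U beta j k) @ \oo -->
  c + fcomp_tail ku U beta j by apply: cvgD; [exact: cvg_cst|exact: tail_cvg].
apply: cvg_trans h; apply: near_eq_cvg; near=> N.
rewrite /c -(big_cat_nat (n := ku.+1))//; first exact: leqW.
by near: N; exact: nbhs_infty_ge.
Unshelve. all: by end_near.
Qed.

(** Parametric components and all levels up to [ku] cancel exactly. *)
Lemma bias_tails : ftrue U beta - fit ku U beta =
  \sum_(j in J1) fcomp_tail ku U beta j.
Proof.
rewrite /fit (Kstar_sum J1 klu (block U beta)) opprD addrA -sumrB [RHS]big_mkcond.
rewrite [X in _ - X]big_mkcond -sumrB; apply: eq_bigr => j _.
case: ifPn => jJ; last by rewrite /fcomp (negbTE jJ) subrr subr0.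
rewrite fcomp_split// big_ltn ?ltnS//.
by rewrite -[LHS]addrA -opprD [X in X - _]addrC addrK.
Qed.

(** Cauchy-Schwarz with weights 2^(-a k) and 2^(a k) on partial sums, then the limit. The squared
    weights sum to at most 4^(-a ku) / (4^a - 1), the source of that denominator. *)
Lemma fcomp_tail_le (a r : R) j : 0 < a -> j \in J1 -> sobolev U beta a j = r%:E ->
  norm2n (fcomp_tail ku U beta j) ^+ 2 <=
  2 `^ (- (2 * a) * ku%:R) / (4 `^ a - 1) * r ^+ 2.
Proof.
move=> a0 jJ sE.
have q1 : 1 < 4 `^ a by apply: powR_gt1 => //; rewrite ltr1n.
apply: norm2n_lim_le => //; last 1 first.
- move=> N.
  have h1 : norm2n (\sum_(ku.+1 <= k < N) block U beta j k) ^+ 2 <=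
      (\sum_(ku.+1 <= k < N) 2 `^ (- a * k%:R) *
        (2 `^ (a * k%:R) * level_norm U beta j k)) ^+ 2.
    rewrite ler_sqr ?nnegrE ?norm2n_ge0//; last first.
      by apply: sumr_ge0 => k _; rewrite !mulr_ge0 ?powR_ge0 ?norm2n_ge0.
    apply: le_trans (norm2n_sum _ _ _) _; apply: ler_sum => k _.
    by rewrite mulrA -pow2D mulNr addNr powRr0 mul1r.
  apply: le_trans h1 _; apply: le_trans (cauchy_schwarz_seq _ _ _) _.
  apply: ler_pM.
  + by apply: sumr_ge0 => k _; rewrite sqr_ge0.
  + by apply: sumr_ge0 => k _; rewrite sqr_ge0.
  + have x01 : 0 < (4 `^ a)^-1 < (1 : R).
      by rewrite invr_gt0 (lt_trans _ q1)//= invf_lt1// (lt_trans _ q1).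
    have e k : 2 `^ (- a * k%:R) ^+ 2 = (4 `^ a)^-1 ^+ k :> R.
      have -> : (4 : R) = 2 `^ 2%:R by rewrite powR_mulrn// -natrX.
      rewrite -powRrM -powRN -(@powR_mulrn R _ k (powR_ge0 _ _)).
      by rewrite -(@powR_mulrn R _ 2 (powR_ge0 _ _)) -2!powRrM; congr powR; ring.
    rewrite (eq_bigr (fun k => (4 `^ a)^-1 ^+ k)) => [|k _]; last exact: e.
    apply: le_trans (geometric_tail_le _ _ x01) _; rewrite invrK -e.
    rewrite -(powR_mulrn 2) ?powR_ge0// -powRrM.
    by rewrite [X in _ `^ X / _](_ : _ = - (2 * a) * ku%:R)//; ring.
  + have [kN|Nk] := leqP ku.+1 N; last by rewrite big_geq 1?ltnW// sqr_ge0.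
    apply: le_trans (sobolev_partial N sE).
    rewrite [leRHS](big_cat_nat (n := ku.+1))//=.
    rewrite ler_wpDl//.
      by apply: sumr_ge0 => k _; rewrite mulr_ge0 ?powR_ge0 ?sqr_ge0.
    apply: ler_sum => k _; rewrite exprMn ler_wpM2r ?sqr_ge0//.
    rewrite -powR_mulrn ?powR_ge0// -powRrM.
    by rewrite [X in _ `^ X](_ : _ = 2 * a * k%:R)//; ring.
- rewrite mulr_ge0 ?sqr_ge0// divr_ge0 ?powR_ge0// subr_ge0 ltW//.
- exact: tail_cvg.
Qed.

Variables (a nrate : R).
Hypotheses (a0 : 0 < a) (nr : 2 `^ (- (2 * a) * ku%:R) <= nrate).

Let D : R := 4 `^ a - 1.
Let D0 : 0 < D.
Proof. by rewrite subr_gt0 powR_gt1// ltr1n. Qed.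
Let nr0 : 0 < nrate.
Proof. exact: lt_le_trans (powR_gt0 _ _) nr. Qed.

(** No orthogonality between components is available, so the tails are added by the triangle
    inequality and the square falls on their sum: the measure of index 1. *)
Lemma bias_sqr_le (s : 'I_p -> R) :
  (forall j, j \in J1 -> sobolev U beta a j = (s j)%:E) -> (forall j, 0 <= s j) ->
  norm2n (ftrue U beta - fit ku U beta) ^+ 2 <= nrate / D * (\sum_(j in J1) s j) ^+ 2.
Proof.
move=> sE s_ge0; rewrite bias_tails.
have c0 : 0 <= nrate / D by rewrite divr_ge0// ltW.
rewrite -[nrate / D](sqr_sqrtr c0) -exprMn ler_sqr ?nnegrE ?norm2n_ge0//; last first.
  by rewrite mulr_ge0 ?sqrtr_ge0// sumr_ge0.
apply: le_trans (norm2n_sum _ _ _) _; rewrite mulr_sumr; apply: ler_sum => j jJ.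
rewrite -ler_sqr ?nnegrE ?norm2n_ge0 ?mulr_ge0 ?sqrtr_ge0//.
rewrite [leRHS]exprMn (sqr_sqrtr c0); apply: le_trans (fcomp_tail_le a0 jJ (sE j jJ)) _.
by rewrite ler_wpM2r ?sqr_ge0// ler_wpM2r// invr_ge0 ltW.
Qed.

Lemma bias_le_M1 :
  ((2 * norm2n (ftrue U beta - fit ku U beta) ^+ 2)%:E <=
   (2 * nrate / D)%:E * M U beta a 1 ^+ 2)%E.
Proof.
have c0 : 0 < 2 * nrate / D by rewrite divr_gt0 ?mulr_gt0.
have [[j jJ sE]|[s sE s_ge0]] := sobolev_fin_or U beta a.
  have := sobolev_le_M U beta a jJ (@lte01 R); rewrite sE leye_eq => /eqP ->.
  by rewrite expe2 mulyy gt0_muley ?lte_fin// leey.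
rewrite (M_fin ltr01 sE) invr1 powRr1; last by apply: sumr_ge0 => j _; rewrite powR_ge0.
rewrite -EFin_expe -EFinM lee_fin; have := bias_sqr_le sE s_ge0.
rewrite (eq_bigr (fun j => s j `^ 1)) => [h|j _]; last by rewrite powRr1.
by rewrite -mulrA -mulrA ler_pM2l// mulrA.
Qed.

(** The constant [|cA| + 1] is positive whatever [cA] is, so an infinite measure stays infinite on
    the right. *)
Lemma bias_le_M2 (cA : R) : condA ku U cA beta ->
  ((2 * norm2n (ftrue U beta - fit ku U beta) ^+ 2)%:E <=
   (2 * nrate / D)%:E * ((`|cA| + 1)%:E * M U beta a 2%:E ^+ 2))%E.
Proof.
move=> hA; have c0 : 0 < 2 * nrate / D by rewrite divr_gt0 ?mulr_gt0.
have C0 : 0 < `|cA| + 1 by rewrite ltr_wpDl.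
have [[j jJ sE]|[s sE s_ge0]] := sobolev_fin_or U beta a.
  have := sobolev_le_M (q := 2%:E) U beta a jJ; rewrite lte_fin ltr0n => /(_ isT).
  rewrite sE leye_eq => /eqP ->.
  by rewrite expe2 mulyy !gt0_muley ?lte_fin// leey.
rewrite (M_fin _ sE)// -EFin_expe -!EFinM lee_fin.
rewrite -(@powR_mulrn R _ 2 (powR_ge0 _ _)) -powRrM mulVf ?pnatr_eq0// powRr1; last first.
  by apply: sumr_ge0 => j _; rewrite powR_ge0.
rewrite -mulrA -mulrA ler_pM2l//; apply: le_trans hA _.
apply: (@le_trans _ _ ((`|cA| + 1) * \sum_(j in J1) norm2n (fcomp_tail ku U beta j) ^+ 2)).
  apply: ler_wpM2r; first by apply: sumr_ge0 => j _; rewrite sqr_ge0.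
  by rewrite (le_trans (ler_norm cA))// lerDl.
rewrite [leRHS](_ : _ = (`|cA| + 1) * (nrate / D * \sum_(j in J1) s j `^ 2)); last by ring.
rewrite ler_pM2l// mulr_sumr; apply: ler_sum => j jJ.
rewrite powR_mulrn//; apply: le_trans (fcomp_tail_le a0 jJ (sE j jJ)) _.
by rewrite ler_wpM2r ?sqr_ge0// ler_wpM2r// invr_ge0 ltW.
Qed.

End Bias.

(** * Constants free of the sizes, and the three special cases *)

Section RateConstants.
Variable R : realType.

Lemma sample_rate (n ku : nat) (a alphas : R) : (0 < n)%N -> 0 < a ->
  n%:R `^ (1 / (2 * alphas + 1)) <= 2 `^ ku%:R ->
  2 `^ (- (2 * a) * ku%:R) <= n%:R `^ (- (2 * a) / (2 * alphas + 1)) :> R.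
Proof.
move=> n0 a0 h; have n0' : 0 < n%:R :> R by rewrite ltr0n.
have a2 : 0 <= 2 * a by rewrite mulr_ge0// ltW.
move: h; rewrite (_ : - (2 * a) / (2 * alphas + 1) = 1 / (2 * alphas + 1) * - (2 * a)).
  2: by rewrite mul1r mulrC.
move: (2 * a) (1 / _) a2 => e d e0 h.
rewrite (mulrC (- e)) (powRrM 2) (powRrM n%:R) (powRN (2 `^ _)) (powRN (n%:R `^ _)).
rewrite lef_pV2 ?posrE; [|exact/powR_gt0/powR_gt0|exact/powR_gt0/powR_gt0].
by apply: ge0_ler_powR; rewrite ?nnegrE ?powR_ge0.
Qed.

(** The full geometric series of ratio 2^(- |c| / (1 - q/2)), whatever the number of levels. *)
Definition Jc_bound (c q : R) : R :=
  (1 + (2 `^ (`|c| / (1 - q / 2)) - 1)^-1) `^ (1 - q / 2).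

Lemma Jc_le (c q : R) k1 k2 : c != 0 -> 0 <= q <= 1 -> Jc c q k1 k2 <= Jc_bound c q.
Proof.
move=> c0 q01; have q2 : 0 < 1 - q / 2 by lra.
set d := `|c| / (1 - q / 2).
have d0 : 0 < d by rewrite divr_gt0// normr_gt0.
have x1 : 1 < 2 `^ d by apply: powR_gt1 => //; rewrite ltr1n.
have x01 : 0 < (2 `^ d)^-1 < (1 : R).
  by rewrite invr_gt0 (lt_trans _ x1)//= invf_lt1// (lt_trans _ x1).
have e (k : nat) : 2 `^ (- d * k%:R) = (2 `^ d)^-1 ^+ k :> R.
  by rewrite -powRN -(@powR_mulrn R _ k (powR_ge0 _ _)) -powRrM.
have i0 : 0 <= (2 `^ d - 1)^-1 :> R by rewrite invr_ge0 subr_ge0 ltW.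
have tail (k m : nat) : \sum_(k.+1 <= i < m) 2 `^ (- d * i%:R) <= (2 `^ d - 1)^-1 :> R.
  rewrite (eq_bigr (fun i => (2 `^ d)^-1 ^+ i)) => [|i _]; last exact: e.
  apply: le_trans (geometric_tail_le k m x01) _; rewrite invrK ler_piMl//.
  by have /andP[x_0 x_1] := x01; rewrite exprn_ile1// ltW.
have b0 : 0 <= 1 + (2 `^ d - 1)^-1 :> R by rewrite addr_ge0.
rewrite /Jc /Jc_bound -/d; case: ifPn => hc; apply: ge0_ler_powR; rewrite ?nnegrE ?(ltW q2)//.
- by apply: sumr_ge0 => k _; rewrite powR_ge0.
- rewrite (eq_bigr (fun k => 2 `^ (- d * k%:R))) => [|k _].
    by apply: le_trans (tail _ _) _; rewrite lerDr.
  by congr powR; rewrite /d ler0_norm//; ring.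
- by apply: sumr_ge0 => k _; rewrite powR_ge0.
rewrite -ltNge in hc; rewrite (eq_bigr (fun k => 2 `^ (- d * k%:R))) => [|k _]; last first.
  by congr powR; rewrite /d gtr0_norm//; ring.
have [->|kN] := posnP (k2 - k1)%N; first by rewrite big_geq.
rewrite big_ltn// mulr0 powRr0 lerD2l; exact: tail.
Qed.

Definition Jrate_bound (q alpha alpha0 : R) : R :=
  let r := rho q alpha alpha0 in
  Jprefactor r * Jc_bound (1 - q / 2 - alpha0 * q) q `^ (1 - r)
               * Jc_bound (alpha - 2^-1) 1 `^ r.

(** The excluded [alpha0] is the value at which [1 - q / 2 - alpha0 * q] vanishes; the sum in [Jc]
    then counts the levels and has no uniform bound. *)
Lemma Jrate_le (q alpha alpha0 : R) kl ku : 0 <= q <= 1 -> 2^-1 < alpha ->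
  (q <> 0 -> alpha0 <> 1 / q - 2^-1) ->
  Jrate q alpha alpha0 kl ku <= Jrate_bound q alpha alpha0.
Proof.
move=> q01 ha hN; have r0 := rho_ge0 q alpha0 ha; have r1 := rho_lt1 q alpha0 ha.
rewrite /Jrate /Jrate_bound; set r := rho _ _ _ in r0 r1 *.
have c0 : 1 - q / 2 - alpha0 * q != 0.
  apply/eqP => h; have [q_0|/eqP qN] := eqVneq q 0.
    by move/eqP: h; rewrite q_0 mul0r mulr0 !subr0 oner_eq0.
  apply: (hN qN); move/eqP: qN => qN.
  have -> : alpha0 = (alpha0 * q) / q by rewrite mulfK.
  by rewrite (_ : alpha0 * q = 1 - q / 2); [field|lra].
have a0 : alpha - 2^-1 != 0 by rewrite subr_eq0 gt_eqF.
have q1_01 : (0 : R) <= 1 <= (1 : R) by rewrite ler01 lexx.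
have r1' : 0 <= 1 - r by rewrite subr_ge0 ltW.
have h1 := Jc_le kl ku c0 q01; have h2 := Jc_le kl ku a0 q1_01.
have m (x y e : R) : 0 <= e -> 0 <= x -> x <= y -> x `^ e <= y `^ e.
  by move=> e0 x0 xy; apply: ge0_ler_powR; rewrite ?nnegrE// (le_trans x0).
have {}h1 := m _ _ _ r1' (Jc_ge0 _ _ _ _) h1; have {}h2 := m _ _ _ r0 (Jc_ge0 _ _ _ _) h2.
apply: ler_pM h2; [|exact: powR_ge0|].
  by apply: mulr_ge0 (powR_ge0 _ _); exact: Jprefactor_ge0.
by apply: ler_wpM2l h1; exact: Jprefactor_ge0.
Qed.

Lemma Jrate_bound_ge0 (q alpha alpha0 : R) : 2^-1 < alpha ->
  0 <= Jrate_bound q alpha alpha0.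
Proof.
move=> ha; have r0 := rho_ge0 q alpha0 ha; have r1 := rho_lt1 q alpha0 ha.
rewrite /Jrate_bound; apply: mulr_ge0 (powR_ge0 _ _).
by apply: mulr_ge0 (powR_ge0 _ _); exact: Jprefactor_ge0.
Qed.

End RateConstants.

Section Complexity.
Variables (R : realType) (n p : nat) (J1 : {set 'I_p}) (dpar : 'I_p -> nat).
Variables (kl : nat) (U : design R n J1 dpar kl) (beta : coefs R J1 dpar kl).

Lemma expe2_poweR (x : \bar R) : (0 <= x)%E -> (x ^+ 2 = x `^ 2)%E.
Proof.
case: x => [x| |]//; last by rewrite expe2 mulyy poweRyr// pnatr_eq0.
by rewrite lee_fin => x0; rewrite -EFin_expe poweR_EFin powR_mulrn.
Qed.

Lemma poweR_le (x y : \bar R) (e : R) : 0 <= e -> (0 <= x)%E -> (x <= y)%E ->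
  (x `^ e <= y `^ e)%E.
Proof.
move=> e0 x0 xy; apply: gt0_ler_poweR; rewrite ?in_itv/= ?leey ?andbT//.
exact: le_trans xy.
Qed.

Lemma sobolev_active a j : j \in J1 -> sobolev U beta a j != 0%E -> active U beta j.
Proof.
move=> jJ; apply: contraNT => /asboolPn h; apply/eqP/sobolev_eq0P => k klk.
have [bE|bN] := eqVneq (block U beta j k) 0; first by rewrite /level_norm bE norm2n0.
by case: h; exists k; rewrite /inK jJ (ltnW klk); split => //; apply/eqP.
Qed.

Lemma M_power_le_count a (e : R) (s0 : nat) : 0 < e -> (num_active U beta <= s0)%N ->
  (M U beta a e%:E `^ e <= s0%:R%:E * M U beta a +oo `^ e)%E.
Proof.
move=> e0 hs.
have [[j jJ sE]|[s sE s_ge0]] := sobolev_fin_or U beta a.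
  have s00 : (0 < s0)%N.
    apply: leq_trans hs; apply/card_gt0P; exists j.
    by apply: (sobolev_active (a := a) jJ); rewrite sE.
  have := sobolev_le_M (q := +oo%E) U beta a jJ; rewrite ltry => /(_ isT).
  rewrite sE leye_eq => /eqP ->.
  by rewrite poweRyr ?gt_eqF// gt0_muley ?leey// lte_fin ltr0n.
rewrite (M_fin e0 sE) (M_fin_oo sE) !poweR_EFin -EFinM lee_fin.
rewrite -powRrM mulVf ?gt_eqF// powRr1; last by apply: sumr_ge0 => j _; rewrite powR_ge0.
set m := \big[Num.max/0]_(j in J1) s j.
have hm j : j \in J1 -> s j `^ e <= m `^ e.
  move=> jJ; have h : s j <= m by apply: le_bigmax_cond.
  apply: ge0_ler_powR; rewrite ?nnegrE ?(ltW e0)//; exact: le_trans h.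
apply: (@le_trans _ _ (\sum_(j in [set j | active U beta j]%SET) m `^ e)).
  rewrite big_mkcond [leRHS]big_mkcond; apply: ler_sum => j _; rewrite inE.
  case: ifPn => jJ; last by case: ifP => // _; rewrite powR_ge0.
  case: ifPn => [_|hj]; first exact: hm.
  have [sj|sj] := eqVneq (s j) 0; first by rewrite sj powR0 ?gt_eqF.
  by case/negP: hj; apply: (sobolev_active (a := a) jJ); rewrite sE// eqe.
rewrite sumr_const -[leLHS]mulr_natl ler_wpM2r ?powR_ge0// ler_nat.
by apply: leq_trans hs; rewrite /num_active cardsE.
Qed.

(** Each norm s is at most the q-measure m, so s = s^q s^(1-q) <= s^q m^(1-q), and the s^q add up to
    m^q. *)
Lemma M1_le_M a (q : R) : 0 < q <= 1 -> (M U beta a 1 <= M U beta a q%:E)%E.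
Proof.
move=> /andP[q0 q1].
have [[j jJ sE]|[s sE s_ge0]] := sobolev_fin_or U beta a.
  have := sobolev_le_M (q := q%:E) U beta a jJ; rewrite lte_fin => /(_ q0).
  by rewrite sE leye_eq => /eqP ->; rewrite leey.
rewrite (M_fin ltr01 sE) (M_fin q0 sE) lee_fin invr1 powRr1; last first.
  by apply: sumr_ge0 => j _; rewrite powR_ge0.
rewrite (eq_bigr s) => [|j _]; last by rewrite powRr1.
set A := \sum_(j in J1) s j `^ q.
have A0 : 0 <= A by apply: sumr_ge0 => j _; rewrite powR_ge0.
set m := A `^ q^-1; have m0 : 0 <= m by rewrite powR_ge0.
have mq : m `^ q = A by rewrite /m -powRrM mulVf ?gt_eqF// powRr1.
have hm j : j \in J1 -> s j <= m.
  move=> jJ; rewrite -[s j]powRr1// -(mulfV (lt0r_neq0 q0)) powRrM.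
  apply: ge0_ler_powR; rewrite ?nnegrE ?invr_ge0 ?powR_ge0 ?(ltW q0)//.
  rewrite /A (bigD1 j)//= lerDl; apply: sumr_ge0 => i _; exact: powR_ge0.
have e (x : R) : 0 <= x -> x = x `^ q * x `^ (1 - q).
  have q_1 : q + (1 - q) = 1 by ring.
  move=> x0; rewrite -powRD q_1; first by rewrite powRr1.
  by rewrite oner_eq0.
rewrite [leRHS]e// mq mulr_suml; apply: ler_sum => j jJ; rewrite [leLHS]e//.
apply: ler_wpM2l; first exact: powR_ge0.
by apply: ge0_ler_powR; rewrite ?nnegrE ?subr_ge0 ?hm.
Qed.

(** The measure of index 0 is a limit: +oo with two nonzero norms, the norm itself with one, while
    with none the count on the left is 0. This reconciles the limit with the counting factor at
    [q = 0]. *)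
Lemma M0_ge a (r : R) : 0 < r < 1 ->
  (((#|[pred j in J1 | sobolev U beta a j != 0%E]|%:R) `^ (1 - r))%:E *
    M U beta a 1 `^ r <= M U beta a 0%:E `^ r)%E.
Proof.
move=> /andP[r0 r1]; set N := #|_|.
have [->|N0] := posnP N; first by rewrite powR0 ?subr_eq0 ?gt_eqF// mul0e poweR_ge0.
have MposE (x : R) : 0 < x -> Mpos U beta a x = M U beta a x%:E.
  by move=> x0; rewrite /= gt_eqF.
have lim_near l : (\forall x \near 0^'+, Mpos U beta a x = l) -> M U beta a 0%:E = l.
  move=> h; rewrite /= eqxx; apply: cvg_lim => //; exact: cvg_near_cst.
have [[j jJ sE]|[s sE s_ge0]] := sobolev_fin_or U beta a.
  rewrite (lim_near +oo%E); first by rewrite poweRyr ?leey// gt_eqF.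
  near=> x; have x0 : 0 < x by near: x; exact: nbhs_right_gt.
  have := sobolev_le_M (q := x%:E) U beta a jJ; rewrite lte_fin => /(_ x0).
  by rewrite sE leye_eq MposE// => /eqP.
have [N2|N1] := ltnP 1 N.
  have /card_gt1P[i [k [+ + ik]]] := N2; rewrite !inE => /andP[iJ] + /andP[kJ].
  rewrite !sE// !eqe => si sk.
  set m := Num.min (s i) (s k).
  have m0 : 0 < m by rewrite lt_min !lt_def si sk !s_ge0.
  suff -> : M U beta a 0%:E = +oo%E by rewrite poweRyr ?leey// gt_eqF.
  rewrite /= eqxx; apply: cvg_lim => //; apply/cvgeyPge => A.
  have A1 : 0 < `|A| + 1 by rewrite ltr_wpDl.
  have l2 : 0 < ln 2 :> R by rewrite ln_gt0// ltr1n.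
  near=> x.
  have x0 : 0 < x by near: x; exact: nbhs_right_gt.
  have xV : 0 <= x^-1 by rewrite invr_ge0 ltW.
  rewrite MposE// (M_fin x0 sE) lee_fin.
  have h1 : 2 * m `^ x <= \sum_(j in J1) s j `^ x.
    rewrite (bigD1 i)//= (bigD1 k)/=; last by rewrite kJ eq_sym.
    have mx (y : R) : m <= y -> m `^ x <= y `^ x.
      move=> my; apply: ge0_ler_powR; rewrite ?nnegrE ?(ltW x0) ?(ltW m0)//.
      by rewrite (le_trans (ltW m0)).
    have := mx (s i); rewrite ge_min lexx => /(_ isT).
    have := mx (s k); rewrite ge_min lexx orbT => /(_ isT).
    have : 0 <= \sum_(j in J1 | (j != i) && (j != k)) s j `^ x.
      by apply: sumr_ge0 => j _; rewrite powR_ge0.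
    rewrite (eq_bigl (fun j => [&& j \in J1, j != i & j != k])) => [|j]; last by [].
    rewrite (eq_bigl (fun j => (j \in J1) && (j != i) && (j != k))) => [|j]; last by rewrite andbA.
    by lra.
  have m20 : 0 <= 2 * m `^ x by rewrite mulr_ge0 ?powR_ge0.
  have h2 : (2 * m `^ x) `^ x^-1 <= (\sum_(j in J1) s j `^ x) `^ x^-1.
    by apply: ge0_ler_powR => //; rewrite nnegrE// (le_trans m20).
  apply: le_trans h2; rewrite powRM ?powR_ge0// -powRrM mulfV ?gt_eqF// powRr1 ?(ltW m0)//.
  (* The lower bound is 2^(1/x) m, and 2^(1/x) >= ln 2 / x is unbounded as [x] tends to 0. *)
  have h3 : x^-1 * ln 2 <= 2 `^ x^-1.
    by rewrite /powR pnatr_eq0/=; apply: le_trans (expR_ge1Dx _); rewrite lerDr.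
  have h4 : A <= x^-1 * ln 2 * m.
    rewrite -mulrA mulrC ler_pdivlMr//.
    have xA : x <= ln 2 * m / (`|A| + 1).
      apply: ltW; near: x; apply: nbhs_right_lt.
      by apply: divr_gt0 => //; exact: mulr_gt0.
    rewrite ler_pdivlMr// in xA; have hA := ler_norm A; nra.
  by apply: le_trans h4 _; rewrite ler_wpM2r// ltW.
have {N0 N1}NE : N = 1%N by apply/eqP; rewrite eqn_leq N1.
have /fintype.card1P[i hi] : #|[pred j in J1 | sobolev U beta a j != 0%E]| == 1%N by apply/eqP.
have iJ : i \in J1 by have := hi i; rewrite !inE eqxx => /andP[].
have M_i (x : R) : 0 < x -> M U beta a x%:E = (s i)%:E.
  move=> x0; rewrite (M_fin x0 sE) (bigD1 i)//= big1 => [|j /andP[jJ ji]].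
    by rewrite addr0 -powRrM mulfV ?gt_eqF// powRr1.
  have := hi j; rewrite !inE jJ (negbTE ji) /= sE// eqe => /negbFE/eqP ->.
  by rewrite powR0 ?gt_eqF.
rewrite NE powR1 mul1e (lim_near (s i)%:E); first by rewrite M_i.
near=> x; have x0 : 0 < x by near: x; exact: nbhs_right_gt.
by rewrite MposE// M_i.
Unshelve. all: by end_near.
Qed.

End Complexity.

Section Combination.
Variables (R : realType) (n p : nat) (J1 : {set 'I_p}) (dpar : 'I_p -> nat).
Variables (kl ku : nat) (U : design R n J1 dpar kl) (beta : coefs R J1 dpar kl).

Lemma Cpred_star_ge0 (lam : nat -> R) (A0 xi : R) (S : {set 'I_p * 'I_ku.+1}) :
  (0 <= Cpred_star U lam A0 xi S)%E.
Proof.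
rewrite /Cpred_star le_max; apply/orP; left.
by rewrite lee_fin mulr_ge0// sqr_ge0.
Qed.

Lemma bound_combine (e b X Y A B D C : \bar R) (c1 c2 c3 c : R) :
  (0 <= C)%E -> (C <= c%:E)%E -> (0 <= A)%E -> (0 <= B)%E -> (0 <= D)%E ->
  (0 <= X)%E -> (0 <= Y)%E ->
  0 <= c1 -> 0 <= c2 -> 0 <= c3 ->
  (e <= b + C * (X + Y))%E ->
  (b <= c1%:E * A)%E -> (X <= c2%:E * B)%E -> (Y <= c3%:E * D)%E ->
  (e <= (c1 + `|c| * (c2 + c3) + 1)%:E * (A + B + D))%E.
Proof.
move=> C0 Cc A_ge0 B_ge0 D_ge0 X0 Y0 c10 c20 c30 he hb hX hY.
have c0 := normr_ge0 c.
have K0 : 0 <= `|c| * (c2 + c3) + 1 by rewrite addr_ge0 ?mulr_ge0 ?addr_ge0.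
apply: le_trans he _.
have -> (k : \bar R) : (k * (A + B + D) = k * A + (k * B + k * D))%E.
  by rewrite ge0_muleDr ?adde_ge0// ge0_muleDr// addeA.
apply: leeD.
  apply: le_trans hb _; apply: lee_wpmul2r => //; rewrite lee_fin.
  by rewrite -addrA lerDl.
have h1 : (C * (X + Y) <= `|c|%:E * (c2%:E * B + c3%:E * D))%E.
  apply: (@le_trans _ _ (`|c|%:E * (X + Y))%E).
    apply: lee_wpmul2r; first by rewrite adde_ge0.
    by apply: le_trans Cc _; rewrite lee_fin ler_norm.
  by apply: lee_wpmul2l; [rewrite lee_fin|exact: leeD].
apply: le_trans h1 _; rewrite ge0_muleDr ?mule_ge0 ?lee_fin// !muleA -!EFinM.
by apply: leeD; apply: lee_wpmul2r => //; rewrite lee_fin; nra.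
Qed.

Variables (sigma eps : R).
Hypotheses (n0 : (0 < n)%N) (s0 : 0 < sigma) (klu : (kl <= ku)%N).
Hypotheses (L1 : 1 <= Lpe p eps) (Ll : 2 `^ (kl%:R - 1) < Lpe p eps).
Hypothesis (Lu : Lpe p eps <= 2 `^ kl%:R).
Notation lam := (lambda sigma p eps).
Notation lam0 := (lambda0 sigma p eps).

Lemma MBR_ge0 q : 0 <= MBR U lam lam0 beta q.
Proof.
apply: sumr_ge0 => j _; rewrite mulr_ge0 ?powR_ge0//.
by case: ifP => // _; exact: powR_ge0.
Qed.

(** From 2^kl < 2 [Lpe] and (x + y)^2 <= 2 x^2 + 2 y^2, the squared penalty level at [kl] is at most
    6 times that of [lam0]; each active component costs at most one such term. *)
Lemma MBR0_le (m : nat) : (num_active U beta <= m)%N ->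
  lam0 `^ (2 - 0) * MBR U lam lam0 beta 0 <= 6 * (m%:R * lam0 ^+ 2).
Proof.
move=> hm; have l0 : 0 < lam0 by exact: lambda0_gt0.
have lk : 0 < lam kl by exact: lambda_gt0.
have h6 : lam kl ^+ 2 <= 6 * lam0 ^+ 2.
  rewrite /lambda /lambda0 powR2_half.
  have h2 : 2 ^+ kl <= 2 * Lpe p eps.
    have -> : 2 ^+ kl = 2 `^ (kl%:R - 1) * 2 :> R.
      by rewrite -[X in _ * X]powRr1// -pow2D subrK powR_mulrn.
    by rewrite mulrC ler_pM2l// ltW.
  set x := Num.sqrt _; set y := Num.sqrt _.
  have xE : x ^+ 2 = 2 ^+ kl by rewrite sqr_sqrtr// exprn_ge0.
  have yE : y ^+ 2 = Lpe p eps by rewrite sqr_sqrtr// (le_trans _ L1).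
  rewrite 2!exprMn [leRHS]mulrCA ler_wpM2l ?sqr_ge0//.
  move: h2; rewrite -xE -yE => h2; have := sqr_ge0 (x - y); nra.
rewrite subr0 powR_mulrn ?(ltW l0)// /MBR mulr_sumr.
apply: (@le_trans _ _ (\sum_(j in [set j | active U beta j]%SET) 6 * lam0 ^+ 2)).
  rewrite [leRHS]big_mkcond; apply: ler_sum => j _; rewrite inE.
  rewrite subr0 powR_mulrn ?divr_ge0 ?(ltW l0) ?(ltW lk)// powRr0.
  have [bE|bN] := eqVneq (block U beta j kl) 0.
    by rewrite !mulr0; case: ifP => // _; rewrite mulr_ge0 ?sqr_ge0.
  have -> : active U beta j.
    by apply/asboolP; exists kl; rewrite /inK leqnn eqxx orbT; split => //; apply/eqP.
  by rewrite mulr1 expr_div_n mulrC divfK// expf_eq0/= gt_eqF.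
rewrite sumr_const -[leLHS]mulr_natl mulrCA ler_wpM2l// ler_wpM2r ?sqr_ge0// ler_nat.
by apply: leq_trans hm; rewrite /num_active cardsE.
Qed.

Lemma min_sum_rate q q0 alpha (alpha0 : R) (q1 q2 : \bar R) :
  let r := rho q alpha alpha0 in
  0 <= q <= 1 -> 0 <= q0 <= 1 -> 0 <= alpha0 <= alpha -> 2^-1 < alpha ->
  (r%:E <= q1)%E -> (0 <= q2)%E -> conjugate q r q1 q2 ->
  ((min_sum ku U lam beta)%:E <=
   (4 * sigma `^ gamma q alpha alpha0 * Jrate q alpha alpha0 kl ku)%:E
     * Mfactor U beta alpha0 q r q1 q2 * (M U beta alpha q1 `^ r)
   + (lam0 `^ (2 - q0) * MBR U lam lam0 beta q0)%:E)%E.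
Proof.
move=> r q01 q001 a0a ha rq1 q20 conj.
have h := min_sum_le U beta s0 klu L1 Lu q001.
apply: (@le_trans _ _ (4%:E * (\sum_(j in J1) \sum_(kl.+1 <= k < ku.+1)
    level_min sigma (level_norm U beta j) k)%:E
    + (lam0 `^ (2 - q0) * MBR U lam lam0 beta q0)%:E)%E).
  by rewrite -EFinM -EFinD lee_fin addrC.
apply: leeD => //; rewrite -mulrA EFinM -2!muleA; apply: lee_wpmul2l.
  by rewrite lee_fin.
by rewrite muleA; exact: rate_sum.
Qed.

End Combination.

Section SpecialRates.
Variable R : realType.
Implicit Types q alpha : R.

Lemma rho_q0 alpha (alpha0 : R) : 2^-1 < alpha -> rho 0 alpha alpha0 = 2 / (2 * alpha + 1).
Proof. by move=> ha; rewrite /rho gap_q0; field; repeat (apply/andP; split); apply/eqP; lra. Qed.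

Lemma gamma_q0 alpha (alpha0 : R) : 2^-1 < alpha ->
  gamma 0 alpha alpha0 = 4 * alpha / (2 * alpha + 1).
Proof. by move=> ha; rewrite /gamma gap_q0; field; repeat (apply/andP; split); apply/eqP; lra. Qed.

Lemma gamma_diag q alpha : 0 <= q <= 1 -> 2^-1 < alpha ->
  gamma q alpha alpha = Num.min (4 * alpha / (2 * alpha + 1)) (2 - q).
Proof.
move=> /andP[q0 q1] ha; have d0 : 0 < 2 * alpha + 1 by lra.
have gE : 1 - q / 2 - q * alpha = 1 - q * (alpha + 2^-1) by lra.
rewrite /gamma /gap gE; case: (leP 0 (1 - q * (alpha + 2^-1))) => h; last first.
  rewrite min_r.
    by rewrite !addr0; field; apply/eqP; lra.
  rewrite ler_pdivlMr//; nra.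
rewrite min_l; last by rewrite ler_pdivrMr//; nra.
(* The denominator is (1 - q) (alpha + 1/2); with a nonnegative gap, [q = 1] would contradict alpha
   > 1/2. *)
have [q_1|q_lt1] := eqVneq q 1.
  exfalso; move: h; rewrite q_1; lra.
have q_1 : q < 1 by rewrite lt_def eq_sym q_lt1.
have d1 : 0 < (1 - q) * (alpha + 2^-1) by rewrite mulr_gt0//; lra.
by field; repeat (apply/andP; split); apply/eqP; lra.
Qed.

Lemma gap_0 q : 0 <= q <= 1 -> gap q 0 = 1 - q / 2.
Proof. by move=> q01; rewrite /gap mulr0 subr0 max_r//; lra. Qed.

Lemma gamma_0 q alpha : 0 <= q <= 1 -> 2^-1 < alpha ->
  gamma q alpha 0 = (2 - q) * (2 * alpha) / (2 * alpha + 1 - q).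
Proof.
by move=> q01 ha; rewrite /gamma gap_0//; field; repeat (apply/andP; split); apply/eqP; lra.
Qed.

Lemma rho_0 q alpha : 0 <= q <= 1 -> 2^-1 < alpha ->
  rho q alpha 0 = gamma q alpha 0 / (2 * alpha).
Proof.
move=> q01 ha; rewrite gamma_0// /rho gap_0//; field.
by repeat (apply/andP; split); apply/eqP; lra.
Qed.

End SpecialRates.

Section SpecialComplexity.
Variables (R : realType) (n p : nat) (J1 : {set 'I_p}) (dpar : 'I_p -> nat).
Variables (kl : nat) (U : design R n J1 dpar kl) (beta : coefs R J1 dpar kl).
Variable alpha : R.
Hypothesis ha : 2^-1 < alpha.

(** With [q1 = r] the count has exponent 0; the sparsity comes back when the power sum is bounded by
    its largest term. *)
Lemma complexity_sparse (alpha0 : R) (q2 : \bar R) (s0 : nat) :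
  let r := rho 0 alpha alpha0 in (num_active U beta <= s0)%N ->
  (Mfactor U beta alpha0 0 r r%:E q2 * M U beta alpha r%:E `^ r <=
   s0%:R%:E * M U beta alpha +oo `^ r)%E.
Proof.
move=> r hs; have r0 : 0 < r by rewrite /r rho_q0// divr_gt0//; have := ha; lra.
rewrite /Mfactor eqxx inver (gt_eqF r0) -EFinM mulfV ?(gt_eqF r0)//= subrr powRr0 mul1e.
exact: M_power_le_count.
Qed.

(** Since 2 - gamma = q (1 - rho) + rho, the two factors merge once the measure of index 1 is below
    that of index q; [q = 0] rests on the limit meaning of index 0. *)
Lemma complexity_diag q : let r := rho q alpha alpha in 0 <= q <= 1 ->
  (Mfactor U beta alpha q r 1 q%:E * M U beta alpha 1 `^ r <=
   M U beta alpha q%:E `^ (2 - gamma q alpha alpha))%E.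
Proof.
move=> r /andP[q0 q1]; have r0 := rho_ge0 q alpha ha; have r1 := rho_lt1 q alpha ha.
rewrite gamma_rho// -/r in r0 r1 *.
rewrite (_ : 2 - _ = q * (1 - r) + r); last by ring.
have [q_0|qN] := eqVneq q 0.
  have rp : 0 < r by rewrite /r q_0 rho_q0// divr_gt0//; have := ha; lra.
  rewrite /Mfactor q_0 eqxx inver oner_eq0 invr1 mule1 mul0r add0r.
  by apply: M0_ge; rewrite rp.
have qp : 0 < q by rewrite lt_def qN.
rewrite /Mfactor (negbTE qN).
have M0 : (0 <= M U beta alpha q%:E)%E by apply: M_ge0; rewrite lte_fin.
rewrite poweRD; last first.
  by apply: add_neq0_poweRD_def; rewrite gt_eqF// ltr_pwDl// mulr_gt0// subr_gt0 r1.
apply: lee_wpmul2l; first exact: poweR_ge0.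
apply: poweR_le => //; first exact: M_ge0.
by apply: M1_le_M; rewrite qp.
Qed.

End SpecialComplexity.

(** [C1] and [C2] are chosen before the dimensions, the design, the signal and the noise, which is
    the meaning given to inequalities up to a constant. The event precedes all indices, so (i) to
    (iii) hold on it as well. *)
Theorem theorem2 (R : realType) :
  exists (C1 : R -> R) (C2 : R -> R -> R -> R -> R -> R),
  forall (n p : nat) (J1 : {set 'I_p}) (dpar : 'I_p -> nat) (kl ku : nat)
    (U : design R n J1 dpar kl) (beta : coefs R J1 dpar kl)
    (sigma eps alphas A0 : R)
    (disp : measure_display) (T : measurableType disp) (P : probability T R)
    (noise : 'I_n -> {RV P >-> R}),
  (0 < n)%N ->
  (forall j, j \notin J1 -> (0 < dpar j <= 2 ^ kl)%N) ->
  fcomp_cvg U beta ->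
  0 < sigma ->
  iid_normal sigma noise ->
  0 < eps <= 1 ->
  1 <= Lpe p eps ->
  2 `^ (kl%:R - 1) < Lpe p eps <= 2 `^ kl%:R ->
  (kl <= ku)%N ->
  0 < alphas ->
  n%:R `^ (1 / (2 * alphas + 1)) <= 2 `^ ku%:R ->
  1 < A0 ->
  let fstar := ftrue U beta in
  let y := fun w : T => fstar + \col_(i < n) noise i w in
  let sigman := sigma / Num.sqrt n%:R in
  let lam := lambda sigman p eps in
  let lam0 := lambda0 sigman p eps in
  let fbar := fit ku U beta in
  let xi := (A0 + 1) / (A0 - 1) in
  let S := strong_set ku U lam A0 beta in
  let Cstar := Cpred_star U lam A0 xi S in
  exists E : set T,
    [/\ measurable E,
        ((1 - eps / Num.sqrt (Lpe p eps))%:E <= P E)%E &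
    forall w, E w ->
    forall bhat : coefs R J1 dpar kl, is_mrgl ku U lam A0 (y w) bhat ->
    forall (q q0 alpha alpha0 : R) (q1 q2 : \bar R),
    0 <= q <= 1 -> 0 <= q0 <= 1 ->
    0 <= alpha0 <= alpha -> 2^-1 < alpha ->
    let g := gamma q alpha alpha0 in
    let r := rho q alpha alpha0 in
    (r%:E <= q1)%E -> (0 <= q2)%E -> conjugate q r q1 q2 ->
    let fhat := fit ku U bhat in
    let nrate := n%:R `^ (- (2 * alpha) / (2 * alphas + 1)) in
    let lhs := (norm2n (fhat - fbar) ^+ 2 + norm2n (fhat - fstar) ^+ 2)%:E in
    let err := (norm2n (fhat - fstar) ^+ 2)%:E in
    let main := (Cstar *
      ((4 * sigman `^ g * Jrate q alpha alpha0 kl ku)%:E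
         * Mfactor U beta alpha0 q r q1 q2
         * (M U beta alpha q1 `^ r)
       + (lam0 `^ (2 - q0) * MBR U lam lam0 beta q0)%:E))%E in
    [/\ (lhs <= (2 * nrate / (4 `^ alpha - 1))%:E * M U beta alpha 1 ^+ 2
                + main)%E,
        (forall cA : R, condA ku U cA beta ->
          (lhs <= (2 * nrate / (4 `^ alpha - 1))%:E
                    * ((C1 cA)%:E * M U beta alpha 2%:E ^+ 2)
                  + main)%E) &
        forall cA cP : R,
        condA ku U cA beta -> (Cstar <= cP%:E)%E ->
        (q <> 0 -> alpha0 <> 1 / q - 2^-1) ->
        let C := (C2 cA cP alpha alpha0 q)%:E in
        [/\
          (* (i) *)
          forall s0 : nat,
          q = 0 -> q1 = r%:E -> q0 = 0 ->
          (num_active U beta <= s0)%N ->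
          [/\ g = 4 * alpha / (2 * alpha + 1),
              g = 2 - r &
              (err <= C *
                ((s0%:R * nrate)%:E * M U beta alpha +oo ^+ 2
                 + (s0%:R * sigman `^ (4 * alpha / (2 * alpha + 1)))%:E
                     * (M U beta alpha +oo `^ (2 / (2 * alpha + 1)))
                 + (s0%:R * lam0 ^+ 2)%:E))%E],
          (* (ii) *)
          alpha0 = alpha -> q1 = 1%E -> q2 = q%:E ->
          g = Num.min (4 * alpha / (2 * alpha + 1)) (2 - q) /\
          (err <= C *
            (nrate%:E * M U beta alpha 2%:E ^+ 2
             + (sigman `^ g)%:E * (M U beta alpha q%:E `^ (2 - g))
             + (lam0 `^ (2 - q0) * MBR U lam lam0 beta q0)%:E))%E &
          (* (iii) *)
          alpha0 = 0 -> q1 = 1%E -> q2 = q%:E ->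
          [/\ g = (2 - q) * (2 * alpha) / (2 * alpha + 1 - q),
              r = g / (2 * alpha) &
              (err <= C *
                (nrate%:E * M U beta alpha 2%:E ^+ 2
                 + (sigman `^ g)%:E * Mfactor U beta 0 q r q1 q2
                     * (M U beta alpha 1 `^ r)
                 + (lam0 `^ (2 - q0) * MBR U lam lam0 beta q0)%:E))%E]]]].
Proof.
(* The terms are the bias constant under condition (A), then [cP] times 4 [Jrate_bound] for the rate
   and 6 from [MBR0_le] for the coarse level. *)
exists (fun cA => `|cA| + 1), (fun cA cP alpha alpha0 q =>
  2 / (4 `^ alpha - 1) * (`|cA| + 1) +
  `|cP| * (4 * Jrate_bound q alpha alpha0 + 6) + 1).
move=> n p J1 dpar kl ku U beta sigma eps alphas A0 disp T P noise n0 hd bc s0 hiid.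
move=> heps L1 hL klu as0 hn A01 fstar y sigman lam lam0 fbar xi S Cstar.
have [E [mE PE hE]] := noise_event ku U n0 hd s0 hiid heps L1 hL.
have /andP[Ll Lu] := hL.
exists E; split => // w Ew bhat hmin q q0 alpha alpha0 q1 q2 q01 q001 a0a ha.
move=> g r rq1 q20 hconj fhat nrate lhs err main.
have sn0 : 0 < sigman by rewrite divr_gt0// sqrtr_gt0 ltr0n.
have lam_gt0 k : 0 < lam k by exact: lambda_gt0.
have a_gt0 : 0 < alpha by lra.
have Cs0 : (0 <= Cstar)%E by exact: Cpred_star_ge0.
have Mf0 : (0 <= Mfactor U beta alpha0 q r q1 q2)%E by exact: Mfactor_ge0.
have hmain : (lhs <= (2 * norm2n (fstar - fbar) ^+ 2)%:E + main)%E.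
  apply: le_trans (oracle_inequality beta n0 lam_gt0 A01 (hE w Ew) hmin) _.
  apply: leeD => //; apply: lee_wpmul2l => //.
  exact: min_sum_rate.
have nr : 2 `^ (- (2 * alpha) * ku%:R) <= nrate by exact: sample_rate.
have nr0 : 0 <= nrate by exact: powR_ge0.
have D0 : 0 < 4 `^ alpha - 1 by rewrite subr_gt0 powR_gt1// ltr1n.
split.
- by apply: le_trans hmain _; apply: leeD => //; exact: bias_le_M1.
- by move=> cA hA; apply: le_trans hmain _; apply: leeD => //; exact: bias_le_M2.
move=> cA cP hA hC hN C.
have Jb0 := Jrate_bound_ge0 q alpha0 ha.
have herr : (err <= lhs)%E by rewrite lee_fin lerDr sqr_ge0.
have sg0 : 0 <= sigman `^ g by exact: powR_ge0.
have G0 : 0 <= 4 * sigman `^ g * Jrate q alpha alpha0 kl ku.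
  by apply: mulr_ge0; [exact: mulr_ge0|exact: Jrate_ge0].
have X0 : (0 <= (4 * sigman `^ g * Jrate q alpha alpha0 kl ku)%:E *
    Mfactor U beta alpha0 q r q1 q2 * M U beta alpha q1 `^ r)%E.
  by apply: mule_ge0 (poweR_ge0 _ _); apply: mule_ge0 Mf0; rewrite lee_fin.
have Y0 : 0 <= lam0 `^ (2 - q0) * MBR U lam lam0 beta q0.
  by rewrite mulr_ge0 ?powR_ge0// MBR_ge0.
have M2_0 : (0 <= M U beta alpha 2%:E)%E by apply: M_ge0; rewrite lte_fin.
(* Cases (i) to (iii) differ only in the majorants [A] of the bias, [Z] of the complexity factors
   and [D] of the coarse level. *)
have comb (A Z D : \bar R) : (0 <= Z)%E -> (0 <= D)%E ->
    (nrate%:E * M U beta alpha 2%:E ^+ 2 <= A)%E ->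
    (Mfactor U beta alpha0 q r q1 q2 * M U beta alpha q1 `^ r <= Z)%E ->
    ((lam0 `^ (2 - q0) * MBR U lam lam0 beta q0)%:E <= 6%:E * D)%E ->
    (err <= C * (A + (sigman `^ g)%:E * Z + D))%E.
  move=> Z0 D_0 hA2 hZ hD.
  have A_0 : (0 <= A)%E by apply: le_trans hA2; rewrite mule_ge0 ?expe_ge0.
  apply: bound_combine Cs0 hC A_0 _ D_0 X0 _ _ _ _ (le_trans herr hmain) _ _ hD.
  - by rewrite mule_ge0.
  - by rewrite lee_fin.
  - by rewrite mulr_ge0 ?divr_ge0 ?(ltW D0) ?addr_ge0.
  - by rewrite mulr_ge0.
  - by [].
  - apply: le_trans (bias_le_M2 n0 klu bc a_gt0 nr hA) _.
    have -> : 2 * nrate / (4 `^ alpha - 1) = 2 / (4 `^ alpha - 1) * nrate by ring.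
    rewrite muleA -EFinM mulrAC EFinM -muleA; apply: lee_wpmul2l => //.
    by rewrite lee_fin mulr_ge0 ?divr_ge0 ?(ltW D0) ?addr_ge0.
  have hG : 4 * sigman `^ g * Jrate q alpha alpha0 kl ku <=
      4 * Jrate_bound q alpha alpha0 * sigman `^ g.
    rewrite mulrAC; apply: (ler_wpM2r sg0); apply: ler_wpM2l; first by [].
    exact: Jrate_le.
  rewrite -[leLHS]muleA [leRHS]muleA -[X in (_ <= X * _)%E]EFinM.
  rewrite -lee_fin in hG; rewrite -lee_fin in G0.
  exact: (lee_pmul G0 (mule_ge0 Mf0 (poweR_ge0 _ _)) hG hZ).
(* Only (i) loses the factor 6; (ii) and (iii) weaken to it in order to share [comb]. *)
have hD6 : ((lam0 `^ (2 - q0) * MBR U lam lam0 beta q0)%:E <=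
    6%:E * (lam0 `^ (2 - q0) * MBR U lam lam0 beta q0)%:E)%E.
  by rewrite -EFinM lee_fin ler_peMl// ler1n.
split.
- move=> m q_0 q1E q0_0 hm.
  have Moo : (0 <= M U beta alpha +oo)%E by exact: M_ge0.
  have gE : g = 4 * alpha / (2 * alpha + 1) by rewrite /g q_0 gamma_q0.
  have rE : r = 2 / (2 * alpha + 1) by rewrite /r q_0 rho_q0.
  split => //.
    by rewrite /g gamma_rho// -/r q_0; ring.
  rewrite -gE -rE [X in (_ + X + _)%E](_ : _ = (sigman `^ g)%:E *
      (m%:R%:E * M U beta alpha +oo `^ r))%E; last by rewrite muleA -EFinM mulrC.
  apply: comb.
  + by rewrite mule_ge0 ?poweR_ge0// lee_fin.
  + by rewrite lee_fin mulr_ge0// sqr_ge0.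
  + rewrite !expe2_poweR// (mulrC m%:R) EFinM -muleA; apply: lee_wpmul2l.
      by rewrite lee_fin.
    exact: M_power_le_count.
  + by rewrite q1E /r q_0; exact: complexity_sparse.
  + by rewrite q0_0 -EFinM lee_fin; exact: MBR0_le.
- move=> a0E q1E q2E; split; first by rewrite /g a0E gamma_diag.
  apply: comb => //; first exact: poweR_ge0.
  by rewrite q1E q2E /g /r a0E; exact: complexity_diag.
- move=> a0E q1E q2E; split; [by rewrite /g a0E gamma_0|by rewrite /r /g a0E rho_0|].
  rewrite -muleA; apply: comb => //.
    by rewrite mule_ge0 ?poweR_ge0//; rewrite -a0E.
  by rewrite a0E q1E.
Qed.
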